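(* Let $0<p,\lambda<1$ and let $g$ be an analytic function on the unit disc $\mathbb{D}$. Then the operator $I_g:\mathcal{D}_p^{\lambda}\to\mathcal{D}_p^{\lambda}$, $I_g(f)(z)=\int_0^z f'(w)g(w)\,dw$, is bounded if and only if $g\in H^\infty$.
   Context: $\mathbb{D}$ is the open unit disc in $\mathbb{C}$, $dm$ is planar Lebesgue measure normalized so that $m(\mathbb{D})=1$, and $\mathcal{H}ol(\mathbb{D})$ is the space of analytic functions on $\mathbb{D}$. For $a\in\mathbb{D}$, $\varphi_a(z)=\frac{a-z}{1-\bar a z}$. $H^\infty$ is the space of bounded analytic functions on $\mathbb{D}$. For $p\ge 0$, the weighted Dirichlet space $\mathcal{D}_p$ consists of all $f\in\mathcal{H}ol(\mathbb{D})$ with $\|f\|_{\mathcal{D}_p}^2=|f(0)|^2+\int_{\mathbb{D}}|f'(z)|^2(1-|z|^2)^p\,dm(z)<\infty$. For $\lambda,p\in[0,1]$, the Dirichlet-Morrey space $\mathcal{D}_p^{\lambda}$ consists of all $f\in\mathcal{H}ol(\mathbb{D})$ with $$\|f\|_{\mathcal{D}_p^{\lambda}}=|f(0)|+\sup_{a\in\mathbb{D}}(1-|a|^2)^{\frac p2(1-\lambda)}\|f\circ\varphi_a-f(a)\|_{\mathcal{D}_p}<\infty ;$$ it is a Banach space under this norm. ''Bounded'' means that the operator maps $\mathcal{D}_p^{\lambda}$ into itself and is a bounded linear operator for this norm. *)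

(* Defs.v *)
From mathcomp Require Import all_boot all_order all_algebra.
From mathcomp Require Import complex.
From mathcomp Require Import all_classical all_reals all_analysis.

Set Implicit Arguments.
Unset Strict Implicit.
Unset Printing Implicit Defensive.

Import Order.TTheory GRing.Theory Num.Theory.
Import numFieldNormedType.Exports.
Import ComplexField.Normc.

Local Open Scope classical_set_scope.
Local Open Scope ring_scope.
Local Open Scope complex_scope.

Definition unit_disc (R : realType) : set R[i] := [set z | normc z < 1].

(* R[i] as a field with the topology of its norm, i.e. the usual complex plane. *)
Definition Cfield (R : realType) : numFieldType := R[i].

(* A function on the disc is represented by a total function R[i] -> R[i] whose
   values off the disc are never used.  Both derivable and derive1 below are taken
   over the field R[i], so this is complex differentiability on the disc. *)
Definition holomorphic_on_disc (R : realType) (f : R[i] -> R[i]) : Prop :=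
  forall z, unit_disc z -> derivable (f : Cfield R -> (Cfield R)^o) z 1.

Definition cderive (R : realType) (f : R[i] -> R[i]) : R[i] -> R[i] :=
  derive1 (f : Cfield R -> (Cfield R)^o).

Definition H_infty (R : realType) : set (R[i] -> R[i]) :=
  [set g | holomorphic_on_disc g /\
           exists M : R, forall z, unit_disc z -> normc (g z) <= M].

Definition disc_aut (R : realType) (a z : R[i]) : R[i] :=
  (a - z) / (1 - a^* * z).

(* The factor 1/pi normalizes the area of the disc to 1. *)
Definition disc_integral (R : realType) (F : R[i] -> \bar R) : \bar R :=
  ((pi^-1)%:E *
   \int[@lebesgue_measure R \x @lebesgue_measure R]_(w in
     [set w : R * R | unit_disc (w.1 +i* w.2)]) F (w.1 +i* w.2))%E.

Definition dirichlet_norm (R : realType) (p : R) (f : R[i] -> R[i]) : \bar R :=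
  sqrte ((normc (f 0) ^+ 2)%:E +
         disc_integral (fun z =>
           (normc (cderive f z) ^+ 2 * (1 - normc z ^+ 2) `^ p)%:E))%E.

Definition dirichlet_morrey_norm (R : realType) (p lambda : R)
    (f : R[i] -> R[i]) : \bar R :=
  ((normc (f 0))%:E +
   ereal_sup [set ((1 - normc a ^+ 2) `^ (p / 2 * (1 - lambda)))%:E *
                  dirichlet_norm p (fun z => f (disc_aut a z) - f a)%R
             | a in @unit_disc R])%E.

Definition dirichlet_morrey (R : realType) (p lambda : R) :
    set (R[i] -> R[i]) :=
  [set f | holomorphic_on_disc f /\ (dirichlet_morrey_norm p lambda f < +oo)%E].

(* The integral of F along the segment from 0 to z, parametrized by t |-> t z;
   for F holomorphic on the disc every path in the disc gives the same value. *)
Definition segment_integral (R : realType) (F : R[i] -> R[i]) (z : R[i]) :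
    R[i] :=
  z * ((\int[lebesgue_measure]_(t in `[0%R, 1%R]) complex.Re (F (t%:C * z))) +i*
       (\int[lebesgue_measure]_(t in `[0%R, 1%R]) complex.Im (F (t%:C * z)))).

Definition I_op (R : realType) (g f : R[i] -> R[i]) : R[i] -> R[i] :=
  segment_integral (fun w => cderive f w * g w).

(* Linearity is required up to equality on the disc, where the elements of the
   space live. *)
Definition bounded_on_dirichlet_morrey (R : realType) (p lambda : R)
    (T : (R[i] -> R[i]) -> (R[i] -> R[i])) : Prop :=
  [/\ forall f, dirichlet_morrey p lambda f -> dirichlet_morrey p lambda (T f),
      forall (c : R[i]) f h,
        dirichlet_morrey p lambda f -> dirichlet_morrey p lambda h ->
        forall z, unit_disc z ->
          T (fun w => c * f w + h w) z = c * T f z + T h z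
    & exists2 C : R, 0 <= C &
        forall f, dirichlet_morrey p lambda f ->
          (dirichlet_morrey_norm p lambda (T f) <=
           C%:E * dirichlet_morrey_norm p lambda f)%E].

(* Main.v *)
Require Import Defs.
From mathcomp Require Import all_boot all_order all_algebra.
From mathcomp Require Import complex ring lra.
From mathcomp Require Import all_classical all_reals all_analysis.
From mathcomp Require Import measurable_realfun.

(** If g is bounded, (I_g f)' = f' g gives the bound pointwise under the integral.
    Conversely, for b in the disc the normalized automorphism
    f_b = (1 - |b|^2)^(-p(1-lambda)/2) (phi_b - b) has Morrey norm at most 32, by the
    Forelli-Rudin type estimate
    int (1 - |z|^2)^p / |1 - conj(d) z|^4 dm <= C (1 - |d|^2)^(p-2).
    Since phi_b is an involution, the term a = b of the norm of I_g f_b is the weighted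
    L^2 norm of g o phi_b, which controls |g(phi_b(0))| = |g(b)| by the area mean value
    property applied to (g o phi_b)^2.

    Only complex differentiability is assumed, so that the holomorphy of derivatives and the
    existence of primitives are obtained from Goursat's lemma on rectangles. *)

Set Implicit Arguments.
Unset Strict Implicit.
Unset Printing Implicit Defensive.

Import Order.TTheory GRing.Theory Num.Theory.
Import numFieldNormedType.Exports.
Import ComplexField.Normc.

Local Open Scope classical_set_scope.
Local Open Scope ring_scope.
Local Open Scope complex_scope.

(** The bound on f_b is uniform because phi_b o phi_a differs from phi_d, d = phi_a(b), by a
    unimodular constant: the a-th Morrey term of f_b is governed by the single kernel |phi_d'|, and
    with q = p(1-lambda) <= p the inequality (1-|a|^2)^q (1-|d|^2)^p <= 4^p (1-|b|^2)^q absorbs the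
    normalization of f_b. The constant is 32^2 = 256 * 4, with 256 from the kernel and 4 >= 4^p.

    The complex analysis rests on integrals along horizontal and vertical segments. Contours are
    therefore squares, the integral of dz/(z-b) enters through a lower bound 8/9 on its imaginary
    part, and the mean value property takes the form of an inequality: Cauchy's formula averaged
    over concentric squares. Goursat's lemma admits one point of mere continuity because Cauchy's
    formula applies it to a difference quotient. Holomorphy of f' is what gives f' g a primitive,
    and so identifies the derivative of I_g f. The point estimate is an L^1 bound; the square of g o
    phi_b turns its integrand into that of the L^2 energy. *)

Section ComplexModulus.
Variable R : realType.
Implicit Types (z w : R[i]) (x y : R).

Lemma normc_ge0 z : 0 <= normc z.
Proof. by case: z => a b; rewrite /normc sqrtr_ge0. Qed.

Lemma sqr_normcE z : normc z ^+ 2 = complex.Re z ^+ 2 + complex.Im z ^+ 2.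
Proof. by case: z => a b; rewrite /normc /= sqr_sqrtr // addr_ge0 ?sqr_ge0. Qed.

Lemma normc_gt0 z : z != 0 -> 0 < normc z.
Proof.
move=> z0; rewrite lt_neqAle normc_ge0 andbT eq_sym.
by apply: contra z0 => /eqP/eq0_normc ->.
Qed.

Lemma normcD z w : normc (z + w) <= normc z + normc w.
Proof. exact: (@le_normcD R z w). Qed.

Lemma normcN' z : normc (- z) = normc z.
Proof. exact: (@normcN R z). Qed.

Lemma normcB z w : normc (z - w) <= normc z + normc w.
Proof. by rewrite -[normc w]normcN'; apply: normcD. Qed.

Lemma normc_distC z w : normc (z - w) = normc (w - z).
Proof. by rewrite -normcN' opprB. Qed.

Lemma normc_subl z w : normc z - normc w <= normc (z - w).
Proof. by rewrite lerBlDr -{1}(subrK w z); apply: normcD. Qed.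

Lemma normcX z n : normc (z ^+ n) = normc z ^+ n.
Proof. by elim: n => [|n IH]; rewrite ?expr0 ?normc1// !exprS normcM IH. Qed.

Lemma normcf_div z w : normc (z / w) = normc z / normc w.
Proof. by rewrite normcM normcV. Qed.

Lemma normcJ' z : normc (z^*) = normc z.
Proof. by case: z => a b; rewrite /normc /= sqrrN. Qed.

Lemma normc_real x : normc (x%:C) = `|x|.
Proof. by rewrite /normc /= expr0n /= addr0 sqrtr_sqr. Qed.

Lemma normc_i : normc ('i : R[i]) = 1.
Proof. by rewrite /normc /= expr0n /= add0r expr1n sqrtr1. Qed.

Lemma Re_le_normc z : `|complex.Re z| <= normc z.
Proof.
case: z => a b; rewrite /normc /= -sqrtr_sqr ler_wsqrtr //.
by rewrite lerDl sqr_ge0.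
Qed.

Lemma Im_le_normc z : `|complex.Im z| <= normc z.
Proof.
case: z => a b; rewrite /normc /= -sqrtr_sqr ler_wsqrtr //.
by rewrite lerDr sqr_ge0.
Qed.

Lemma normc_le_ReIm z : normc z <= `|complex.Re z| + `|complex.Im z|.
Proof.
rewrite -(ler_pXn2r (_ : 0 < 2)%N) ?nnegrE ?addr_ge0 ?normr_ge0 ?normc_ge0 //.
rewrite sqr_normcE -(real_normK (num_real (complex.Re z))).
rewrite -(real_normK (num_real (complex.Im z))).
by have := normr_ge0 (complex.Re z); have := normr_ge0 (complex.Im z); nra.
Qed.

(** Dividing by [K + 1] instead of [K] keeps [K = 0] admissible. Most epsilon-delta arguments below
    split their tolerance this way. *)
Lemma exists_small (e K : R) : 0 < e -> 0 <= K -> exists2 d, 0 < d & d * K <= e.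
Proof.
move=> e0 K0; exists (e / (K + 1)); first by apply: divr_gt0 => //; lra.
rewrite mulrAC ler_pdivrMr; nra.
Qed.

End ComplexModulus.

(** * Complex differentiability in epsilon-delta form *)

Section ComplexDerivative.
Variable R : realType.
Implicit Types (f g : R[i] -> R[i]) (z l m h : R[i]).

Definition ccont f z := forall e : R, 0 < e -> exists2 d : R, 0 < d &
  forall h, normc h < d -> normc (f (z + h) - f z) <= e.

(** The remainder form has no quotient, allows [h = 0], and compares real moduli only, so real
    arithmetic tactics apply; [is_cderivP] ties it to the limit of difference quotients over
    R[i]. *)
Definition is_cderiv f z l := forall e : R, 0 < e -> exists2 d : R, 0 < d &
  forall h, normc h < d -> normc (f (z + h) - f z - l * h) <= e * normc h.

Lemma is_cderiv_lip f z l : is_cderiv f z l -> exists2 d : R, 0 < d &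
  forall h, normc h < d -> normc (f (z + h) - f z) <= (normc l + 1) * normc h.
Proof.
move=> /(_ 1 ltr01)[d d0 H]; exists d => // h hd.
have := H _ hd; have := normcD (f (z + h) - f z - l * h) (l * h).
by rewrite subrK normcM; lra.
Qed.

Lemma is_cderiv_cont f z l : is_cderiv f z l -> ccont f z.
Proof.
move=> /is_cderiv_lip[d d0 H] e e0.
have K0 : 0 <= normc l + 1 by have := normc_ge0 l; lra.
have [k k0 ke] := exists_small e0 K0.
exists (Num.min d k) => [|h]; first by rewrite lt_min d0.
rewrite lt_min => /andP[hd hk]; apply: le_trans (H _ hd) _.
by have := normc_ge0 h; nra.
Qed.

Lemma is_cderiv_cst (c : R[i]) z : is_cderiv (fun=> c) z 0.
Proof.
by move=> e e0; exists 1 => // h _; rewrite subrr mul0r subr0 normc0 mulr_ge0 ?normc_ge0 // ltW.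
Qed.

Lemma is_cderiv_id z : is_cderiv id z 1.
Proof.
move=> e e0; exists 1 => // h _.
have -> : z + h - z - 1 * h = 0 by ring.
by rewrite normc0 mulr_ge0 ?normc_ge0 // ltW.
Qed.

Lemma is_cderivD f g z l m : is_cderiv f z l -> is_cderiv g z m ->
  is_cderiv (fun w => f w + g w) z (l + m).
Proof.
move=> Hf Hg e e0; have e20 : 0 < e / 2 by lra.
have [d d0 {}Hf] := Hf _ e20; have [k k0 {}Hg] := Hg _ e20.
exists (Num.min d k) => [|h]; first by rewrite lt_min d0.
rewrite lt_min => /andP[/Hf {}Hf /Hg {}Hg].
have -> : f (z + h) + g (z + h) - (f z + g z) - (l + m) * h =
  (f (z + h) - f z - l * h) + (g (z + h) - g z - m * h) by ring.
by apply: le_trans (normcD _ _) _; lra.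
Qed.

Lemma is_cderivM f g z l m : is_cderiv f z l -> is_cderiv g z m ->
  is_cderiv (fun w => f w * g w) z (l * g z + f z * m).
Proof.
move=> Hf Hg e e0.
have gc := is_cderiv_cont Hg.
have [] := @exists_small R e (3 * (normc (g z) + 1)) => //.
  by have := normc_ge0 (g z); lra.
move=> e1 e10 He1.
have [] := @exists_small R e (3 * (normc (f z))) => //.
  by have := normc_ge0 (f z); lra.
move=> e2 e20 He2.
have [] := @exists_small R e (3 * (normc l)) => //.
  by have := normc_ge0 l; lra.
move=> e3 e30 He3.
have [d1 d10 H1] := Hf _ e10.
have [d2 d20 H2] := Hg _ e20.
have [d3 d30 H3] := gc _ e30.
have [d4 d40 H4] := gc _ ltr01.
exists (Num.min (Num.min d1 d2) (Num.min d3 d4)) => [|h]; first by rewrite !lt_min d10 d20 d30.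
rewrite !lt_min => /andP[/andP[/H1 {}H1 /H2 {}H2] /andP[/H3 {}H3 /H4 {}H4]].
have -> : f (z + h) * g (z + h) - f z * g z - (l * g z + f z * m) * h =
  (f (z + h) - f z - l * h) * g (z + h) + (f z * (g (z + h) - g z - m * h) +
   l * h * (g (z + h) - g z)) by ring.
have gb : normc (g (z + h)) <= normc (g z) + 1.
  by have := normcD (g (z + h) - g z) (g z); rewrite subrK; lra.
apply: le_trans (normcD _ _) _.
have := normcD (f z * (g (z + h) - g z - m * h)) (l * h * (g (z + h) - g z)).
rewrite !normcM.
have h0 := normc_ge0 h; have f0 := normc_ge0 (f z); have l0 := normc_ge0 l.
have g0 := normc_ge0 (g (z + h)).
have T1 : normc (f (z + h) - f z - l * h) * normc (g (z + h)) <=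
   (e1 * normc h) * (normc (g z) + 1) by apply: ler_pM => //; exact: normc_ge0.
have T2 : normc (f z) * normc (g (z + h) - g z - m * h) <=
   normc (f z) * (e2 * normc h) by rewrite ler_wpM2l.
have T3 : normc l * normc h * normc (g (z + h) - g z) <=
   normc l * normc h * e3 by rewrite ler_wpM2l // mulr_ge0.
have S1 : e1 * (3 * (normc (g z) + 1)) * normc h <= e * normc h by rewrite ler_wpM2r.
have S2 : e2 * (3 * (normc (f z))) * normc h <= e * normc h by rewrite ler_wpM2r.
have S3 : e3 * (3 * (normc l)) * normc h <= e * normc h by rewrite ler_wpM2r.
lra.
Qed.

Lemma is_cderivV f z l : f z != 0 -> is_cderiv f z l ->
  is_cderiv (fun w => (f w)^-1) z (- l / f z ^+ 2).
Proof.
move=> fz0 Hf e e0.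
have fc := is_cderiv_cont Hf.
have n0 := normc_gt0 fz0; set n := normc (f z) in n0 *.
have e20 : 0 < e * n ^+ 3 / 4 by rewrite divr_gt0 // mulr_gt0 // exprn_gt0.
have n20 : 0 < n / 2 by lra.
have [e1 e10 He1] := exists_small e20 (ltW n0).
have [e2 e20' He2] := exists_small e20 (normc_ge0 l).
have [d1 d10 H1] := Hf _ e10.
have [d2 d20 H2] := fc _ e20'.
have [d3 d30 H3] := fc _ n20.
exists (Num.min d1 (Num.min d2 d3)) => [|h]; first by rewrite !lt_min d10 d20.
rewrite !lt_min => /andP[/H1 {}H1 /andP[/H2 {}H2 /H3 {}H3]].
have fb : n / 2 <= normc (f (z + h)).
  have := normcB (f (z + h)) (f (z + h) - f z).
  by rewrite opprB addrC subrK -/n; lra.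
have fh0 : f (z + h) != 0.
  by apply: contraTneq fb => ->; rewrite normc0 -ltNge.
have -> : (f (z + h))^-1 - (f z)^-1 - (- l / f z ^+ 2) * h =
  (l * h * (f (z + h) - f z) - (f (z + h) - f z - l * h) * f z) / (f z ^+ 2 * f (z + h)).
  by field; rewrite fz0 fh0.
rewrite normcf_div ler_pdivrMr; last by rewrite normc_gt0 // mulf_neq0 // expf_neq0.
apply: le_trans (normcB _ _) _; rewrite [normc (_ ^+ 2 * _)]normcM normcX !normcM -/n.
have h0 := normc_ge0 h; have l0 := normc_ge0 l.
have T2 : normc (f (z + h) - f z - l * h) * n <= (e1 * normc h) * n by rewrite ler_wpM2r // ltW.
have T3 : normc l * normc h * normc (f (z + h) - f z) <=
   normc l * normc h * e2 by rewrite ler_wpM2l // mulr_ge0.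
have S2 : e1 * n * normc h <= (e * n ^+ 3 / 4) * normc h by rewrite ler_wpM2r.
have S3 : e2 * normc l * normc h <= (e * n ^+ 3 / 4) * normc h by rewrite ler_wpM2r.
have S4 : (e * normc h * n ^+ 2) * (n / 2) <= (e * normc h * n ^+ 2) * normc (f (z + h)).
  by rewrite ler_wpM2l // !mulr_ge0 // ?sqr_ge0 // ltW.
have E3 : n ^+ 3 = n ^+ 2 * n by rewrite exprSr.
rewrite E3 in S2 S3; lra.
Qed.

Lemma is_cderiv_comp f g z l m : is_cderiv f z l -> is_cderiv g (f z) m ->
  is_cderiv (fun w => g (f w)) z (m * l).
Proof.
move=> Hf Hg e e0.
have [d0 d00 H0] := is_cderiv_lip Hf.
have L0 : 0 <= 2 * (normc l + 1) by have := normc_ge0 l; lra.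
have [e1 e10 He1] := exists_small e0 L0.
have [] := @exists_small R e (2 * normc m) => //; first by have := normc_ge0 m; lra.
move=> e2 e20 He2.
have [d1 d10 H1] := Hg _ e10.
have [d2 d20 H2] := Hf _ e20.
have [d3 d30 H3] := is_cderiv_cont Hf (ltac:(lra) : 0 < d1 / 2).
exists (Num.min d0 (Num.min d2 d3)) => [|h]; first by rewrite !lt_min d00 d20.
rewrite !lt_min => /andP[/H0 {}H0 /andP[/H2 {}H2 /H3 {}H3]].
have kd : normc (f (z + h) - f z) < d1 by lra.
have := H1 _ kd; rewrite [f z + _]addrC subrK => {}H1.
have -> : g (f (z + h)) - g (f z) - m * l * h =
  (g (f (z + h)) - g (f z) - m * (f (z + h) - f z)) + m * (f (z + h) - f z - l * h) by ring.
apply: le_trans (normcD _ _) _; rewrite normcM.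
have h0 := normc_ge0 h; have m0 := normc_ge0 m.
have T1 : e1 * normc (f (z + h) - f z) <= e1 * ((normc l + 1) * normc h).
  by rewrite ler_wpM2l // ltW.
have T2 : normc m * normc (f (z + h) - f z - l * h) <= normc m * (e2 * normc h).
  by rewrite ler_wpM2l.
have S1 : e1 * (2 * (normc l + 1)) * normc h <= e * normc h by rewrite ler_wpM2r.
have S2 : e2 * (2 * normc m) * normc h <= e * normc h by rewrite ler_wpM2r.
lra.
Qed.

Lemma is_cderiv_near f g z l (r : R) : 0 < r ->
  (forall h, normc h < r -> f (z + h) = g (z + h)) -> is_cderiv f z l -> is_cderiv g z l.
Proof.
move=> r0 fg Hf e e0; have [d d0 H] := Hf _ e0.
exists (Num.min d r) => [|h]; first by rewrite lt_min d0.
rewrite lt_min => /andP[hd hr]; rewrite -fg // -{2}[z]addr0 -fg ?normc0 // addr0.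
exact: H.
Qed.

Lemma is_cderiv_eq f z l m : is_cderiv f z l -> l = m -> is_cderiv f z m.
Proof. by move=> H <-. Qed.

Lemma is_cderivN f z l : is_cderiv f z l -> is_cderiv (fun w => - f w) z (- l).
Proof.
move=> H e e0; have [d d0 {}H] := H _ e0; exists d => // h /H.
by rewrite -(normcN' (f _ - _ - _)); apply: le_trans; rewrite le_eqVlt; apply/orP; left; apply/eqP; congr normc; ring.
Qed.

Lemma is_cderivB f g z l m : is_cderiv f z l -> is_cderiv g z m ->
  is_cderiv (fun w => f w - g w) z (l - m).
Proof. by move=> Hf Hg; apply: is_cderivD => //; exact: is_cderivN. Qed.

Lemma is_cderivZ f z l (c : R[i]) : is_cderiv f z l -> is_cderiv (fun w => c * f w) z (c * l).
Proof.
move=> H; apply: (is_cderiv_eq (is_cderivM (is_cderiv_cst c z) H)).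
by rewrite mul0r add0r.
Qed.

Lemma is_cderiv_div f g z l m : g z != 0 -> is_cderiv f z l -> is_cderiv g z m ->
  is_cderiv (fun w => f w / g w) z ((l * g z - f z * m) / g z ^+ 2).
Proof.
move=> g0 Hf Hg; apply: (is_cderiv_eq (is_cderivM Hf (is_cderivV g0 Hg))).
by field.
Qed.

Lemma ccontD f g z : ccont f z -> ccont g z -> ccont (fun w => f w + g w) z.
Proof.
move=> Hf Hg e e0; have e20 : 0 < e / 2 by lra.
have [d d0 {}Hf] := Hf _ e20; have [k k0 {}Hg] := Hg _ e20.
exists (Num.min d k) => [|h]; first by rewrite lt_min d0.
rewrite lt_min => /andP[/Hf {}Hf /Hg {}Hg].
have -> : f (z + h) + g (z + h) - (f z + g z) =
  (f (z + h) - f z) + (g (z + h) - g z) by ring.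
by apply: le_trans (normcD _ _) _; lra.
Qed.

Lemma normc_normC z : `|z : Cfield R| = (normc z)%:C.
Proof. by rewrite /normc; case: z => a b; rewrite normc_def. Qed.

(* The order of R[i] is partial: a positive element is a positive real. *)
Lemma gt0_Cfield (e : Cfield R) : 0 < e -> exists2 x : R, 0 < x & e = x%:C.
Proof.
rewrite (ltcE (0 : R[i])) /= => /andP[/eqP im re]; exists (complex.Re e) => //.
by case: e im re => a b /= -> _.
Qed.

(** Dividing the remainder by a nonzero [h] gives the distance of the difference quotient from [l].
    Since positive elements of R[i] are real, complex radii and tolerances in the filter statements
    reduce to real ones. *)
Lemma is_cderivP f z l : is_cderiv f z l <->
  derivable (f : Cfield R -> (Cfield R)^o) z 1 /\ cderive f z = l.
Proof.
have E (h : Cfield R) : h != 0 ->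
  (fun h : Cfield R => h^-1 *: (((f : Cfield R -> (Cfield R)^o) \o shift z) (h *: (1 : Cfield R)) - f z)) h - l =
  (f (z + h) - f z - l * h) / h :> R[i].
  move=> h0; rewrite /= /GRing.scale /= mulr1 [h + z]addrC mulrC.
  by rewrite [RHS]mulrBl mulfK.
have Ecvg : is_cderiv f z l <->
  (fun h : Cfield R => h^-1 *: (((f : Cfield R -> (Cfield R)^o) \o shift z) (h *: (1 : Cfield R)) - f z))
     @ 0^' --> (l : (Cfield R)^o).
  split=> [H|].
    apply/cvgrPdist_le => e /gt0_Cfield[x x0 ->].
    have [d d0 Hd] := H _ x0.
    rewrite /dnbhs; near=> h.
    have h0 : h != 0 by near: h; exact: nbhs_dnbhs_neq.
    have hd : normc h < d.
      have : `|h| < (d%:C : Cfield R).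
        near: h; apply: dnbhs0_lt; first by rewrite (ltcR (0:R)).
      by rewrite normc_normC ltcR.
    rewrite distrC E // normc_normC lecR normcf_div ler_pdivrMr ?normc_gt0 //.
    exact: Hd.
  move=> /cvgrPdist_le H e e0.
  have ec0 : 0 < (e%:C : Cfield R) by rewrite (ltcR (0:R)).
  have := H _ ec0; rewrite near_withinE => /nbhs_ballP[d /gt0_Cfield[x x0 ->] Hd].
  exists x => // h hx.
  have [->|h0] := eqVneq h 0.
    by rewrite addr0 subrr mulr0 subr0 normc0 mulr0.
  have := Hd h; rewrite /= -ball_normE /= sub0r normrN normc_normC ltcR => /(_ hx h0).
  rewrite distrC E // normc_normC lecR normcf_div ler_pdivrMr ?normc_gt0 //.
split=> [/Ecvg H|[H1 H2]].
  split; first by apply/cvg_ex; exists l.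
  rewrite /cderive derive1E /derive; apply: (cvg_lim _ H).
  exact: norm_hausdorff.
by apply/Ecvg; rewrite -H2 /cderive derive1E.
Unshelve. all: by end_near.
Qed.

Lemma is_cderiv_unique f z l m : is_cderiv f z l -> is_cderiv f z m -> l = m.
Proof. by move=> /is_cderivP[_ <-] /is_cderivP[_ <-]. Qed.

Lemma cderiveE f z l : is_cderiv f z l -> cderive f z = l.
Proof. by move=> /is_cderivP[]. Qed.

Lemma holo_cderiv f z : holomorphic_on_disc f -> unit_disc z -> is_cderiv f z (cderive f z).
Proof. by move=> H /H H'; apply/is_cderivP. Qed.

Lemma cderiv_holo f (f' : R[i] -> R[i]) :
  (forall z, unit_disc z -> is_cderiv f z (f' z)) -> holomorphic_on_disc f.
Proof. by move=> H z /H /is_cderivP[]. Qed.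

End ComplexDerivative.

(** * Oriented integrals over real intervals *)

Section RealIntegral.
Variable R : realType.
Implicit Types (f g : R -> R) (a b c t : R).

(** The sign convention for [b < a] makes additivity hold for endpoints in any order, as needed for
    increments of either sign. *)
Definition rint f a b : R :=
  if a <= b then \int[lebesgue_measure]_(t in `[a, b]) f t
  else - \int[lebesgue_measure]_(t in `[b, a]) f t.

Definition seg a b : set R := [set t | Num.min a b <= t <= Num.max a b].

Lemma segE a b t : a <= b -> seg a b t = (a <= t <= b).
Proof. by move=> ab; rewrite /seg /= min_l // max_r. Qed.

Lemma segC a b : seg a b = seg b a.
Proof. by rewrite /seg minC maxC. Qed.

Lemma cont_integrable f a b : (forall t, a <= t <= b -> {for t, continuous f}) ->
  lebesgue_measure.-integrable `[a, b] (EFin \o f).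
Proof.
move=> H; apply: continuous_compact_integrable; first exact: segment_compact.
apply: continuous_in_subspaceT => t; rewrite inE /= in_itv /=; exact: H.
Qed.

Lemma rintC f a b : rint f a b = - rint f b a.
Proof.
rewrite /rint; case: (ltgtP a b) => [||->]; rewrite ?opprK //.
by rewrite set_itv1 Rintegral_set1 oppr0.
Qed.

(** With a common left end [A], every oriented integral is a difference of two values of one
    function, and additivity becomes a ring identity. *)
Lemma rint_sub f A B a b : (forall t, A <= t <= B -> {for t, continuous f}) ->
  A <= a <= B -> A <= b <= B ->
  rint f a b = \int[lebesgue_measure]_(t in `[A, b]) f t -
               \int[lebesgue_measure]_(t in `[A, a]) f t.
Proof.
move=> H; wlog ab : a b / a <= b.
  move=> W Ha Hb; have [|/ltW] := leP a b; first by move=> ?; apply: W.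
  by move=> ba; rewrite rintC W // opprB.
move=> /andP[Aa aB] /andP[Ab bB]; rewrite /rint ab.
have Hint x y : A <= x -> y <= B -> lebesgue_measure.-integrable `[x, y] (EFin \o f).
  by move=> Ax yB; apply: cont_integrable => t /andP[? ?]; apply: H; apply/andP; split; lra.
rewrite Rintegral_itvB ?bnd_simp //; last exact: Hint.
rewrite Rintegral_itv_obnd_cbnd //.
by apply: integrableS (Hint a b Aa bB) => //; apply: subset_itvr; rewrite bnd_simp.
Qed.

Lemma rint_chasles f A B a b c : (forall t, A <= t <= B -> {for t, continuous f}) ->
  A <= a <= B -> A <= b <= B -> A <= c <= B -> rint f a b + rint f b c = rint f a c.
Proof. by move=> H Ha Hb Hc; rewrite !(rint_sub H) //; ring. Qed.

Lemma rintD f g a b : (forall t, seg a b t -> {for t, continuous f}) ->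
  (forall t, seg a b t -> {for t, continuous g}) ->
  rint (fun t => f t + g t) a b = rint f a b + rint g a b.
Proof.
wlog ab : a b / a <= b.
  move=> W; have [|/ltW] := leP a b; first by move=> ?; apply: W.
  by rewrite segC => ba Hf Hg; rewrite ![rint _ a b]rintC W // opprD.
move=> Hf Hg; rewrite /rint ab RintegralD //; apply: cont_integrable => t; rewrite -segE //; auto.
Qed.

Lemma rintZ f a b k : (forall t, seg a b t -> {for t, continuous f}) ->
  rint (fun t => k * f t) a b = k * rint f a b.
Proof.
wlog ab : a b / a <= b.
  move=> W; have [|/ltW] := leP a b; first by move=> ?; apply: W.
  by rewrite segC => ba Hf; rewrite ![rint _ a b]rintC W // mulrN.
move=> Hf; rewrite /rint ab RintegralZl //; apply: cont_integrable => t; rewrite -segE //; auto.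
Qed.

Lemma eq_rint f g a b : (forall t, seg a b t -> f t = g t) -> rint f a b = rint g a b.
Proof.
wlog ab : a b / a <= b.
  move=> W; have [|/ltW] := leP a b; first by move=> ?; apply: W.
  by rewrite segC => ba Hf; rewrite ![rint _ a b]rintC (W b a).
move=> Hf; rewrite /rint ab; apply: eq_Rintegral => t; rewrite inE /= in_itv /= -segE //.
exact: Hf.
Qed.

Lemma rint_cst a b k : rint (fun=> k) a b = k * (b - a).
Proof.
wlog ab : a b / a <= b.
  move=> W; have [|/ltW] := leP a b; first by move=> ?; apply: W.
  by move=> ba; rewrite rintC W // -mulrN opprB.
have -> : rint (fun=> k) a b = k * fine (lebesgue_measure `[a, b]).
  by rewrite /rint ab -Rintegral_cst.
rewrite lebesgue_measure_itv /= lte_fin.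
by case: ltgtP ab => // -> _; rewrite /= subrr mulr0.
Qed.

Lemma rint_le f g a b : a <= b -> (forall t, a <= t <= b -> {for t, continuous f}) ->
  (forall t, a <= t <= b -> {for t, continuous g}) ->
  (forall t, a <= t <= b -> f t <= g t) -> rint f a b <= rint g a b.
Proof.
move=> ab Hf Hg fg; rewrite /rint ab; by apply: le_Rintegral => //; exact: cont_integrable.
Qed.

Lemma cst_cont k t : {for t, continuous (fun=> k : R)}.
Proof. exact: cst_continuous. Qed.

Lemma rint_bound f a b M : (forall t, seg a b t -> {for t, continuous f}) ->
  (forall t, seg a b t -> `|f t| <= M) -> `|rint f a b| <= M * `|b - a|.
Proof.
wlog ab : a b / a <= b.
  move=> W; have [|/ltW] := leP a b; first by move=> ?; apply: W.
  by rewrite segC => ba Hf; rewrite rintC normrN distrC; apply: W.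
move=> Hf fM; rewrite [X in _ * X]ger0_norm ?subr_ge0 // ler_norml -mulNr -!rint_cst.
apply/andP; split; apply: rint_le => // t; rewrite -segE // => st;
  first [exact: cst_cont | exact: Hf | by have := fM _ st; rewrite ler_norml => /andP[]].
Qed.

(** This is the real counterpart of [is_cderivP], in the direction needed: it receives the remainder
    estimates obtained from a complex derivative by taking real or imaginary parts. *)
Lemma is_derive_eps (F : R -> R) x l : (forall e : R, 0 < e -> exists2 d : R, 0 < d &
   forall h, `|h| < d -> `|F (x + h) - F x - l * h| <= e * `|h|) ->
  is_derive x 1 F l.
Proof.
move=> H.
have C : (fun h : R => h^-1 *: ((F \o shift x) (h *: (1 : R)) - F x)) @ 0^' --> l.
  apply/cvgrPdist_le => e e0; have [d d0 Hd] := H _ e0.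
  rewrite /dnbhs; near=> h.
  have h0 : h != 0 by near: h; exact: nbhs_dnbhs_neq.
  have hd : `|h| < d by near: h; apply: dnbhs0_lt.
  have := Hd _ hd; rewrite /= /GRing.scale /= mulr1 [h + x]addrC.
  rewrite -ler_pdivrMr ?normr_gt0 // -normf_div distrC.
  by rewrite [(_ - l * h) / h]mulrBl mulfK // [_^-1 * _]mulrC.
have D : derivable F x 1 by apply/cvg_ex; exists l.
apply: DeriveDef => //; rewrite /derive; apply: (cvg_lim _ C).
exact: norm_hausdorff.
Unshelve. all: by end_near.
Qed.

Lemma rint_FTC F f a b : (forall t, seg a b t -> is_derive t 1 F (f t)) ->
  (forall t, seg a b t -> {for t, continuous f}) -> rint f a b = F b - F a.
Proof.
wlog ab : a b / a <= b.
  move=> W; have [|/ltW] := leP a b; first by move=> ?; apply: W.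
  by rewrite segC => ba HF Hf; rewrite rintC W // opprB.
move=> HF Hf; rewrite /rint ab; move: ab; rewrite le_eqVlt => /orP[/eqP->|ab].
  by rewrite set_itv1 Rintegral_set1 subrr.
have S t : a <= t <= b -> seg a b t by rewrite segE // ltW.
have HC t : seg a b t -> {for t, continuous F}.
  by move=> /HF[D _]; apply/differentiable_continuous/derivable1_diffP.
rewrite /Rintegral (@continuous_FTC2 R f F a b) //=.
- by apply: continuous_in_subspaceT => t; rewrite inE /= in_itv /= => /S/Hf.
- split.
  + by move=> t; rewrite in_itv /= => /andP[? ?]; have [] // := HF t (S _ _); rewrite !ltW.
  + by apply: cvg_at_right_filter; apply: HC; apply: S; rewrite lexx ltW.
  + by apply: cvg_at_left_filter; apply: HC; apply: S; rewrite lexx ltW.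
- move=> t; rewrite in_itv /= => /andP[? ?]; rewrite derive1E.
  by have [|_ ->] // := HF t (S _ _); rewrite !ltW.
Qed.

End RealIntegral.

(** * Complex-valued integrals along affine paths *)

Section ComplexIntegral.
Variable R : realType.
Implicit Types (f g : R -> R[i]) (F G P : R[i] -> R[i]) (a b c t : R) (v k : R[i]).

Definition rcont f t := {for t, continuous (fun s => complex.Re (f s))} /\
  {for t, continuous (fun s => complex.Im (f s))}.

Definition cint f a b : R[i] :=
  rint (fun t => complex.Re (f t)) a b +i* rint (fun t => complex.Im (f t)) a b.

(** One notion covers horizontal sides ([v = 1]), vertical sides ([v = 'i]) and rays from 0 to z
    ([v = z]). *)
Definition affine (gam : R -> R[i]) v := forall s t, gam s - gam t = (s - t)%:C * v.

Lemma affineE gam v t h : affine gam v -> gam (t + h) = gam t + h%:C * v.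
Proof. by move=> /(_ (t + h) t); rewrite [t + h - t]addrAC subrr add0r => <-; rewrite [RHS]addrC subrK. Qed.

Lemma affine_h y : affine (fun t => t +i* y) 1.
Proof. by move=> s t; simpc. Qed.

Lemma affine_v x : affine (fun t => x +i* t) 'i.
Proof. by move=> s t; simpc. Qed.

Lemma affine_ray z : affine (fun t => t%:C * z) z.
Proof. by move=> s t; rewrite -mulrBl -rmorphB. Qed.

Lemma cint_chasles f A B a b c : (forall t, A <= t <= B -> rcont f t) ->
  A <= a <= B -> A <= b <= B -> A <= c <= B -> cint f a b + cint f b c = cint f a c.
Proof.
move=> H Ha Hb Hc; rewrite /cint; simpc.
by congr (_ +i* _); apply: (rint_chasles (A := A) (B := B)) => // t /H[].
Qed.

Lemma cintC f a b : cint f a b = - cint f b a.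
Proof. by rewrite /cint ![rint _ a b]rintC. Qed.

Lemma rcontD f g t : rcont f t -> rcont g t -> rcont (fun s => f s + g s) t.
Proof.
move=> [f1 f2] [g1 g2]; split.
  rewrite (_ : (fun s => _) = (fun s => complex.Re (f s) + complex.Re (g s))); last by apply/funext => s; rewrite raddfD.
  exact: cvgD.
rewrite (_ : (fun s => _) = (fun s => complex.Im (f s) + complex.Im (g s))); last by apply/funext => s; rewrite raddfD.
exact: cvgD.
Qed.

Lemma ReM k z : complex.Re (k * z) = complex.Re k * complex.Re z + - complex.Im k * complex.Im z :> R.
Proof. by case: k z => a b [c d] /=; rewrite mulNr. Qed.

Lemma ImM k z : complex.Im (k * z) = complex.Re k * complex.Im z + complex.Im k * complex.Re z :> R.
Proof. by case: k z => a b [c d] /=; rewrite addrC; ring. Qed.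

Lemma cvgZ1 (u : R) (h : R -> R) t : {for t, continuous h} -> {for t, continuous (fun s => u * h s)}.
Proof. by move=> H; apply: cvgM => //; exact: cvg_cst. Qed.

Lemma rcontZ k f t : rcont f t -> rcont (fun s => k * f s) t.
Proof.
move=> [f1 f2]; split.
  under [X in {for t, continuous X}]eq_fun do rewrite ReM.
  by apply: cvgD; apply: cvgZ1.
under [X in {for t, continuous X}]eq_fun do rewrite ImM.
by apply: cvgD; apply: cvgZ1.
Qed.

Lemma cintD f g a b : (forall t, seg a b t -> rcont f t) -> (forall t, seg a b t -> rcont g t) ->
  cint (fun t => f t + g t) a b = cint f a b + cint g a b.
Proof.
move=> Hf Hg; rewrite /cint; simpc; congr (_ +i* _).
  rewrite -rintD; [|by move=> t /Hf[]|by move=> t /Hg[]].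
  by apply: eq_rint => t _; rewrite raddfD.
rewrite -rintD; [|by move=> t /Hf[]|by move=> t /Hg[]].
by apply: eq_rint => t _; rewrite raddfD.
Qed.

Lemma cintZ k f a b : (forall t, seg a b t -> rcont f t) ->
  cint (fun t => k * f t) a b = k * cint f a b.
Proof.
move=> Hf.
have H1 t : seg a b t -> {for t, continuous (fun s => complex.Re (f s))} by move=> /Hf[].
have H2 t : seg a b t -> {for t, continuous (fun s => complex.Im (f s))} by move=> /Hf[].
rewrite /cint [k in RHS]complexE; case: k => k1 k2 /=; simpc; congr (_ +i* _).
  rewrite -[in RHS](rintZ k1 H1) -mulNr -[in RHS](rintZ (- k2) H2) -rintD.
  - by apply: eq_rint => t _; rewrite ReM.
  - by move=> t st; apply: cvgZ1; apply: H1.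
  - by move=> t st; apply: cvgZ1; apply: H2.
rewrite -[in RHS](rintZ k1 H2) -[in RHS](rintZ k2 H1) -rintD.
- by apply: eq_rint => t _; rewrite ImM.
- by move=> t st; apply: cvgZ1; apply: H2.
- by move=> t st; apply: cvgZ1; apply: H1.
Qed.

Lemma eq_cint f g a b : (forall t, seg a b t -> f t = g t) -> cint f a b = cint g a b.
Proof. by move=> H; rewrite /cint; congr (_ +i* _); apply: eq_rint => t /H ->. Qed.

(** The factor 2 comes from bounding real and imaginary parts separately. *)
Lemma cint_bound f a b M : (forall t, seg a b t -> rcont f t) ->
  (forall t, seg a b t -> normc (f t) <= M) -> normc (cint f a b) <= 2 * M * `|b - a|.
Proof.
move=> H HM; apply: le_trans (normc_le_ReIm _) _; rewrite /cint /=.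
have B1 : `|rint (fun t => complex.Re (f t)) a b| <= M * `|b - a|.
  by apply: rint_bound => t /[dup] /H[? ?] // /HM; apply: le_trans; exact: Re_le_normc.
have B2 : `|rint (fun t => complex.Im (f t)) a b| <= M * `|b - a|.
  by apply: rint_bound => t /[dup] /H[? ?] // /HM; apply: le_trans; exact: Im_le_normc.
lra.
Qed.

Lemma ccont_affine F gam v t : affine gam v -> ccont F (gam t) -> rcont (fun s => F (gam s)) t.
Proof.
move=> Hg HF.
have K e : 0 < e -> \forall s \near t, normc (F (gam s) - F (gam t)) <= e.
  move=> e0; have [d d0 Hd] := HF _ e0.
  have [k k0 Hk] := exists_small (ltac:(lra) : 0 < d / 2) (normc_ge0 v).
  apply/nbhs_ballP; exists k => //= s; rewrite /ball /= => st.
  have := Hd (gam s - gam t); rewrite [gam t + _]addrC subrK; apply.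
  rewrite Hg normcM normc_real distrC.
  have : `|t - s| * normc v <= k * normc v by rewrite ler_wpM2r ?normc_ge0 // ltW.
  by lra.
split; apply/cvgrPdist_le => e /K; apply: filterS => s; apply: le_trans; rewrite distrC -raddfB.
  exact: Re_le_normc.
exact: Im_le_normc.
Qed.

(** By the chain rule [P] composed with the path has derivative [v * F (gam t)]; the real
    fundamental theorem then applies to its real and imaginary parts. *)
Lemma cint_FTC P F gam v a b : affine gam v ->
  (forall t, seg a b t -> is_cderiv P (gam t) (F (gam t))) ->
  (forall t, seg a b t -> ccont F (gam t)) ->
  v * cint (fun t => F (gam t)) a b = P (gam b) - P (gam a).
Proof.
move=> Hg HP HF.
have HF' t : seg a b t -> rcont (fun s => F (gam s)) t by move=> /HF; exact: ccont_affine.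
rewrite -cintZ //.
have HV t : seg a b t -> rcont (fun s => v * F (gam s)) t by move=> /HF'; exact: rcontZ.
have D t : seg a b t -> forall e : R, 0 < e -> exists2 d : R, 0 < d & forall h, `|h| < d ->
    normc (P (gam (t + h)) - P (gam t) - h%:C * (v * F (gam t))) <= e * `|h|.
  move=> /HP H e e0.
  have [e1 e10 He1] := exists_small e0 (normc_ge0 v).
  have [d d0 Hd] := H _ e10.
  have [k k0 Hk] := exists_small (ltac:(lra) : 0 < d / 2) (normc_ge0 v).
  exists k => // h hk; rewrite (affineE _ _ Hg).
  have hv : normc (h%:C * v) < d.
    rewrite normcM normc_real.
    have : `|h| * normc v <= k * normc v by rewrite ler_wpM2r ?normc_ge0 // ltW.
    lra.
  have := Hd _ hv; rewrite normcM normc_real [F _ * _]mulrC -mulrA => /le_trans; apply.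
  by have := normr_ge0 h; nra.
have RhM (h : R) z : complex.Re (h%:C * z) = complex.Re z * h by case: z => ? ? /=; ring.
have IhM (h : R) z : complex.Im (h%:C * z) = complex.Im z * h by case: z => ? ? /=; ring.
rewrite [RHS]complexE raddfB /= raddfB /= /cint; simpc; congr (_ +i* _).
  apply: (@rint_FTC _ (fun t => complex.Re (P (gam t)))); last by move=> t /HV[].
  move=> t /D H; apply: is_derive_eps => e /H[d d0 {}H]; exists d => // h /H; apply: le_trans.
  by rewrite -RhM -!raddfB Re_le_normc.
rewrite raddfB; apply: (@rint_FTC _ (fun t => complex.Im (P (gam t)))); last by move=> t /HV[].
move=> t /D H; apply: is_derive_eps => e /H[d d0 {}H]; exists d => // h /H; apply: le_trans.
by rewrite -IhM -!raddfB Im_le_normc.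
Qed.

End ComplexIntegral.

(** * Compactness of a rectangle by dyadic bisection *)

Section Bisection.
Variable R : realType.

Lemma exists_half_pow (K d : R) : 0 < d -> exists n, K / 2 ^+ n < d.
Proof.
move=> d0; pose n := (Num.truncn `|K / d|).+1; exists n.
have n1 : `|K / d| < n%:R by rewrite /n truncnS_gt.
have n2 : (n%:R : R) < 2 ^+ n by rewrite -natrX ltr_nat ltn_expl.
rewrite ltr_pdivrMr ?exprn_gt0 // -ltr_pdivrMl //.
have := ler_norm (K / d); rewrite [d^-1 * _]mulrC; lra.
Qed.

(** A cell where [P] fails has a quarter where it fails. The resulting nested cells shrink to a
    point of the rectangle, where the local hypothesis makes [P] true on all small enough cells
    containing it. This serves both Goursat's lemma and the boundedness of continuous functions. *)
Lemma dyadic_cousin (P : nat -> R -> R -> Prop) (W H x0 y0 : R) :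
  0 <= W -> 0 <= H ->
  (forall n x y, (forall i j : bool, P n.+1 (x + i%:R * (W / 2 ^+ n.+1)) (y + j%:R * (H / 2 ^+ n.+1))) ->
     P n x y) ->
  (forall a b, x0 <= a <= x0 + W -> y0 <= b <= y0 + H -> exists2 d : R, 0 < d &
     forall n x y, x <= a <= x + W / 2 ^+ n -> y <= b <= y + H / 2 ^+ n ->
       W / 2 ^+ n + H / 2 ^+ n < d -> P n x y) -> P 0 x0 y0.
Proof.
move=> W0 H0 Pstep Ploc; apply: contrapT => nP.
(* Failure is put inside the conclusion as a premise, so a quarter can be chosen for every cell and
   the sequence is a plain recursion whose invariant is proved afterwards. *)
have step (n : nat) (s : R * R) : exists ij : bool * bool, ~ P n s.1 s.2 ->
    ~ P n.+1 (s.1 + ij.1%:R * (W / 2 ^+ n.+1)) (s.2 + ij.2%:R * (H / 2 ^+ n.+1)).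
  apply: contrapT => /forallNP C; have nPn : ~ P n s.1 s.2.
    by move=> Q; apply: (C (true, true)) => /(_ Q).
  apply: nPn; apply: Pstep => i j; apply: contrapT => nQ.
  by apply: (C (i, j)).
pose ij n s := projT1 (cid (step n s)).
pose s := fix s n : R * R := if n is n'.+1 then
  ((s n').1 + (ij n' (s n')).1%:R * (W / 2 ^+ n), (s n').2 + (ij n' (s n')).2%:R * (H / 2 ^+ n))
  else (x0, y0).
have sP n : ~ P n (s n).1 (s n).2.
  by elim: n => [//|n IH] /=; exact: (projT2 (cid (step n (s n))) IH).
have half (K : R) n : K / 2 ^+ n = 2 * (K / 2 ^+ n.+1).
  by rewrite exprS; field; rewrite expf_neq0.
(* Left ends increase and right ends decrease, so the supremum of the left ends lies in every
   interval. *)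
have lim (K : R) (u : nat -> R) : 0 <= K ->
    (forall n, exists i : bool, u n.+1 = u n + i%:R * (K / 2 ^+ n.+1)) ->
    exists a, forall n, u n <= a <= u n + K / 2 ^+ n.
  move=> K0 Hu.
  have Kn n : 0 <= K / 2 ^+ n by rewrite divr_ge0 // exprn_ge0.
  have u1 n : u n <= u n.+1.
    by have [i ->] := Hu n; rewrite lerDl mulr_ge0.
  have u2 n : u n.+1 + K / 2 ^+ n.+1 <= u n + K / 2 ^+ n.
    have [i ->] := Hu n; rewrite (half K n); have := Kn n.+1.
    by case: i; rewrite /= ?mul1r ?mul0r; lra.
  have mon m k : u m <= u (m + k)%N.
    by elim: k => [|k IH]; rewrite ?addn0 // addnS (le_trans IH).
  have mon2 m k : u (m + k)%N + K / 2 ^+ (m + k) <= u m + K / 2 ^+ m.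
    by elim: k => [|k IH]; rewrite ?addn0 // addnS (le_trans (u2 _)).
  have ub n m : u m <= u n + K / 2 ^+ n.
    have [mn|/ltnW nm] := leqP m n.
      rewrite -(subnKC mn); apply: (le_trans (mon m (n - m)%N)).
      by rewrite lerDl.
    rewrite -(subnKC nm); apply: le_trans (mon2 n (m - n)%N).
    by rewrite lerDl.
  have bnd : has_sup (range u).
    split; first by exists (u 0%N), 0%N.
    by exists (u 0%N + K / 2 ^+ 0) => _ [m _ <-]; exact: ub.
  exists (sup (range u)) => n; apply/andP; split.
    by apply: sup_upper_bound => //; exists n.
  apply: ge_sup; first by exists (u 0%N), 0%N.
  by move=> _ [m _ <-]; exact: ub.
have [|a Ha] := lim W (fun n => (s n).1) W0; first by move=> n; exists (ij n (s n)).1.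
have [|b Hb] := lim H (fun n => (s n).2) H0; first by move=> n; exists (ij n (s n)).2.
have [||d d0 Hd] := Ploc a b.
- by have := Ha 0%N; rewrite expr0 divr1.
- by have := Hb 0%N; rewrite expr0 divr1.
have [n Hn] := @exists_half_pow (W + H) d d0.
by apply: (sP n); apply: Hd => //; rewrite -mulrDl.
Qed.

End Bisection.

(** * Boundary integrals and Goursat's lemma on rectangles *)

Section Rectangles.
Variable R : realType.
Implicit Types (F G P : R[i] -> R[i]) (x y : R) (z l : R[i]).

Definition rect x1 x2 y1 y2 : set R[i] :=
  [set z | x1 <= complex.Re z <= x2 /\ y1 <= complex.Im z <= y2].

(** Counterclockwise contour integral: bottom minus top, then right minus left with the factor ['i]
    of dz on vertical sides. *)
Definition oint F x1 x2 y1 y2 : R[i] :=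
  (cint (fun t => F (t +i* y1)) x1 x2 - cint (fun t => F (t +i* y2)) x1 x2) +
  'i * (cint (fun t => F (x2 +i* t)) y1 y2 - cint (fun t => F (x1 +i* t)) y1 y2).

Definition rect_cont F x1 x2 y1 y2 := forall z, rect x1 x2 y1 y2 z -> ccont F z.

Lemma rect_cont_sub F x1 x2 y1 y2 x3 x4 y3 y4 : rect_cont F x1 x2 y1 y2 ->
  x1 <= x3 -> x4 <= x2 -> y1 <= y3 -> y4 <= y2 -> rect_cont F x3 x4 y3 y4.
Proof.
move=> HF h1 h2 h3 h4 z [/andP[? ?] /andP[? ?]]; apply: HF.
by split; apply/andP; split; lra.
Qed.

Lemma rcont_h F x1 x2 y1 y2 x y : rect_cont F x1 x2 y1 y2 -> x1 <= x <= x2 -> y1 <= y <= y2 ->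
  rcont (fun t => F (t +i* y)) x.
Proof. by move=> HF Hx Hy; apply: (ccont_affine (affine_h y)); apply: HF; split. Qed.

Lemma rcont_v F x1 x2 y1 y2 x y : rect_cont F x1 x2 y1 y2 -> x1 <= x <= x2 -> y1 <= y <= y2 ->
  rcont (fun t => F (x +i* t)) y.
Proof. by move=> HF Hx Hy; apply: (ccont_affine (affine_v x)); apply: HF; split. Qed.

Lemma oint_splitx F x1 x2 y1 y2 x : rect_cont F x1 x2 y1 y2 -> x1 <= x <= x2 -> y1 <= y2 ->
  oint F x1 x2 y1 y2 = oint F x1 x y1 y2 + oint F x x2 y1 y2.
Proof.
move=> HF /andP[x1x xx2] y12; have x12 := le_trans x1x xx2; rewrite /oint.
have S y : y1 <= y <= y2 -> cint (fun t => F (t +i* y)) x1 x2 =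
    cint (fun t => F (t +i* y)) x1 x + cint (fun t => F (t +i* y)) x x2.
  move=> Hy; rewrite (cint_chasles (A := x1) (B := x2)) ?lexx ?x1x ?x12 //.
  by move=> t Ht; exact: (rcont_h HF).
by rewrite (S y1) ?lexx // (S y2) ?lexx ?y12 //; ring.
Qed.

Lemma oint_splity F x1 x2 y1 y2 y : rect_cont F x1 x2 y1 y2 -> x1 <= x2 -> y1 <= y <= y2 ->
  oint F x1 x2 y1 y2 = oint F x1 x2 y1 y + oint F x1 x2 y y2.
Proof.
move=> HF x12 /andP[y1y yy2]; have y12 := le_trans y1y yy2; rewrite /oint.
have S x : x1 <= x <= x2 -> cint (fun t => F (x +i* t)) y1 y2 =
    cint (fun t => F (x +i* t)) y1 y + cint (fun t => F (x +i* t)) y y2.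
  move=> Hx; rewrite (cint_chasles (A := y1) (B := y2)) ?lexx ?y1y ?y12 //.
  by move=> t Ht; exact: (rcont_v HF).
by rewrite (S x1) ?lexx // (S x2) ?lexx ?x12 //; ring.
Qed.

(** Hypotheses are restricted to the boundary so that kernels with a pole inside the rectangle
    remain covered. *)
Definition bdry x1 x2 y1 y2 : set R[i] := [set z | rect x1 x2 y1 y2 z /\
  [|| complex.Re z == x1, complex.Re z == x2, complex.Im z == y1 | complex.Im z == y2]].

Definition bdry_cont F x1 x2 y1 y2 := forall z, bdry x1 x2 y1 y2 z -> ccont F z.

Lemma rect_bdry_cont F x1 x2 y1 y2 : rect_cont F x1 x2 y1 y2 -> bdry_cont F x1 x2 y1 y2.
Proof. by move=> H z [/H]. Qed.

Lemma bdry_h x1 x2 y1 y2 x y : y1 <= y2 -> x1 <= x <= x2 -> (y == y1) || (y == y2) ->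
  bdry x1 x2 y1 y2 (x +i* y).
Proof.
move=> y12 Hx Hy; split; last by rewrite /= Hy !orbT.
by split=> //=; case/orP: Hy => /eqP ->; rewrite lexx ?y12.
Qed.

Lemma bdry_v x1 x2 y1 y2 x y : x1 <= x2 -> y1 <= y <= y2 -> (x == x1) || (x == x2) ->
  bdry x1 x2 y1 y2 (x +i* y).
Proof.
move=> x12 Hy Hx; split; last by case/orP: Hx => /= ->; rewrite ?orbT.
by split=> //=; case/orP: Hx => /eqP ->; rewrite lexx ?x12.
Qed.

Lemma bdry_cont_h F x1 x2 y1 y2 x y : bdry_cont F x1 x2 y1 y2 -> y1 <= y2 -> x1 <= x <= x2 ->
  (y == y1) || (y == y2) -> rcont (fun t => F (t +i* y)) x.
Proof. by move=> HF y12 Hx Hy; apply: (ccont_affine (affine_h y)); apply/HF/bdry_h. Qed.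

Lemma bdry_cont_v F x1 x2 y1 y2 x y : bdry_cont F x1 x2 y1 y2 -> x1 <= x2 -> y1 <= y <= y2 ->
  (x == x1) || (x == x2) -> rcont (fun t => F (x +i* t)) y.
Proof. by move=> HF x12 Hy Hx; apply: (ccont_affine (affine_v x)); apply/HF/bdry_v. Qed.

Lemma ointD F G x1 x2 y1 y2 : x1 <= x2 -> y1 <= y2 ->
  bdry_cont F x1 x2 y1 y2 -> bdry_cont G x1 x2 y1 y2 ->
  oint (fun z => F z + G z) x1 x2 y1 y2 = oint F x1 x2 y1 y2 + oint G x1 x2 y1 y2.
Proof.
move=> x12 y12 HF HG; rewrite /oint !cintD; first ring.
all: move=> t; rewrite segE // => Ht.
all: first [apply: (bdry_cont_h HF y12 Ht) | apply: (bdry_cont_h HG y12 Ht)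
  | apply: (bdry_cont_v HF x12 Ht) | apply: (bdry_cont_v HG x12 Ht)];
  by rewrite eqxx ?orbT.
Qed.

Lemma ointZ F x1 x2 y1 y2 (k : R[i]) : x1 <= x2 -> y1 <= y2 -> bdry_cont F x1 x2 y1 y2 ->
  oint (fun z => k * F z) x1 x2 y1 y2 = k * oint F x1 x2 y1 y2.
Proof.
move=> x12 y12 HF; rewrite /oint !cintZ; first ring.
all: move=> t; rewrite segE // => Ht;
  first [apply: (bdry_cont_h HF y12 Ht) | apply: (bdry_cont_v HF x12 Ht)];
  by rewrite eqxx ?orbT.
Qed.

Lemma eq_oint F G x1 x2 y1 y2 : x1 <= x2 -> y1 <= y2 ->
  (forall z, bdry x1 x2 y1 y2 z -> F z = G z) ->
  oint F x1 x2 y1 y2 = oint G x1 x2 y1 y2.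
Proof.
move=> x12 y12 H; rewrite /oint; congr (_ - _ + 'i * (_ - _)); apply: eq_cint => t;
  rewrite segE // => Ht; apply: H;
  first [apply: (bdry_h y12 Ht) | apply: (bdry_v x12 Ht)]; by rewrite ?eqxx ?orbT.
Qed.

Lemma oint_bound F x1 x2 y1 y2 M : x1 <= x2 -> y1 <= y2 -> bdry_cont F x1 x2 y1 y2 ->
  (forall z, bdry x1 x2 y1 y2 z -> normc (F z) <= M) ->
  normc (oint F x1 x2 y1 y2) <= 4 * M * ((x2 - x1) + (y2 - y1)).
Proof.
move=> x12 y12 HF HM; rewrite /oint.
have Bh y : (y == y1) || (y == y2) -> normc (cint (fun t => F (t +i* y)) x1 x2) <= 2 * M * (x2 - x1).
  move=> Hy; rewrite -[x2 - x1]ger0_norm ?subr_ge0 //; apply: cint_bound => t; rewrite segE // => Ht.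
    exact: (bdry_cont_h HF).
  exact/HM/bdry_h.
have Bv x : (x == x1) || (x == x2) -> normc (cint (fun t => F (x +i* t)) y1 y2) <= 2 * M * (y2 - y1).
  move=> Hx; rewrite -[y2 - y1]ger0_norm ?subr_ge0 //; apply: cint_bound => t; rewrite segE // => Ht.
    exact: (bdry_cont_v HF).
  exact/HM/bdry_v.
have := Bh y1; have := Bh y2; have := Bv x1; have := Bv x2; rewrite !eqxx !orbT.
move=> /(_ isT) b1 /(_ isT) b2 /(_ isT) b3 /(_ isT) b4.
apply: le_trans (normcD _ _) _; rewrite normcM normc_i mul1r.
set A := cint _ _ _ in b4 *; set B := cint _ _ _ in b3 *.
set C := cint _ _ _ in b1 *; set D := cint _ _ _ in b2 *.
by have := normcB A B; have := normcB C D; lra.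
Qed.

Lemma oint_primitive P F x1 x2 y1 y2 : x1 <= x2 -> y1 <= y2 -> bdry_cont F x1 x2 y1 y2 ->
  (forall z, bdry x1 x2 y1 y2 z -> is_cderiv P z (F z)) -> oint F x1 x2 y1 y2 = 0.
Proof.
move=> x12 y12 HF HP; rewrite /oint mulrBr.
have Bh y : (y == y1) || (y == y2) ->
    cint (fun t => F (t +i* y)) x1 x2 = P (x2 +i* y) - P (x1 +i* y).
  move=> Hy; rewrite -[LHS]mul1r; apply: (cint_FTC (affine_h y)) => t; rewrite segE // => Ht.
    exact/HP/bdry_h.
  exact/HF/bdry_h.
have Bv x : (x == x1) || (x == x2) ->
    'i * cint (fun t => F (x +i* t)) y1 y2 = P (x +i* y2) - P (x +i* y1).
  move=> Hx; apply: (cint_FTC (affine_v x)) => t; rewrite segE // => Ht.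
    exact/HP/bdry_v.
  exact/HF/bdry_v.
by rewrite !Bh ?Bv ?eqxx ?orbT //; ring.
Qed.

Lemma rect_dist x1 x2 y1 y2 z w : rect x1 x2 y1 y2 z -> rect x1 x2 y1 y2 w ->
  normc (z - w) <= (x2 - x1) + (y2 - y1).
Proof.
move=> [/andP[? ?] /andP[? ?]] [/andP[? ?] /andP[? ?]].
apply: le_trans (normc_le_ReIm _) _; rewrite !raddfB.
by apply: lerD; rewrite ler_norml; apply/andP; split; lra.
Qed.

(** An affine function has a polynomial primitive, so subtracting it leaves the contour integral
    unchanged. Taking [l] to be the derivative exploits differentiability at a point; [l = 0]
    exploits continuity alone. *)
Lemma oint_near_affine F x1 x2 y1 y2 z0 (u l : R[i]) M : x1 <= x2 -> y1 <= y2 ->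
  rect_cont F x1 x2 y1 y2 ->
  (forall z, rect x1 x2 y1 y2 z -> normc (F z - (u + l * (z - z0))) <= M) ->
  normc (oint F x1 x2 y1 y2) <= 4 * M * ((x2 - x1) + (y2 - y1)).
Proof.
move=> x12 y12 HF HM.
pose A z := u + l * (z - z0); pose P z := u * z + l / 2 * (z - z0) ^+ 2.
have dB z : is_cderiv (fun w => w - z0) z 1.
  by apply: (is_cderiv_eq (is_cderivB (is_cderiv_id z) (is_cderiv_cst z0 z))); rewrite subr0.
have dA z : is_cderiv A z l.
  apply: (is_cderiv_eq (is_cderivD (is_cderiv_cst u z) (is_cderivZ l (dB z)))); ring.
have dP z : is_cderiv P z (A z).
  apply: (is_cderiv_eq (is_cderivD (is_cderivZ u (is_cderiv_id z))
    (is_cderivZ (l / 2) (is_cderivM (dB z) (dB z))))); by rewrite /A; field.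
have cA : bdry_cont A x1 x2 y1 y2 by move=> z _; exact: is_cderiv_cont (dA z).
have A0 : oint A x1 x2 y1 y2 = 0 by apply: (oint_primitive (P := P)).
have cFA : bdry_cont (fun z => F z + (-1) * A z) x1 x2 y1 y2.
  by move=> z [Hz _]; apply: ccontD; [exact: HF|exact: is_cderiv_cont (is_cderivZ _ (dA z))].
have -> : oint F x1 x2 y1 y2 = oint (fun z => F z + (-1) * A z) x1 x2 y1 y2.
  rewrite ointD //; [by rewrite ointZ // A0 mulr0 addr0|exact: rect_bdry_cont|].
  by move=> z _; exact: is_cderiv_cont (is_cderivZ _ (dA z)).
by apply: oint_bound => // z [Hz _]; rewrite mulN1r; apply: HM.
Qed.

(** This is sign(u) sqrt |u|: [Num.sqrt] vanishes on negative reals, so at most one of the two terms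
    is nonzero. *)
Let sgnsqrt (u : R) : R := Num.sqrt u - Num.sqrt (- u).

Let sgnsqrt_le u v : u <= v -> sgnsqrt u <= sgnsqrt v.
Proof. by move=> uv; apply: lerB; apply: ler_wsqrtr; rewrite ?lerN2. Qed.

Let sgnsqrt_sub u v : u <= 0 <= v -> Num.sqrt (v - u) <= sgnsqrt v - sgnsqrt u.
Proof.
move=> /andP[u0 v0]; rewrite /sgnsqrt (ler0_sqrtr u0) (ler0_sqrtr (_ : - v <= 0)); last by lra.
rewrite subr0 sub0r opprK -(ler_pXn2r (_ : 0 < 2)%N) ?nnegrE ?addr_ge0 ?sqrtr_ge0 //.
rewrite sqrrD !sqr_sqrtr; [|lra|lra|lra].
have : 0 <= Num.sqrt v * Num.sqrt (- u) by rewrite mulr_ge0 ?sqrtr_ge0.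
by rewrite -mulr_natl; lra.
Qed.

(* At the exceptional point only continuity is available, so the integral over a
   small rectangle containing it is o(side) instead of o(area).  The weight
   (A x2 - A x1)(B y2 - B y1), where A and B are signed square roots of the distance
   to the point, is additive and at least of the order of the side there. *)
Theorem goursat F x1 x2 y1 y2 b : x1 <= x2 -> y1 <= y2 -> rect_cont F x1 x2 y1 y2 ->
  (forall z, rect x1 x2 y1 y2 z -> z != b -> exists l, is_cderiv F z l) ->
  oint F x1 x2 y1 y2 = 0.
Proof.
have cint0 (f : R -> R[i]) a : cint f a a = 0.
  by rewrite /cint !/(rint _ a a) lexx set_itv1 !Rintegral_set1.
(* Degenerate rectangles are treated apart because the tolerances below are multiples of [W * H] and
   of sqrt W sqrt H, which must be positive. *)
rewrite le_eqVlt => /orP[/eqP-> _ _ _|x12].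
  by rewrite /oint !cint0 !subrr mulr0 addr0.
rewrite le_eqVlt => /orP[/eqP-> _ _|y12].
  by rewrite /oint !cint0 !subrr mulr0 addr0.
move=> HF HD.
pose W := x2 - x1; pose H := y2 - y1.
have W0 : 0 < W by rewrite subr_gt0.
have H0 : 0 < H by rewrite subr_gt0.
pose w n := W / 2 ^+ n; pose h n := H / 2 ^+ n.
have p2 n : 0 < (2 ^+ n)^-1 :> R by rewrite invr_gt0 exprn_gt0.
have wn n : 0 < w n by rewrite mulr_gt0.
have hn n : 0 < h n by rewrite mulr_gt0.
pose A t := sgnsqrt (t - complex.Re b); pose B t := sgnsqrt (t - complex.Im b).
(* The area term pays for cells around points of differentiability, the product of increments for
   cells around [b]; both are additive under quartering. *)
pose mu n x y := w n * h n + (A (x + w n) - A x) * (B (y + h n) - B y).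
have A_le s t : s <= t -> A s <= A t by move=> st; apply: sgnsqrt_le; rewrite lerD2r.
have B_le s t : s <= t -> B s <= B t by move=> st; apply: sgnsqrt_le; rewrite lerD2r.
have AB0 n x y : 0 <= (A (x + w n) - A x) * (B (y + h n) - B y).
  by rewrite mulr_ge0 // subr_ge0; [apply: A_le|apply: B_le]; rewrite lerDl ltW.
have key e : 0 < e -> normc (oint F x1 x2 y1 y2) <= e * mu 0%N x1 y1.
  move=> e0.
  (* Inclusion in the original rectangle is a premise of [P] because the bisection principle
     quantifies over arbitrary cells. *)
  pose P n x y := x1 <= x -> x + w n <= x2 -> y1 <= y -> y + h n <= y2 ->
    normc (oint F x (x + w n) y (y + h n)) <= e * mu n x y.
  have : P 0%N x1 y1; last first.
    rewrite /P /w /h expr0 !divr1 /W /H !(addrC x1) !(addrC y1) !subrK; exact.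
  apply: (@dyadic_cousin _ P W H); [exact: ltW|exact: ltW| |].
    move=> n x y HP; rewrite /P => a1 a2 a3 a4.
    have Ew : w n = w n.+1 + w n.+1 by rewrite /w exprS; field; rewrite expf_neq0.
    have Eh : h n = h n.+1 + h n.+1 by rewrite /h exprS; field; rewrite expf_neq0.
    have Ex : x + w n.+1 + w n.+1 = x + w n by rewrite Ew addrA.
    have Ey : y + h n.+1 + h n.+1 = y + h n by rewrite Eh addrA.
    have w1 := wn n.+1; have h1 := hn n.+1.
    have fx0 : x <= x + w n.+1 by rewrite lerDl ltW.
    have fx1 : x + w n.+1 <= x + w n by rewrite -Ex lerDl ltW.
    have fy0 : y <= y + h n.+1 by rewrite lerDl ltW.
    have fy1 : y + h n.+1 <= y + h n by rewrite -Ey lerDl ltW.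
    have HF' : rect_cont F x (x + w n) y (y + h n) by apply: (rect_cont_sub HF).
    rewrite (oint_splitx (x := x + w n.+1) HF'); [|by apply/andP; split; lra|lra].
    rewrite (oint_splity (x1 := x) (y := y + h n.+1)); last 3 first.
    - by apply: (rect_cont_sub HF') => //; lra.
    - by lra.
    - by apply/andP; split; lra.
    rewrite (oint_splity (x2 := x + w n) (y := y + h n.+1)); last 3 first.
    - by apply: (rect_cont_sub HF') => //; lra.
    - by lra.
    - by apply/andP; split; lra.
    have := HP false false; have := HP false true; have := HP true false; have := HP true true.
    rewrite /P !mul0r !mul1r !addr0 -/(w n.+1) -/(h n.+1) Ex Ey.
    move=> /(_ (le_trans a1 fx0) a2 (le_trans a3 fy0) a4) q1.
    move=> /(_ (le_trans a1 fx0) a2 a3 (le_trans fy1 a4)) q2.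
    move=> /(_ a1 (le_trans fx1 a2) (le_trans a3 fy0) a4) q3.
    move=> /(_ a1 (le_trans fx1 a2) a3 (le_trans fy1 a4)) q4.
    have -> : mu n x y = mu n.+1 x y + mu n.+1 x (y + h n.+1) +
        (mu n.+1 (x + w n.+1) y + mu n.+1 (x + w n.+1) (y + h n.+1)).
      by rewrite /mu Ex Ey {1}Ew {1}Eh; ring.
    rewrite mulrDr mulrDr [e * (_ + mu n.+1 _ (y + _))]mulrDr.
    apply: le_trans (normcD _ _) _; apply: lerD; apply: le_trans (normcD _ _) _; exact: lerD.
  move=> a c Ha Hc.
  have Hac : rect x1 x2 y1 y2 (a +i* c).
    by move: Ha Hc; rewrite /W /H !(addrC x1) !(addrC y1) !subrK; split.
  have [ab|ab] := eqVneq (a +i* c) b.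
    (* Near [b] the integral is at most 4 e1 (W + H) / 2^n, while the weight of a cell containing
       [b] is at least sqrt(w n) sqrt(h n) = S / 2^n: both scale like the side. *)
    pose S := Num.sqrt W * Num.sqrt H.
    have S0 : 0 < e * S by rewrite !mulr_gt0 // sqrtr_gt0.
    have [e1 e10 He1] := exists_small S0 (ltac:(lra) : 0 <= 4 * (W + H)).
    have [d d0 Hd] := HF _ Hac _ e10.
    exists d => // n x y; rewrite -/(w n) -/(h n) => Hax Hcy nd; rewrite /P => a1 a2 a3 a4.
    have w1 := wn n; have h1 := hn n.
    have Hr : rect x (x + w n) y (y + h n) (a +i* c) by split.
    apply: le_trans (oint_near_affine (z0 := 0) (u := F (a +i* c)) (l := 0) (M := e1) _ _ _ _) _.
    - by lra.
    - by lra.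
    - by apply: (rect_cont_sub HF).
    - move=> z Hz; rewrite mul0r addr0.
      have := Hd (z - (a +i* c)); rewrite [a +i* c + _]addrC subrK; apply.
      by apply: le_lt_trans (rect_dist Hz Hr) _; lra.
    have -> : x + w n - x + (y + h n - y) = (W + H) * (2 ^+ n)^-1.
      by rewrite mulrDl -/(w n) -/(h n); ring.
    have Q1 : Num.sqrt (w n) <= A (x + w n) - A x.
      have := @sgnsqrt_sub (x - complex.Re b) (x + w n - complex.Re b).
      rewrite -ab /= (_ : x + w n - a - (x - a) = w n); last by ring.
      by rewrite /A -ab /=; apply; case/andP: Hax => ? ?; apply/andP; split; lra.
    have Q2 : Num.sqrt (h n) <= B (y + h n) - B y.
      have := @sgnsqrt_sub (y - complex.Im b) (y + h n - complex.Im b).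
      rewrite -ab /= (_ : y + h n - c - (y - c) = h n); last by ring.
      by rewrite /B -ab /=; apply; case/andP: Hcy => ? ?; apply/andP; split; lra.
    have Q3 : S * (2 ^+ n)^-1 = Num.sqrt (w n) * Num.sqrt (h n).
      rewrite /w /h !sqrtrM ?ltW // /S.
      by rewrite -[in LHS](sqr_sqrtr (ltW (p2 n))); ring.
    have Q4 : S * (2 ^+ n)^-1 <= mu n x y.
      rewrite Q3 /mu; apply: le_trans (_ : (A (x + w n) - A x) * (B (y + h n) - B y) <= _).
        by apply: ler_pM; rewrite ?sqrtr_ge0.
      by rewrite lerDr mulr_ge0 ?ltW.
    have Q5 : e1 * (4 * (W + H)) * (2 ^+ n)^-1 <= e * S * (2 ^+ n)^-1 by rewrite ler_wpM2r // ltW.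
    have Q6 : e * (S * (2 ^+ n)^-1) <= e * mu n x y by rewrite ler_wpM2l // ltW.
    by lra.
  have [l Hl] := HD _ Hac ab.
  (* All cells are similar to the original rectangle, so the bound 4 e1 (w n + h n)^2 is a fixed
     multiple of the area; [e1] is chosen to make it at most e w h. *)
  have S0 : 0 < e * (W * H) by rewrite !mulr_gt0.
  have [e1 e10 He1] := exists_small S0 (ltac:(by rewrite mulr_ge0 // sqr_ge0) : 0 <= 4 * (W + H) ^+ 2).
  have [d d0 Hd] := Hl _ e10.
  exists d => // n x y; rewrite -/(w n) -/(h n) => Hax Hcy nd; rewrite /P => a1 a2 a3 a4.
  have w1 := wn n; have h1 := hn n.
  have Hr : rect x (x + w n) y (y + h n) (a +i* c) by split.
  apply: le_trans (oint_near_affine (z0 := a +i* c) (u := F (a +i* c)) (l := l)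
    (M := e1 * (w n + h n)) _ _ _ _) _.
  - by lra.
  - by lra.
  - by apply: (rect_cont_sub HF).
  - move=> z Hz; have D := rect_dist Hz Hr.
    have := Hd (z - (a +i* c)); rewrite [a +i* c + _]addrC subrK opprD addrA => /(_ _)/le_trans; apply.
      by apply: le_lt_trans D _; lra.
    by rewrite ler_wpM2l ?(ltW e10) //; apply: le_trans D _; lra.
  have -> : x + w n - x + (y + h n - y) = w n + h n by ring.
  have E : w n + h n = (W + H) * (2 ^+ n)^-1 by rewrite mulrDl.
  have Q5 : e1 * (4 * (W + H) ^+ 2) * ((2 ^+ n)^-1 * (2 ^+ n)^-1) <=
     e * (W * H) * ((2 ^+ n)^-1 * (2 ^+ n)^-1) by rewrite ler_wpM2r // mulr_ge0 // ltW.
  have Q6 : e * (w n * h n) <= e * mu n x y by rewrite (ler_wpM2l (ltW e0)) // /mu lerDl.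
  have Q7 : e * (w n * h n) = e * (W * H) * ((2 ^+ n)^-1 * (2 ^+ n)^-1) by rewrite /w /h; ring.
  have Q8 : 4 * (e1 * (w n + h n)) * (w n + h n) = e1 * (4 * (W + H) ^+ 2) * ((2 ^+ n)^-1 * (2 ^+ n)^-1).
    by rewrite E; ring.
  by rewrite Q8; lra.
apply: eq0_normc; apply/eqP; rewrite eq_le normc_ge0 andbT leNgt; apply/negP => N0.
have m0 : 0 <= mu 0%N x1 y1 by rewrite addr_ge0 // mulr_ge0 ?ltW.
have [e e0 He] := exists_small (ltac:(lra) : 0 < normc (oint F x1 x2 y1 y2) / 2) m0.
by have := key e e0; lra.
Qed.

End Rectangles.

(** * Cauchy's formula on squares and differentiability of the derivative *)

Section CauchyIntegral.
Variable R : realType.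
Implicit Types (f F G : R[i] -> R[i]) (b z h : R[i]) (s : R).

Let sq s := rect (- s) s (- s) s.
Let sqb s := bdry (- s) s (- s) s.
Let so F s := oint F (- s) s (- s) s.

(** Bounds on four quarters combine by maximum, and continuity bounds [F] near each point, so
    bisection applies. *)
Lemma rect_bounded F x1 x2 y1 y2 : x1 <= x2 -> y1 <= y2 -> rect_cont F x1 x2 y1 y2 ->
  exists2 M : R, 0 <= M & forall z, rect x1 x2 y1 y2 z -> normc (F z) <= M.
Proof.
move=> x12 y12 HF; pose W := x2 - x1; pose H := y2 - y1.
have W0 : 0 <= W by rewrite subr_ge0.
have H0 : 0 <= H by rewrite subr_ge0.
have Ex : x1 + W = x2 by rewrite addrC subrK.
have Ey : y1 + H = y2 by rewrite addrC subrK.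
pose P (n : nat) x y := exists M : R, forall z, rect x1 x2 y1 y2 z ->
  rect x (x + W / 2 ^+ n) y (y + H / 2 ^+ n) z -> normc (F z) <= M.
have : P 0%N x1 y1; last first.
  move=> [M HM]; exists `|M| => // z Hz; apply: le_trans (ler_norm M).
  by apply: HM => //; rewrite !expr0 !divr1 Ex Ey.
apply: (dyadic_cousin W0 H0) => [n x y HP|a b].
  have half (K : R) : K / 2 ^+ n = K / 2 ^+ n.+1 + K / 2 ^+ n.+1.
    by rewrite exprS; field; rewrite expf_neq0.
  have [M1 H1] := HP false false; have [M2 H2] := HP true false.
  have [M3 H3] := HP false true; have [M4 H4] := HP true true.
  exists (Num.max (Num.max M1 M2) (Num.max M3 M4)) => z Hz [].
  rewrite !half; set w := W / _; set k := H / _ => /andP[u1 u2] /andP[v1 v2].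
  rewrite !le_max.
  rewrite !mul0r !mul1r !addr0 -/w -/k in H1 H2 H3 H4.
  have [c1|/ltW c1] := leP (complex.Re z) (x + w); have [c2|/ltW c2] := leP (complex.Im z) (y + k).
  - by rewrite (H1 z Hz) //; split; apply/andP; split; lra.
  - by rewrite (H3 z Hz) ?orbT //; split; apply/andP; split; lra.
  - by rewrite (H2 z Hz) ?orbT //; split; apply/andP; split; lra.
  - by rewrite (H4 z Hz) ?orbT //; split; apply/andP; split; lra.
rewrite Ex Ey => Ha Hb.
have [//|d d0 Hd] := HF (a +i* b) _ _ ltr01.
exists d => // n x y Hax Hby nd; exists (normc (F (a +i* b)) + 1) => z _ Hz.
have Hab : rect x (x + W / 2 ^+ n) y (y + H / 2 ^+ n) (a +i* b) by [].
have zab : normc (z - (a +i* b)) < d.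
  by apply: le_lt_trans (rect_dist Hz Hab) _; rewrite ![_ + _ - _]addrAC !subrr !add0r.
have := Hd _ zab; rewrite [a +i* b + _]addrC subrK.
by have := normcD (F z - F (a +i* b)) (F (a +i* b)); rewrite subrK; lra.
Qed.

Lemma normc_nat n : normc (n%:R : R[i]) = n%:R.
Proof. by rewrite -(rmorph_nat (real_complex R)) normc_real normr_nat. Qed.

(** The radius s/2 keeps [b] at distance at least s/2 from the boundary of the square, which bounds
    the kernels uniformly by powers of 2/s. *)
Definition inner_disc s b := normc b < s / 2.

Lemma sqb_dist s b z : inner_disc s b -> sqb s z -> s / 2 <= normc (z - b).
Proof.
rewrite /inner_disc => Hb [_ Hz].
have := Re_le_normc b; have := Im_le_normc b.
rewrite !ler_norml => /andP[? ?] /andP[? ?].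
case/or4P: Hz => /eqP E.
- apply: le_trans (Re_le_normc _); rewrite raddfB /= E distrC.
  by apply: le_trans (ler_norm _); lra.
- apply: le_trans (Re_le_normc _); rewrite raddfB /= E.
  by apply: le_trans (ler_norm _); lra.
- apply: le_trans (Im_le_normc _); rewrite raddfB /= E distrC.
  by apply: le_trans (ler_norm _); lra.
- apply: le_trans (Im_le_normc _); rewrite raddfB /= E.
  by apply: le_trans (ler_norm _); lra.
Qed.

Lemma inner_disc_gt0 s b : inner_disc s b -> 0 < s.
Proof. by rewrite /inner_disc => H; have := normc_ge0 b; lra. Qed.

Lemma sqb_neq s b z : inner_disc s b -> sqb s z -> z - b != 0.
Proof.
move=> Hb Hz; apply: contraTneq (sqb_dist Hb Hz) => ->.
by rewrite normc0 -ltNge; have := inner_disc_gt0 Hb; lra.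
Qed.

Lemma inner_discD s b h : normc h < s / 2 - normc b -> inner_disc s (b + h).
Proof. by rewrite /inner_disc => H; have := normcD b h; lra. Qed.

Lemma is_cderiv_subz b z : is_cderiv (fun w => w - b) z 1.
Proof. by apply: (is_cderiv_eq (is_cderivB (is_cderiv_id z) (is_cderiv_cst b z))); rewrite subr0. Qed.

Lemma is_cderiv_pow_subz n b z :
  is_cderiv (fun w => (w - b) ^+ n.+1) z (n.+1%:R * (z - b) ^+ n).
Proof.
elim: n => [|n IH].
  by apply: (is_cderiv_eq (is_cderiv_subz b z)); rewrite expr0 mulr1.
have -> : (fun w => (w - b) ^+ n.+2) = (fun w => (w - b) * (w - b) ^+ n.+1).
  by apply/funext => w; rewrite exprS.
apply: (is_cderiv_eq (is_cderivM (is_cderiv_subz b z) IH)).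
by rewrite -[n.+2]addn1 natrD exprS; ring.
Qed.

Lemma bdry_cont_kernel s f b n : inner_disc s b ->
  (forall z, sqb s z -> exists l, is_cderiv f z l) ->
  forall z, sqb s z -> exists l, is_cderiv (fun w => f w / (w - b) ^+ n.+1) z l.
Proof.
move=> Hb Hf z Hz; have [l Hl] := Hf z Hz; eexists.
apply: is_cderiv_div Hl (is_cderiv_pow_subz n b z).
by rewrite expf_neq0 //; exact: sqb_neq Hz.
Qed.

(* On each side the integrand is at least (s/2)/(2(3s/2)^2) = 1/(9s). *)
Lemma winding_ge s b : inner_disc s b -> 8 / 9 <= complex.Im (so (fun z => 1 / (z - b)) s).
Proof.
move=> Hb; have s0 := inner_disc_gt0 Hb.
have [b1 b2] : `|complex.Re b| <= s / 2 /\ `|complex.Im b| <= s / 2.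
  by split; apply: le_trans (ltW Hb); [exact: Re_le_normc|exact: Im_le_normc].
have ss : - s <= s by lra.
have BC : bdry_cont (fun z => 1 / (z - b)) (- s) s (- s) s.
  move=> z Hz; have [|l Hl] := @bdry_cont_kernel s (fun=> 1) b 0 Hb _ z Hz.
    by move=> w _; eexists; exact: is_cderiv_cst.
  exact: is_cderiv_cont Hl.
have KEY (u v : R) : s / 2 <= v -> v <= 3 * s / 2 -> `|u| <= 3 * s / 2 ->
    1 / (9 * s) <= v / (u ^+ 2 + v ^+ 2).
  rewrite ler_norml => v1 v2 /andP[u1 u2].
  have D : 0 < u ^+ 2 + v ^+ 2 by rewrite ltr_wpDl ?sqr_ge0 // exprn_gt0; lra.
  rewrite ler_pdivlMr // mulrAC mul1r ler_pdivrMr ?mulr_gt0 //.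
  have : u ^+ 2 <= (3 * s / 2) ^+ 2 by nra.
  have : v ^+ 2 <= (3 * s / 2) ^+ 2 by nra.
  have : s / 2 * s <= v * s by nra.
  lra.
move: b1 b2; rewrite !ler_norml => /andP[p1 p2] /andP[q1 q2].
(* A side has length 2s, so it contributes at least 2s / (9s) = 2/9; the four sides give 8/9. *)
have LO (g : R -> R) : (forall t, - s <= t <= s -> {for t, continuous g}) ->
    (forall t, - s <= t <= s -> 1 / (9 * s) <= g t) -> 2 / 9 <= rint g (- s) s.
  move=> g1 g2; have -> : 2 / 9 = rint (fun=> 1 / (9 * s)) (- s) s.
    by rewrite rint_cst; field; rewrite gt_eqF.
  by apply: rint_le => // t _; exact: cst_cont.
have UP (g : R -> R) : (forall t, - s <= t <= s -> {for t, continuous g}) ->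
    (forall t, - s <= t <= s -> 1 / (9 * s) <= - g t) -> rint g (- s) s <= - (2 / 9).
  move=> g1 g2; have -> : - (2 / 9) = rint (fun=> - (1 / (9 * s))) (- s) s.
    by rewrite rint_cst; field; rewrite gt_eqF.
  by apply: rint_le => // t Ht; [exact: cst_cont|rewrite lerNr; exact: g2].
have E : complex.Im (so (fun z => 1 / (z - b)) s) =
  rint (fun t => complex.Im (1 / ((t +i* - s) - b))) (- s) s -
  rint (fun t => complex.Im (1 / ((t +i* s) - b))) (- s) s +
  (rint (fun t => complex.Re (1 / ((s +i* t) - b))) (- s) s -
   rint (fun t => complex.Re (1 / ((- s +i* t) - b))) (- s) s).
  by rewrite /so /oint /cint; simpc; rewrite /= ?mul0r ?mul1r ?add0r.
rewrite E; clear E.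
have eb0 (u v : R) : (u +i* v) - b = (u - complex.Re b) +i* (v - complex.Im b).
  by case: b {Hb BC p1 p2 q1 q2} => ? ?; simpc.
have EI u v : complex.Im (1 / ((u +i* v) - b)) =
    - ((v - complex.Im b) / ((u - complex.Re b) ^+ 2 + (v - complex.Im b) ^+ 2)).
  by rewrite eb0 div1r.
have ER u v : complex.Re (1 / ((u +i* v) - b)) =
    (u - complex.Re b) / ((u - complex.Re b) ^+ 2 + (v - complex.Im b) ^+ 2).
  by rewrite eb0 div1r.
have BH1 t : - s <= t <= s -> rcont (fun t => 1 / ((t +i* - s) - b)) t.
  by move=> Ht; apply: (bdry_cont_h BC ss Ht); rewrite eqxx.
have BH2 t : - s <= t <= s -> rcont (fun t => 1 / ((t +i* s) - b)) t.
  by move=> Ht; apply: (bdry_cont_h BC ss Ht); rewrite eqxx orbT.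
have BV1 t : - s <= t <= s -> rcont (fun t => 1 / ((- s +i* t) - b)) t.
  by move=> Ht; apply: (bdry_cont_v BC ss Ht); rewrite eqxx.
have BV2 t : - s <= t <= s -> rcont (fun t => 1 / ((s +i* t) - b)) t.
  by move=> Ht; apply: (bdry_cont_v BC ss Ht); rewrite eqxx orbT.
have I1 : 2 / 9 <= rint (fun t => complex.Im (1 / ((t +i* - s) - b))) (- s) s.
  apply: LO => t Ht; first by case: (BH1 t Ht).
  rewrite EI -mulNr -[X in _ / (_ + X)]sqrrN; case/andP: Ht => t1 t2.
  by apply: KEY; [lra|lra|rewrite ler_norml; apply/andP; split; lra].
have I2 : rint (fun t => complex.Im (1 / ((t +i* s) - b))) (- s) s <= - (2 / 9).
  apply: UP => t Ht; first by case: (BH2 t Ht).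
  rewrite EI opprK; case/andP: Ht => t1 t2.
  by apply: KEY; [lra|lra|rewrite ler_norml; apply/andP; split; lra].
have I3 : 2 / 9 <= rint (fun t => complex.Re (1 / ((s +i* t) - b))) (- s) s.
  apply: LO => t Ht; first by case: (BV2 t Ht).
  rewrite ER [X in _ <= _ / X]addrC; case/andP: Ht => t1 t2.
  by apply: KEY; [lra|lra|rewrite ler_norml; apply/andP; split; lra].
have I4 : rint (fun t => complex.Re (1 / ((- s +i* t) - b))) (- s) s <= - (2 / 9).
  apply: UP => t Ht; first by case: (BV1 t Ht).
  rewrite ER -mulNr [X in _ <= _ / X]addrC -[X in _ <= _ / (_ + X)]sqrrN; case/andP: Ht => t1 t2.
  by apply: KEY; [lra|lra|rewrite ler_norml; apply/andP; split; lra].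
lra.
Qed.

(** The difference quotient of [f] at [b], completed by the derivative there, is differentiable off
    [b] and continuous at [b] by the very definition of the derivative. Hence [goursat] with
    exceptional point [b] annihilates its integral, and on the boundary it splits into the two
    kernels. *)
Lemma cauchy_square s f b : inner_disc s b ->
  (forall z, sq s z -> exists l, is_cderiv f z l) ->
  so (fun z => f z / (z - b)) s = f b * so (fun z => 1 / (z - b)) s.
Proof.
move=> Hb Hf; have s0 := inner_disc_gt0 Hb; have ss : - s <= s by lra.
have bsq : sq s b.
  have := Re_le_normc b; have := Im_le_normc b; move: Hb; rewrite /inner_disc !ler_norml => Hb.
  by move=> /andP[? ?] /andP[? ?]; split; apply/andP; split; lra.
have [l Hl] := Hf b bsq.
pose G z := if z == b then l else (f z - f b) / (z - b).
have GD z : sq s z -> z != b -> exists m, is_cderiv G z m.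
  move=> Hz zb; have [m Hm] := Hf z Hz.
  have zb0 : 0 < normc (z - b) by rewrite normc_gt0 // subr_eq0.
  eexists; apply: (@is_cderiv_near _ (fun w => (f w - f b) / (w - b)) G z _ _ zb0) => [h hz|].
    rewrite /G ifF //; apply/eqP => E.
    by move: hz; rewrite -E opprD addrA subrr sub0r normcN' ltxx.
  apply: is_cderiv_div (is_cderivB Hm (is_cderiv_cst _ _)) (is_cderiv_subz b z).
  by rewrite subr_eq0.
have GC : rect_cont G (- s) s (- s) s.
  move=> z Hz; have [->|zb] := eqVneq z b; last first.
    by have [m Hm] := GD z Hz zb; exact: is_cderiv_cont Hm.
  move=> e e0; have [d d0 Hd] := Hl _ e0; exists d => // h hd.
  rewrite /G eqxx; have [->|h0] := eqVneq h 0.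
    by rewrite addr0 eqxx subrr normc0 ltW.
  rewrite ifF; last by apply/negbTE; rewrite -subr_eq0 addrAC subrr add0r.
  have -> : (f (b + h) - f b) / (b + h - b) - l = (f (b + h) - f b - l * h) / h.
    by rewrite [b + h - b]addrAC subrr add0r; field.
  by rewrite normcf_div ler_pdivrMr ?normc_gt0 //; exact: Hd.
have := goursat ss ss GC GD.
have Hf' z : sqb s z -> exists m, is_cderiv f z m by case=> /Hf.
have C1 : bdry_cont (fun z => f z / (z - b)) (- s) s (- s) s.
  by move=> z Hz; have [m Hm] := @bdry_cont_kernel s f b 0 Hb Hf' z Hz; exact: is_cderiv_cont Hm.
have C2 : bdry_cont (fun z => 1 / (z - b)) (- s) s (- s) s.
  move=> z Hz; have [|m Hm] := @bdry_cont_kernel s (fun=> 1) b 0 Hb _ z Hz.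
    by move=> w _; eexists; exact: is_cderiv_cst.
  exact: is_cderiv_cont Hm.
have C3 : bdry_cont (fun z => - f b * (1 / (z - b))) (- s) s (- s) s.
  move=> z Hz; have [|m Hm] := @bdry_cont_kernel s (fun=> 1) b 0 Hb _ z Hz.
    by move=> w _; eexists; exact: is_cderiv_cst.
  exact: is_cderiv_cont (is_cderivZ (- f b) Hm).
rewrite (@eq_oint _ G (fun z => f z / (z - b) + - f b * (1 / (z - b)))) //; last first.
  move=> z Hz; have zb := sqb_neq Hb Hz.
  by rewrite /G ifF; [field|apply/negbTE; rewrite -subr_eq0].
rewrite ointD // ointZ // => /eqP; rewrite mulNr subr_eq0 => /eqP; exact.
Qed.

(** Differentiation under the integral sign: a quadratic remainder, uniform on the boundary,
    integrates to a quadratic remainder. *)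
Lemma is_cderiv_oint (k : R[i] -> R[i] -> R[i]) (k' : R[i] -> R[i]) s b (C r : R) :
  0 <= s -> 0 < r -> 0 <= C ->
  (forall h, normc h < r -> bdry_cont (k^~ (b + h)) (- s) s (- s) s) ->
  bdry_cont k' (- s) s (- s) s ->
  (forall h z, normc h < r -> sqb s z ->
     normc (k z (b + h) - k z b - h * k' z) <= C * normc h ^+ 2) ->
  is_cderiv (fun w => so (k^~ w) s) b (so k' s).
Proof.
move=> s0 r0 C0 Ck Ck' H e e0; have ss : - s <= s by lra.
(* With side 2s, [oint_bound] gives 4 (C |h|^2) (4s) = 16 s C |h|^2. *)
have [e1 e10 He1] := exists_small e0 (ltac:(by rewrite !mulr_ge0) : 0 <= 16 * s * C).
exists (Num.min r e1) => [|h]; first by rewrite lt_min r0.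
rewrite lt_min => /andP[hr he].
have Ck0 : bdry_cont (k^~ b) (- s) s (- s) s.
  by have := Ck 0; rewrite normc0 addr0; apply.
have CZ (c : R[i]) F : bdry_cont F (- s) s (- s) s -> bdry_cont (fun z => c * F z) (- s) s (- s) s.
  move=> HF z /HF HC e' e'0; have [e2 e20 He2] := exists_small e'0 (normc_ge0 c).
  have [d d0 Hd] := HC _ e20; exists d => // w /Hd Hw; rewrite -mulrBr normcM.
  by have := normc_ge0 c; nra.
have E : so (k^~ (b + h)) s - so (k^~ b) s - so k' s * h =
    so (fun z => k z (b + h) + (-1 * k z b + - h * k' z)) s.
  rewrite /so ointD //; [|exact: Ck|by move=> z Hz; apply: ccontD; apply: CZ].
  by rewrite ointD //; [rewrite !ointZ //; ring|apply: CZ|apply: CZ].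
rewrite E; apply: le_trans (@oint_bound _ _ _ _ _ _ (C * normc h ^+ 2) ss ss _ _) _.
- move=> z Hz; apply: ccontD; first exact: Ck.
  by apply: ccontD; apply: CZ.
- move=> z Hz; apply: le_trans (H h z hr Hz); rewrite le_eqVlt; apply/orP; left.
  by apply/eqP; congr normc; ring.
have -> : 4 * (C * normc h ^+ 2) * (s - - s + (s - - s)) = (normc h * (16 * s * C)) * normc h by ring.
rewrite ler_wpM2r ?normc_ge0 //; apply: le_trans He1; rewrite ler_wpM2r ?(ltW he) //.
by rewrite !mulr_ge0.
Qed.

(** Cauchy-type integral of order n at the parameter [b]; differentiating order 1 in [b] gives order
    2. *)
Let K n f s b := so (fun z => f z / (z - b) ^+ n) s.

Section Kernels.
Variables (s : R) (f : R[i] -> R[i]).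
Hypothesis f_hol : forall z, sqb s z -> exists l, is_cderiv f z l.
Hypothesis f_bd : exists2 M : R, 0 <= M & forall z, sqb s z -> normc (f z) <= M.

Let KC n b : inner_disc s b -> bdry_cont (fun z => f z / (z - b) ^+ n.+1) (- s) s (- s) s.
Proof. by move=> Hb z Hz; have [l Hl] := bdry_cont_kernel n Hb f_hol Hz; exact: is_cderiv_cont Hl. Qed.

Lemma inv_dist b z : inner_disc s b -> sqb s z -> normc (z - b)^-1 <= 2 / s.
Proof.
move=> Hb Hz; have s0 := inner_disc_gt0 Hb; rewrite normcV.
have := sqb_dist Hb Hz => D; have D0 : 0 < normc (z - b) by apply: lt_le_trans D; lra.
by rewrite -[2 / s]invrK lef_pV2 ?posrE ?invr_gt0 ?divr_gt0 // invf_div.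
Qed.

Lemma is_cderiv_kernel1 b : inner_disc s b -> is_cderiv (K 1 f s) b (K 2 f s b).
Proof.
move=> Hb; have s0 := inner_disc_gt0 Hb; have [M M0 HM] := f_bd.
apply: (@is_cderiv_oint (fun z b => f z / (z - b) ^+ 1) _ s b (M * ((2 / s) ^+ 2 * (2 / s))) (s / 2 - normc b)).
- exact: ltW.
- by rewrite subr_gt0.
- by rewrite !mulr_ge0 // ?exprn_ge0 // ?invr_ge0 ltW.
- by move=> h hr; apply: KC; exact: inner_discD.
- exact: KC.
move=> h z hr Hz; have u0 := sqb_neq Hb Hz.
have Hbh := inner_discD hr; have v0 := sqb_neq Hbh Hz.
(* With u = z - b the exact remainder is 1/(u-h) - 1/u - h/u^2 = h^2 / (u^2 (u-h)). *)
have -> : f z / (z - (b + h)) ^+ 1 - f z / (z - b) ^+ 1 - h * (f z / (z - b) ^+ 2) =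
  f z * ((z - b)^-1 ^+ 2 * (z - (b + h))^-1) * h ^+ 2.
  by field; rewrite v0 u0.
rewrite [normc (_ * h ^+ 2)]normcM normcX ler_wpM2r ?exprn_ge0 ?normc_ge0 //.
rewrite [normc (f z * _)]normcM; apply: ler_pM; rewrite ?normc_ge0 //; first exact: HM.
rewrite normcM normcX; apply: ler_pM; rewrite ?exprn_ge0 ?normc_ge0 //; last exact: inv_dist.
by rewrite ler_pXn2r ?nnegrE ?normc_ge0 ?divr_ge0 ?(ltW s0) //; exact: inv_dist.
Qed.

Lemma is_cderiv_kernel2 b : inner_disc s b -> exists l, is_cderiv (K 2 f s) b l.
Proof.
move=> Hb; have s0 := inner_disc_gt0 Hb; have [M M0 HM] := f_bd.
exists (so (fun z => 2 * (f z / (z - b) ^+ 3)) s).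
apply: (@is_cderiv_oint (fun z b => f z / (z - b) ^+ 2) _ s b
  (M * ((11 * s) * ((2 / s) ^+ 3 * (2 / s) ^+ 2))) (Num.min s (s / 2 - normc b))).
- exact: ltW.
- by rewrite lt_min s0 subr_gt0.
- by rewrite !mulr_ge0 // ?exprn_ge0 // ?mulr_ge0 ?invr_ge0 // ltW.
- by move=> h; rewrite lt_min => /andP[_ hr]; apply: KC; exact: inner_discD.
- move=> z Hz; have [l Hl] := bdry_cont_kernel 2 Hb f_hol Hz.
  exact: is_cderiv_cont (is_cderivZ 2 Hl).
move=> h z; rewrite lt_min => /andP[hs hr] Hz; have u0 := sqb_neq Hb Hz.
have Hbh := inner_discD hr; have v0 := sqb_neq Hbh Hz.
have -> : f z / (z - (b + h)) ^+ 2 - f z / (z - b) ^+ 2 - h * (2 * (f z / (z - b) ^+ 3)) =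
  f z * ((3 * (z - b) - 2 * h) * ((z - b)^-1 ^+ 3 * (z - (b + h))^-1 ^+ 2)) * h ^+ 2.
  by field; rewrite v0 u0.
(* Here |z| <= 2s, |b| < s/2 and |h| < s, so the modulus is below 3 (5s/2) + 2s = 19s/2. *)
have Hn : normc (3 * (z - b) - 2 * h) <= 11 * s.
  have [[/andP[? ?] /andP[? ?]] _] := Hz.
  have z2 : normc z <= 2 * s.
    apply: le_trans (normc_le_ReIm z) _; have -> : 2 * s = s + s by ring.
    by apply: lerD; rewrite ler_norml; apply/andP.
  have := normcB (3 * (z - b)) (2 * h); have := normcB z b; rewrite !normcM.
  by rewrite !normc_nat; move: Hb; rewrite /inner_disc; lra.
rewrite [normc (_ * h ^+ 2)]normcM normcX ler_wpM2r ?exprn_ge0 ?normc_ge0 //.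
rewrite [normc (f z * _)]normcM; apply: ler_pM; rewrite ?normc_ge0 //; first exact: HM.
rewrite normcM; apply: ler_pM; rewrite ?normc_ge0 //.
rewrite normcM !normcX; apply: ler_pM; rewrite ?exprn_ge0 ?normc_ge0 //;
  by rewrite ler_pXn2r ?nnegrE ?normc_ge0 ?divr_ge0 ?(ltW s0) //; exact: inv_dist.
Qed.

End Kernels.

(** Let I(b) be the integral of dz/(z-b). Differentiating f I = [K 1 f s], which is Cauchy's
    formula, gives f' = ([K 2 f s] - f [K 2 1 s]) / I on the inner disc. Every ingredient on the
    right is differentiable at 0, and I does not vanish by [winding_ge]. *)
Lemma cderiv2_origin s f (f' : R[i] -> R[i]) : 0 < s ->
  (forall z, sq s z -> is_cderiv f z (f' z)) -> exists l, is_cderiv f' 0 l.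
Proof.
move=> s0 Hf; have ss : - s <= s by lra.
have f_hol z : sq s z -> exists l, is_cderiv f z l by move=> /Hf; exists (f' z).
have f_holb z : sqb s z -> exists l, is_cderiv f z l by case=> /f_hol.
have [|M M0 HM] := rect_bounded ss ss (F := f); first by move=> z /Hf /is_cderiv_cont.
have f_bd : exists2 M : R, 0 <= M & forall z, sqb s z -> normc (f z) <= M.
  by exists M => // z [/HM].
have one_hol z : sqb s z -> exists l, is_cderiv (fun=> 1 : R[i]) z l.
  by move=> _; eexists; exact: is_cderiv_cst.
have one_bd : exists2 M : R, 0 <= M & forall z, sqb s z -> normc (1 : R[i]) <= M.
  by exists 1 => //; rewrite normc1.
pose I b := K 1 (fun=> 1) s b.
have I0 b : inner_disc s b -> I b != 0.
  move=> Hb; apply: contraTneq (winding_ge Hb) => I0.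
  have -> : so (fun z => 1 / (z - b)) s = I b by [].
  by rewrite I0 /= -ltNge.
have fI b : inner_disc s b -> f b * I b = K 1 f s b.
  by move=> Hb; apply/esym; exact: (cauchy_square Hb f_hol).
have f'E b : inner_disc s b -> f' b = (K 2 f s b - f b * K 2 (fun=> 1) s b) / I b.
  move=> Hb; have bs : sq s b.
    move: (Hb) => /[dup]/inner_disc_gt0 ? ; rewrite /inner_disc => ?.
    have := Re_le_normc b; have := Im_le_normc b; rewrite !ler_norml.
    by move=> /andP[? ?] /andP[? ?]; split; apply/andP; split; lra.
  have D1 := is_cderivM (Hf b bs) (is_cderiv_kernel1 one_hol one_bd Hb).
  have D2 := is_cderiv_kernel1 f_holb f_bd Hb.
  have r0 : 0 < s / 2 - normc b by rewrite subr_gt0.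
  have D3 := is_cderiv_near r0 (fun h hr => fI _ (inner_discD hr)) D1.
  by rewrite -(is_cderiv_unique D3 D2) -/(I b) addrK mulfK // I0.
have H0 : inner_disc s 0 by rewrite /inner_disc normc0; lra.
have [l1 D1] := is_cderiv_kernel2 f_holb f_bd H0.
have [l2 D2] := is_cderiv_kernel2 one_hol one_bd H0.
have D3 := is_cderiv_kernel1 one_hol one_bd H0.
have D0 : is_cderiv f 0 (f' 0) by apply: Hf; split; rewrite /= oppr_le0 ltW.
have D := is_cderiv_div (I0 0 H0) (is_cderivB D1 (is_cderivM D0 D2)) D3.
have s20 : 0 < s / 2 by lra.
eexists; apply: (is_cderiv_near s20 _ D) => h hs; rewrite add0r -f'E //.
Qed.

Lemma derivative_cderiv f z : holomorphic_on_disc f -> unit_disc z ->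
  exists l, is_cderiv (cderive f) z l.
Proof.
(* Points of the square of half-side s have modulus at most 2s = (1 - |z|)/2, so its translate by z
   stays in the disc. *)
move=> Hf Hz; pose s := (1 - normc z) / 4.
have s0 : 0 < s by rewrite divr_gt0 // subr_gt0.
have [w [/andP[? ?] /andP[? ?]]|l Hl] := @cderiv2_origin s (fun w => f (w + z)) (fun w => cderive f (w + z)) s0.
  have wz : unit_disc (w + z).
    rewrite /unit_disc /=; have := normcD w z; have := normc_le_ReIm w.
    have : `|complex.Re w| <= s by rewrite ler_norml; apply/andP.
    have : `|complex.Im w| <= s by rewrite ler_norml; apply/andP.
    by move: (Hz); rewrite /s /unit_disc /=; lra.
  have D : is_cderiv (fun w => w + z) w 1.
    by apply: (is_cderiv_eq (is_cderivD (is_cderiv_id w) (is_cderiv_cst z w))); rewrite addr0.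
  by apply: (is_cderiv_eq (is_cderiv_comp D (holo_cderiv Hf wz))); rewrite mulr1.
exists l => e e0; have [d d0 Hd] := Hl e e0; exists d; first exact: d0.
by move=> h hd; have := Hd h hd; rewrite !add0r [h + z]addrC.
Qed.

End CauchyIntegral.

(** * Primitives on the disc and the derivative of the integral operator *)

Section DiscPrimitive.
Variable R : realType.
Implicit Types (F P : R[i] -> R[i]) (z h : R[i]) (x y : R).

Lemma oint_flipx F x1 x2 y1 y2 : oint F x1 x2 y1 y2 = - oint F x2 x1 y1 y2.
Proof. by rewrite /oint ![cint _ x1 x2]cintC; ring. Qed.

Lemma oint_flipy F x1 x2 y1 y2 : oint F x1 x2 y1 y2 = - oint F x1 x2 y2 y1.
Proof. by rewrite /oint ![cint _ y1 y2]cintC; ring. Qed.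

Lemma goursat_seg F x1 x2 y1 y2 :
  (forall x y, seg x1 x2 x -> seg y1 y2 y -> exists l, is_cderiv F (x +i* y) l) ->
  oint F x1 x2 y1 y2 = 0.
Proof.
wlog x12 : x1 x2 / x1 <= x2.
  move=> W; have [|/ltW] := leP x1 x2; first by move=> ?; apply: W.
  by move=> x21 H; rewrite oint_flipx W ?oppr0 // => x y; rewrite segC; apply: H.
wlog y12 : y1 y2 / y1 <= y2.
  move=> W; have [|/ltW] := leP y1 y2; first by move=> ?; apply: W.
  by move=> y21 H; rewrite oint_flipy W ?oppr0 // => x y Hx; rewrite segC; apply: H.
move=> H; have D z : rect x1 x2 y1 y2 z -> exists l, is_cderiv F z l.
  by case: z => x y [Hx Hy]; apply: H; rewrite segE.
apply: (@goursat _ _ _ _ _ _ 0 x12 y12) => [z /D[l]|z /D //].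
exact: is_cderiv_cont.
Qed.

Lemma normc_le2 (a b c d : R) : `|a| <= `|c| -> `|b| <= `|d| -> normc (a +i* b) <= normc (c +i* d).
Proof.
move=> ac bd; rewrite /normc ler_wsqrtr //.
rewrite -(real_normK (num_real a)) -(real_normK (num_real b)).
rewrite -(real_normK (num_real c)) -(real_normK (num_real d)).
by apply: lerD; rewrite ler_pXn2r ?nnegrE.
Qed.

(** With each of its points the disc contains the rectangle spanned by that point and the axes, so
    axis-parallel paths from 0 stay inside. *)
Lemma disc_le2 (a b c d : R) : unit_disc (c +i* d) -> `|a| <= `|c| -> `|b| <= `|d| ->
  unit_disc (a +i* b).
Proof. by move=> cd ac bd; apply: le_lt_trans (normc_le2 ac bd) cd. Qed.

Lemma cint_cst (k : R[i]) a b : cint (fun=> k) a b = k * (b - a)%:C.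
Proof. by rewrite /cint !rint_cst; case: k => u v; simpc. Qed.

Lemma seg0 y t : seg 0 y t -> `|t| <= `|y|.
Proof.
rewrite /seg /= ge_min le_max => /andP[/orP[] h1 /orP[] h2].
- have -> : t = 0 by lra.
  by rewrite normr0.
- by rewrite !ger0_norm //; lra.
- by rewrite !ler0_norm //; lra.
- have -> : t = y by lra.
  by [].
Qed.

Lemma seg_shift x (h : R) t : seg x (x + h) t -> exists2 k, t = x + k & `|k| <= `|h|.
Proof.
rewrite /seg /= ge_min le_max => H; exists (t - x); first by rewrite addrC subrK.
case/andP: H => /orP[] h1 /orP[] h2.
- have -> : t - x = 0 by lra.
  by rewrite normr0.
- by rewrite !ger0_norm //; lra.
- by rewrite !ler0_norm //; lra.
- have -> : t - x = h by lra.
  by [].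
Qed.

Lemma cint_near F gam v x (h : R) (k : R[i]) M : affine gam v ->
  (forall t, seg x (x + h) t -> ccont F (gam t)) ->
  (forall t, seg x (x + h) t -> normc (F (gam t) - k) <= M) ->
  normc (cint (fun t => F (gam t)) x (x + h) - k * h%:C) <= 2 * M * `|h|.
Proof.
move=> Hg HF HM.
have C t : seg x (x + h) t -> rcont (fun t => F (gam t)) t by move=> /HF; apply: ccont_affine.
have Ck t : rcont (fun=> - k) t by split; exact: cst_continuous.
have -> : cint (fun t => F (gam t)) x (x + h) - k * h%:C =
    cint (fun t => F (gam t) + - k) x (x + h).
  by rewrite cintD // cint_cst [x + h - x]addrAC subrr add0r mulNr.
have {2}-> : h = x + h - x by rewrite [x + h - x]addrAC subrr add0r.
by apply: cint_bound => // t st; apply: rcontD; [exact: C|exact: Ck].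
Qed.

(** The primitive integrates along the real axis and then vertically. Its increment is compared with
    [F] on two short sides at the target point, after Goursat's lemma has moved the horizontal one
    from height 0 to height y. *)
Theorem disc_primitive F : (forall z, unit_disc z -> exists l, is_cderiv F z l) ->
  exists P, forall z, unit_disc z -> is_cderiv P z (F z).
Proof.
move=> HF; have CF z : unit_disc z -> ccont F z by move=> /HF[l]; exact: is_cderiv_cont.
exists (fun z => cint (fun t => F (t +i* 0)) 0 (complex.Re z) +
  'i * cint (fun t => F (complex.Re z +i* t)) 0 (complex.Im z)).
case=> x y Hz e e0.
(* Two sides, each with the factor 2 of [cint_bound] and length at most |h|, turn e/4 into e. *)
have [d d0 Hd] := CF _ Hz (e / 4) (ltac:(lra)).
have r0 : 0 < 1 - normc (x +i* y) by rewrite subr_gt0.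
exists (Num.min d (1 - normc (x +i* y))); first by rewrite lt_min d0.
case=> h1 h2; rewrite lt_min => /andP[hd hr].
have xyD t s : (x +i* y) + (t +i* s) = (x + t) +i* (y + s) by simpc.
have NB t s : `|t| <= `|h1| -> `|s| <= `|h2| -> unit_disc ((x + t) +i* (y + s)).
  move=> /normc_le2 H1 /H1 H2; have N := normcD (x +i* y) (t +i* s).
  have {N H1} : normc ((x + t) +i* (y + s)) < 1 by rewrite -xyD; lra.
  by [].
have Fd t s : `|t| <= `|h1| -> `|s| <= `|h2| ->
    normc (F ((x + t) +i* (y + s)) - F (x +i* y)) <= e / 4.
  move=> /normc_le2 H1 /H1 H2; have := Hd (t +i* s); rewrite xyD; apply.
  exact: le_lt_trans H2 hd.
have DX : unit_disc ((x + h1) +i* y) by have := NB h1 0; rewrite addr0 normr0; apply.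
have axis : cint (fun t => F (t +i* 0)) 0 (x + h1) =
    cint (fun t => F (t +i* 0)) 0 x + cint (fun t => F (t +i* 0)) x (x + h1).
  pose m := Num.max `|x| `|x + h1|.
  rewrite (cint_chasles (A := - m) (B := m)) //.
  - move=> t Ht; apply: (ccont_affine (affine_h 0)); apply: CF.
    have : `|t| <= m by rewrite ler_norml.
    rewrite /m le_max => /orP[] H.
      by apply: (disc_le2 Hz) => //; rewrite normr0.
    by apply: (disc_le2 DX) => //; rewrite normr0.
  - by rewrite -ler_norml normr0 /m le_max normr_ge0.
  - by rewrite -ler_norml /m le_max lexx.
  - by rewrite -ler_norml /m le_max lexx orbT.
have vert : cint (fun t => F ((x + h1) +i* t)) 0 (y + h2) =
    cint (fun t => F ((x + h1) +i* t)) 0 y + cint (fun t => F ((x + h1) +i* t)) y (y + h2).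
  pose m := Num.max `|y| `|y + h2|.
  rewrite (cint_chasles (A := - m) (B := m)) //.
  - move=> t Ht; apply: (ccont_affine (affine_v (x + h1))); apply: CF.
    have : `|t| <= m by rewrite ler_norml.
    rewrite /m le_max => /orP[] H.
      exact: (disc_le2 DX).
    by apply: (disc_le2 (NB h1 h2 _ _)).
  - by rewrite -ler_norml normr0 /m le_max normr_ge0.
  - by rewrite -ler_norml /m le_max lexx.
  - by rewrite -ler_norml /m le_max lexx orbT.
have rct : oint F x (x + h1) 0 y = 0.
  apply: goursat_seg => u v /seg_shift[k -> kh] /seg0 vy; apply: HF.
  by have := NB k 0 kh; rewrite addr0 normr0 => /(_ (normr_ge0 _)) /disc_le2; apply.
pose C1 := cint (fun t => F (t +i* y)) x (x + h1).
pose C2 := cint (fun t => F ((x + h1) +i* t)) y (y + h2).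
have B1 : normc (C1 - F (x +i* y) * h1%:C) <= 2 * (e / 4) * `|h1|.
  apply: (cint_near (affine_h y)) => t /seg_shift[k -> kh].
    by apply: CF; have := NB k 0 kh; rewrite addr0 normr0; apply.
  by have := Fd k 0 kh; rewrite addr0 normr0; apply.
have B2 : normc (C2 - F (x +i* y) * h2%:C) <= 2 * (e / 4) * `|h2|.
  apply: (cint_near (affine_v (x + h1))) => t /seg_shift[k -> kh].
    by apply: CF; apply: NB.
  by apply: Fd.
have -> : cint (fun t => F (t +i* 0)) 0 (complex.Re (x +i* y + h1 +i* h2)) +
    'i * cint (fun t => F (complex.Re (x +i* y + h1 +i* h2) +i* t)) 0
           (complex.Im (x +i* y + h1 +i* h2)) -
    (cint (fun t => F (t +i* 0)) 0 (complex.Re (x +i* y)) +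
     'i * cint (fun t => F (complex.Re (x +i* y) +i* t)) 0 (complex.Im (x +i* y))) -
    F (x +i* y) * (h1 +i* h2) =
  (C1 - F (x +i* y) * h1%:C) + 'i * (C2 - F (x +i* y) * h2%:C).
  have -> : complex.Re (x +i* y + h1 +i* h2) = x + h1 by [].
  have -> : complex.Im (x +i* y + h1 +i* h2) = y + h2 by [].
  have -> : complex.Re (x +i* y) = x by [].
  have -> : complex.Im (x +i* y) = y by [].
  have -> : h1 +i* h2 = h1%:C + 'i * h2%:C :> R[i] by simpc.
  rewrite axis vert /C2; move: rct; rewrite /oint -/C1.
  move=> /eqP; rewrite addr_eq0 => /eqP; rewrite -[X in X = _]addr0.
  set a0 := cint _ 0 x; set a1 := cint _ x (x + h1); set b0 := cint _ 0 y; set b1 := cint _ 0 y.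
  set c := cint _ y (y + h2); move=> E.
  have -> : a1 = C1 - 'i * (b0 - b1) by rewrite -[a1](subrK C1) -[a1 - C1]addr0 E; ring.
  ring.
apply: le_trans (normcD _ _) _; rewrite normcM normc_i mul1r.
have := Re_le_normc (h1 +i* h2); have := Im_le_normc (h1 +i* h2); rewrite /= -/(normc (h1 +i* h2)).
by have := normr_ge0 h1; have := normr_ge0 h2; nra.
Qed.

Lemma segment_integral_primitive P F z :
  (forall w, unit_disc w -> is_cderiv P w (F w)) -> (forall w, unit_disc w -> ccont F w) ->
  unit_disc z -> segment_integral F z = P z - P 0.
Proof.
move=> HP HF Hz.
have E : segment_integral F z = z * cint (fun t => F (t%:C * z)) 0 1.
  by rewrite /segment_integral /cint /rint ler01.
have D t : seg 0 1 t -> unit_disc (t%:C * z).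
  rewrite segE // => /andP[t0 t1]; rewrite /unit_disc /= normcM normc_real ger0_norm //.
  by move: Hz; rewrite /unit_disc /=; have := normc_ge0 z; nra.
rewrite E (cint_FTC (P := P) (affine_ray z)); first by rewrite mul1r mul0r.
  by move=> t /D/HP.
by move=> t /D/HF.
Qed.

(** The product f' g is differentiable because f' is, hence has a primitive, and the segment
    integral is an increment of it. *)
Lemma I_op_cderiv f g : holomorphic_on_disc f -> holomorphic_on_disc g ->
  exists2 P, forall z, unit_disc z -> is_cderiv P z (cderive f z * g z) &
    forall z, unit_disc z -> I_op g f z = P z - P 0.
Proof.
move=> Hf Hg.
have HF z : unit_disc z -> exists l, is_cderiv (fun w => cderive f w * g w) z l.
  move=> Hz; have [l Hl] := derivative_cderiv Hf Hz.
  by eexists; apply: is_cderivM Hl (holo_cderiv Hg Hz).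
have [P HP] := disc_primitive HF; exists P => // z Hz.
apply: segment_integral_primitive => // w /HF[l]; exact: is_cderiv_cont.
Qed.

End DiscPrimitive.

(** * Measurability of continuous integrands on the disc *)

Section PlaneMeasurability.
Variable R : realType.
Implicit Types (F : R[i] -> R[i]) (w : R * R) (O : set (R * R)).

Definition disc2 : set (R * R) := [set w | unit_disc (w.1 +i* w.2)].

(** The product sigma-algebra is generated by measurable rectangles, so an open set is written as
    the countable union of the rational boxes it contains. *)
Lemma box_open_measurable O :
  (forall w, O w -> exists2 r : R, 0 < r & forall v : R * R,
     `|v.1 - w.1| < r -> `|v.2 - w.2| < r -> O v) -> measurable O.
Proof.
move=> HO.
pose box (q : rat * rat * rat) : set (R * R) :=
  `](ratr q.1.1 - ratr q.2), (ratr q.1.1 + ratr q.2)[ `*`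
  `](ratr q.1.2 - ratr q.2), (ratr q.1.2 + ratr q.2)[.
pose U q := if pselect (box q `<=` O) then box q else set0.
have -> : O = \bigcup_q U q.
  apply/seteqP; split => [w Ow|w [q _]]; last first.
    by rewrite /U; case: pselect => // bO /bO.
  have [r r0 Hr] := HO w Ow.
  (* A box of half-width k centred within k of [w] in each coordinate contains [w] and lies within
     2k < r of it. *)
  have [k] := @rat_in_itvoo R 0 (r / 2) (ltac:(lra)); rewrite in_itv /= => /andP[k0 kr].
  have [a] := @rat_in_itvoo R (w.1 - ratr k) (w.1 + ratr k) (ltac:(lra)).
  rewrite in_itv /= => /andP[a1 a2].
  have [b] := @rat_in_itvoo R (w.2 - ratr k) (w.2 + ratr k) (ltac:(lra)).
  rewrite in_itv /= => /andP[b1 b2].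
  exists (a, b, k) => //; rewrite /U; case: pselect => [bO|nb].
    by split; rewrite /= in_itv /=; apply/andP; split; lra.
  case: nb => v [] /=; rewrite !in_itv /= => /andP[? ?] /andP[? ?].
  by apply: Hr; rewrite ltr_norml; apply/andP; split; lra.
apply: countable_bigcupT_measurable; first exact: countableP.
move=> q; rewrite /U; case: pselect => qO; last exact: measurable0.
by apply: measurableX; exact: measurable_itv.
Qed.

Lemma measurable_disc_norm F : (forall z, unit_disc z -> ccont F z) ->
  measurable_fun disc2 (fun w => normc (F (w.1 +i* w.2))).
Proof.
move=> HF mD; apply: (measurability _ (RGenOInfty.measurableE R)) => //.
move=> _ [_ [x ->] <-]; apply: box_open_measurable => w [Dw].
rewrite /= in_itv /= andbT => xw.
have e0 : 0 < (normc (F (w.1 +i* w.2)) - x) / 2 by lra.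
have [d d0 Hd] := HF _ Dw _ e0.
have n1 : 0 < 1 - normc (w.1 +i* w.2) by rewrite subr_gt0.
exists (Num.min d (1 - normc (w.1 +i* w.2)) / 2).
  by rewrite divr_gt0 // lt_min d0.
move=> v; set r := Num.min _ _ => v1 v2.
pose h := (v.1 - w.1) +i* (v.2 - w.2).
have Ev : v.1 +i* v.2 = w.1 +i* w.2 + h.
  by rewrite /h; simpc; rewrite !subrKC.
have hr : normc h < r.
  apply: le_lt_trans (normc_le_ReIm h) _.
  have -> : complex.Re h = v.1 - w.1 by [].
  have -> : complex.Im h = v.2 - w.2 by [].
  by lra.
move: hr; rewrite lt_min => /andP[hd hn]; split.
  have := normcD (w.1 +i* w.2) h; rewrite -Ev => N.
  have {}N : normc (v.1 +i* v.2) < 1 by lra.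
  by [].
rewrite /= in_itv /= andbT.
have {Hd} := Hd h hd; rewrite -Ev => H1.
have := normc_subl (F (w.1 +i* w.2)) (F (v.1 +i* v.2)); rewrite normc_distC => H2.
have {}H : x < normc (F (v.1 +i* v.2)) by lra.
by [].
Qed.

Lemma measurable_disc2 : measurable disc2.
Proof.
apply: box_open_measurable => w Dw.
have n1 : 0 < 1 - normc (w.1 +i* w.2) by rewrite subr_gt0.
exists ((1 - normc (w.1 +i* w.2)) / 2); first by rewrite divr_gt0.
move=> v v1 v2; pose h := (v.1 - w.1) +i* (v.2 - w.2).
have Ev : v.1 +i* v.2 = w.1 +i* w.2 + h.
  by rewrite /h; simpc; rewrite !subrKC.
have hr : normc h < 1 - normc (w.1 +i* w.2).
  apply: le_lt_trans (normc_le_ReIm h) _.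
  have -> : complex.Re h = v.1 - w.1 by [].
  have -> : complex.Im h = v.2 - w.2 by [].
  by lra.
have := normcD (w.1 +i* w.2) h; rewrite -Ev => N.
have {}N : normc (v.1 +i* v.2) < 1 by lra.
by [].
Qed.

Lemma measurable_disc_weight (p : R) :
  measurable_fun disc2 (fun w => (1 - normc (w.1 +i* w.2) ^+ 2) `^ p).
Proof.
apply: (measurableT_comp (f := fun x : R => x `^ p)); first exact: measurable_powR.
apply: measurable_funB; first exact: measurable_cst.
apply: measurable_funX; apply: (measurable_disc_norm (F := id)) => z _.
exact: is_cderiv_cont (is_cderiv_id z).
Qed.

End PlaneMeasurability.

(** * Bounding the value at 0 by a weighted area integral *)

Section PointEvaluation.
Variable R : realType.
Implicit Types (E : R[i] -> R[i]) (s : R).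

(** Cauchy's formula at 0 with the integrand E(z)/z: the factor 4 comes from |z| >= s >= 1/4 on the
    boundary, and 8/9 from [winding_ge]. *)
Lemma square_sides_bound E s : 4^-1 <= s ->
  (forall z, rect (- s) s (- s) s z -> exists l, is_cderiv E z l) ->
  exists f : R[i] -> R[i], [/\ bdry_cont f (- s) s (- s) s,
    forall z, bdry (- s) s (- s) s z -> normc (f z) <= 4 * normc (E z) &
    8 / 9 * normc (E 0) <= normc (cint (fun t => f (t +i* s)) (- s) s) +
      normc (cint (fun t => f (t +i* (- s))) (- s) s) +
      (normc (cint (fun t => f (s +i* t)) (- s) s) +
       normc (cint (fun t => f ((- s) +i* t)) (- s) s))].
Proof.
move=> s4 Hsq; have s0 : 0 < s by lra.
have h0 : inner_disc s (0 : R[i]) by rewrite /inner_disc normc0; lra.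
have C := cauchy_square h0 Hsq; have W := winding_ge h0.
exists (fun z => E z / (z - 0)); split.
- have Hb z : bdry (- s) s (- s) s z -> exists l, is_cderiv E z l by case=> /Hsq.
  move=> z Hz; have [l Hl] := bdry_cont_kernel 0 h0 Hb Hz.
  exact: is_cderiv_cont Hl.
- move=> z [_ Hz]; rewrite subr0 normcf_div.
  have zs : s <= normc z.
    case/or4P: Hz => /eqP e.
    - by apply: le_trans (Re_le_normc z); rewrite e normrN ger0_norm // ltW.
    - by apply: le_trans (Re_le_normc z); rewrite e ger0_norm // ltW.
    - by apply: le_trans (Im_le_normc z); rewrite e normrN ger0_norm // ltW.
    - by apply: le_trans (Im_le_normc z); rewrite e ger0_norm // ltW.
  by rewrite ler_pdivrMr; [have := normc_ge0 (E z); nra|lra].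
pose I := oint (fun z => 1 / (z - 0)) (- s) s (- s) s.
rewrite -/I in C W; clearbody I; move: C W; rewrite /oint.
set q1 := cint _ _ _; set q2 := cint _ _ _; set q3 := cint _ _ _; set q4 := cint _ _ _.
move=> C W.
have {C} : normc (E 0) * normc I <= normc q1 + normc q2 + (normc q3 + normc q4).
  rewrite -normcM -C; apply: le_trans (normcD _ _) _; rewrite normcM normc_i mul1r.
  by apply: lerD; exact: normcB.
have : 8 / 9 <= normc I by apply: le_trans W _; apply: le_trans (Im_le_normc I); exact: ler_norm.
move=> I89 EI; rewrite [normc q2 + normc q1]addrC; apply: le_trans EI.
by rewrite mulrC ler_wpM2l ?normc_ge0.
Qed.

Local Open Scope ereal_scope.

Local Notation leb := (@lebesgue_measure R).

Lemma integral_reflect (f : R -> \bar R) : measurable_fun setT f -> (forall x, 0 <= f x) ->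
  \int[leb]_x f (- x)%R = \int[leb]_x f x.
Proof.
move=> mf f0; transitivity (\int[pushforward leb (-%R : _ -> measurableTypeR R)]_x f x).
  by rewrite ge0_integral_pushforward.
by apply: eq_measure_integral => A mA _; exact/lebesgue_measureN.
Qed.

(** The side constant 8 of [cint_le_integral] divided by 8/9 is 9; the [y] may be infinite, whence
    the extended reals. *)
Lemma lee_sum_sides (e x1 x2 x3 x4 : R) (y1 y2 y3 y4 : \bar R) :
  0 <= y1 -> 0 <= y2 -> 0 <= y3 -> 0 <= y4 ->
  x1%:E <= 8%:E * y1 -> x2%:E <= 8%:E * y2 -> x3%:E <= 8%:E * y3 -> x4%:E <= 8%:E * y4 ->
  (8 / 9 * e <= x1 + x2 + (x3 + x4))%R -> e%:E <= 9%:E * (y1 + y2 + (y3 + y4)).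
Proof.
move=> p1 p2 p3 p4 b1 b2 b3 b4 H.
have n8 : 0 <= 8%:E :> \bar R by rewrite lee_fin.
have L : 8%:E * (9^-1%:E * e%:E) <= 8%:E * (y1 + y2 + (y3 + y4)).
  rewrite (ge0_muleDr _ (adde_ge0 p1 p2) (adde_ge0 p3 p4)) (ge0_muleDr _ p1 p2) (ge0_muleDr _ p3 p4).
  apply: le_trans (leeD (leeD b1 b2) (leeD b3 b4)).
  by rewrite -!EFinM -!EFinD lee_fin; lra.
rewrite lee_pmul2l ?lte_fin // in L.
have n9 : 0 <= 9%:E :> \bar R by rewrite lee_fin.
apply: le_trans (lee_wpmul2l n9 L).
by rewrite -!EFinM lee_fin; lra.
Qed.

(** Real and imaginary parts each cost 4, giving 8. The function [g] will be a slice of an integrand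
    on the plane, so it may be infinite and is integrated over the whole line. *)
Lemma cint_le_integral (f : R -> R[i]) (g : R -> \bar R) (a b : R) : (a <= b)%R ->
  (forall t, (a <= t <= b)%R -> rcont f t) -> measurable_fun setT g -> (forall t, 0 <= g t) ->
  (forall t, (a <= t <= b)%R -> (normc (f t))%:E <= 4%:E * g t) ->
  (normc (cint f a b))%:E <= 8%:E * \int[leb]_t g t.
Proof.
move=> ab fc mg g0 fg.
have P (h : R -> R) : (forall t, (a <= t <= b)%R -> {for t, continuous h}) ->
    (forall t, (`|h t| <= normc (f t))%R) ->
    (`|rint h a b|%R)%:E <= 4%:E * \int[leb]_t g t.
  move=> hc hf; have ih := cont_integrable hc.
  rewrite /rint ab EFin_normr_Rintegral //.
  apply: le_trans (le_abse_integral _ _ _) _ => //; first exact: measurable_int ih.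
  apply: (@le_trans _ _ (\int[leb]_(t in `[a, b]) (4%:E * g t))).
    apply: ge0_le_integral => //.
    - by apply: measurableT_comp => //; exact: measurable_int ih.
    - by apply: measurable_funTS; apply: measurable_funeM.
    - move=> t; rewrite /= in_itv /= => Ht; apply: le_trans (fg t Ht).
      by rewrite /= lee_fin.
  rewrite -ge0_integralZl //.
  apply: ge0_subset_integral => //; first exact: measurable_funeM.
  by move=> t _; rewrite mule_ge0.
apply: (@le_trans _ _ ((`|rint (fun t => complex.Re (f t)) a b|%R)%:E +
   (`|rint (fun t => complex.Im (f t)) a b|%R)%:E)).
  by rewrite -EFinD lee_fin; exact: normc_le_ReIm.
have -> : 8%:E = 4%:E + 4%:E :> \bar R by rewrite -EFinD; congr (_%:E); ring.
rewrite ge0_muleDl //; apply: leeD.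
  by apply: P => t; [move=> /fc[]|exact: Re_le_normc].
by apply: P => t; [move=> /fc[]|exact: Im_le_normc].
Qed.

Let third : set (R * R) := `[(- 3^-1)%R, 3^-1%R] `*` `[(- 3^-1)%R, 3^-1%R].

Let third_disc w : third w -> (normc (w.1 +i* w.2) ^+ 2 <= 2 / 9)%R.
Proof.
have -> : (normc (w.1 +i* w.2) ^+ 2 = w.1 ^+ 2 + w.2 ^+ 2)%R by rewrite sqr_normcE.
by move=> []; rewrite /= !in_itv /= => /andP[? ?] /andP[? ?]; nra.
Qed.

Let third_sub : third `<=` @disc2 R.
Proof.
move=> w /third_disc H; have N := normc_ge0 (w.1 +i* w.2).
have {}H : (normc (w.1 +i* w.2) < 1)%R by nra.
by [].
Qed.

(* Cauchy's formula on the boundary of [-s,s]^2, averaged over 1/4 <= s <= 1/3. *)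
Lemma point_bound_square E : (forall z, unit_disc z -> exists l, is_cderiv E z l) ->
  (normc (E 0%R))%:E <= 432%:E * \int[leb \x leb]_(w in third) (normc (E (w.1 +i* w.2)))%:E.
Proof.
move=> HE; pose G := (fun w : R * R => (normc (E (w.1 +i* w.2)))%:E) \_ third.
have mthird : measurable third by apply: measurableX; exact: measurable_itv.
have mG : measurable_fun setT G.
  apply/(measurable_restrictT _ mthird)/measurable_EFinP.
  apply: measurable_funS third_sub _; first exact: measurable_disc2.
  by apply: measurable_disc_norm => z /HE[l]; exact: is_cderiv_cont.
have G0 w : 0 <= G w.
  by rewrite /G patchE; case: ifP => // _; rewrite lee_fin normc_ge0.
have GE w : third w -> G w = (normc (E (w.1 +i* w.2)))%:E.
  by move=> Tw; rewrite /G patchE mem_set.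
pose S := \int[leb \x leb]_w G w.
have -> : \int[leb \x leb]_(w in third) (normc (E (w.1 +i* w.2)))%:E = S.
  by rewrite integral_mkcond.
(* [g1] and [g2] integrate over vertical and horizontal lines; by Tonelli the integral of either is
   [S]. *)
pose g1 x := \int[leb]_y G (x, y); pose g2 y := \int[leb]_x G (x, y).
have S1 : S = \int[leb]_x g1 x by rewrite /S fubini_tonelli1.
have S2 : S = \int[leb]_x g2 x by rewrite /S fubini_tonelli2.
have mg1 : measurable_fun setT g1 by exact: measurable_fun_fubini_tonelli_F.
have mg2 : measurable_fun setT g2 by exact: measurable_fun_fubini_tonelli_G.
have g10 x : 0 <= g1 x by apply: integral_ge0.
have g20 x : 0 <= g2 x by apply: integral_ge0.
have key s : (4^-1 <= s <= 3^-1)%R ->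
    (normc (E 0%R))%:E <= 9%:E * (g2 s + g2 (- s)%R + (g1 s + g1 (- s)%R)).
  move=> /andP[s4 s3].
  have ss : (- s <= s)%R by lra.
  have T1 t : (- s <= t <= s)%R -> third (t, s) /\ third (t, - s)%R.
    by move=> /andP[? ?]; do 2 split; rewrite /= in_itv /=; apply/andP; split; lra.
  have T2 t : (- s <= t <= s)%R -> third (s, t) /\ third (- s, t)%R.
    by move=> /andP[? ?]; do 2 split; rewrite /= in_itv /=; apply/andP; split; lra.
  have [f [BC fb L]] : exists f : R[i] -> R[i], ([/\ bdry_cont f (- s) s (- s) s,
    forall z, bdry (- s) s (- s) s z -> normc (f z) <= 4 * normc (E z) &
    8 / 9 * normc (E 0) <= normc (cint (fun t => f (t +i* s)) (- s) s) +
      normc (cint (fun t => f (t +i* (- s))) (- s) s) +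
      (normc (cint (fun t => f (s +i* t)) (- s) s) +
       normc (cint (fun t => f ((- s) +i* t)) (- s) s))])%R.
    apply: square_sides_bound => // -[x y] [/= /andP[? ?] /andP[? ?]]; apply: HE.
    by apply: (@third_sub (x, y)); split; rewrite /= in_itv /=; apply/andP; split; lra.
  have Bh y : (y == - s)%R || (y == s) ->
      (normc (cint (fun t => f (t +i* y)) (- s)%R s))%:E <= 8%:E * g2 y.
    move=> Hy; apply: cint_le_integral => //.
    - by move=> t Ht; exact: (bdry_cont_h BC ss Ht).
    - exact: measurable_fun_pair1.
    - move=> t Ht; rewrite GE /=; last by have [? ?] := T1 t Ht; case/orP: Hy => /eqP ->.
      by rewrite -EFinM lee_fin; apply: fb; exact: bdry_h.
  have Bv x : (x == - s)%R || (x == s) ->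
      (normc (cint (fun t => f (x +i* t)) (- s)%R s))%:E <= 8%:E * g1 x.
    move=> Hx; apply: cint_le_integral => //.
    - by move=> t Ht; exact: (bdry_cont_v BC ss Ht).
    - exact: measurable_fun_pair2.
    - move=> t Ht; rewrite GE /=; last by have [? ?] := T2 t Ht; case/orP: Hx => /eqP ->.
      by rewrite -EFinM lee_fin; apply: fb; exact: bdry_v.
  have b1 := Bh s (ltac:(by rewrite eqxx orbT)); have b2 := Bh (- s)%R (ltac:(by rewrite eqxx)).
  have b3 := Bv s (ltac:(by rewrite eqxx orbT)); have b4 := Bv (- s)%R (ltac:(by rewrite eqxx)).
  exact: (lee_sum_sides (g20 _) (g20 _) (g10 _) (g10 _) b1 b2 b3 b4 L).
pose h s := 9%:E * (g2 s + g2 (- s)%R + (g1 s + g1 (- s)%R)).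
have mN (u : R -> \bar R) : measurable_fun setT u -> measurable_fun setT (fun s => u (- s)%R).
  by move=> mu; apply: measurableT_comp => //; exact: oppr_measurable.
have mh : measurable_fun setT h.
  by apply: measurable_funeM; apply: emeasurable_funD; apply: emeasurable_funD => //; exact: mN.
have h0 s : 0 <= h s by apply: mule_ge0; [rewrite lee_fin|apply: adde_ge0; apply: adde_ge0].
have I1 : \int[leb]_(s in `[4^-1%R, 3^-1%R]) (normc (E 0%R))%:E <= \int[leb]_s h s.
  apply: (@le_trans _ _ (\int[leb]_(s in `[4^-1%R, 3^-1%R]) h s)); last exact: ge0_subset_integral.
  apply: ge0_le_integral => //.
  - by move=> t _; rewrite lee_fin normc_ge0.
  - exact: measurable_funTS.
have DD u : measurable_fun setT u -> (forall x, 0 <= u x) ->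
    \int[leb]_x (u x + u (- x)%R) = \int[leb]_x u x + \int[leb]_x u x.
  move=> mu u0; rewrite ge0_integralD //; last exact: (mN u mu).
  by rewrite integral_reflect.
have I2 : \int[leb]_s h s = 9%:E * (S + S + (S + S)).
  rewrite ge0_integralZl //; first last.
  - by move=> s _; apply: adde_ge0; apply: adde_ge0.
  - by apply: emeasurable_funD; apply: emeasurable_funD => //; exact: mN.
  rewrite ge0_integralD //; first last.
  - by apply: emeasurable_funD => //; exact: mN.
  - by move=> s _; apply: adde_ge0.
  - by apply: emeasurable_funD => //; exact: mN.
  - by move=> s _; apply: adde_ge0.
  by rewrite (DD g2) // (DD g1) // -S1 -S2.
(* The interval has length 1/12 and the four slices total 9 * 4 S = 36 S, whence 432 = 36 * 12. *)
have I3 : \int[leb]_(s in `[4^-1%R, 3^-1%R]) (normc (E 0%R))%:E =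
    (normc (E 0%R) * (3^-1 - 4^-1))%:E.
  transitivity ((normc (E 0%R))%:E * leb `[4^-1%R, 3^-1%R]); first by rewrite integral_cst.
  by rewrite lebesgue_measure_itv /= lte_fin ifT; [rewrite -EFinB -EFinM|lra].
move: I1; rewrite I2 I3.
have S0 : 0 <= S by apply: integral_ge0.
case: S S0 {S1 S2 I2} => [r| |] //= _.
  by rewrite -!EFinD -!EFinM !lee_fin; lra.
by move=> _; rewrite gt0_muley ?leey // lte_fin.
Qed.

Let lee_scale (k : R) (X Y : \bar R) : (0 <= k)%R -> X <= 2%:E * Y -> k%:E * X <= (k * 2)%:E * Y.
Proof. move=> k0 XY; rewrite (EFinM k 2) -(muleA k%:E).
by apply: lee_wpmul2l XY; rewrite lee_fin. Qed.

Lemma point_bound (p : R) E : (0 <= p <= 1)%R ->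
  (forall z, unit_disc z -> exists l, is_cderiv E z l) ->
  (normc (E 0%R))%:E <= (432 * 2)%:E * \int[leb \x leb]_(w in @disc2 R)
     (normc (E (w.1 +i* w.2)) * (1 - normc (w.1 +i* w.2) ^+ 2) `^ p)%:E.
Proof.
move=> /andP[p0 p1] HE; apply: le_trans (point_bound_square HE) _.
have mthird : measurable third by apply: measurableX; exact: measurable_itv.
have mE : measurable_fun (@disc2 R) (fun w => normc (E (w.1 +i* w.2))).
  by apply: measurable_disc_norm => z /HE[l]; exact: is_cderiv_cont.
have mW : measurable_fun (@disc2 R)
    (fun w => (normc (E (w.1 +i* w.2)) * (1 - normc (w.1 +i* w.2) ^+ 2) `^ p)%:E).
  by apply/measurable_EFinP; apply: measurable_funM => //; exact: measurable_disc_weight.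
have W0 (w : R * R) : 0 <= (normc (E (w.1 +i* w.2)) * (1 - normc (w.1 +i* w.2) ^+ 2) `^ p)%:E.
  by rewrite lee_fin mulr_ge0 ?normc_ge0 ?powR_ge0.
suff : \int[leb \x leb]_(w in third) (normc (E (w.1 +i* w.2)))%:E <=
    2%:E * \int[leb \x leb]_(w in @disc2 R)
      (normc (E (w.1 +i* w.2)) * (1 - normc (w.1 +i* w.2) ^+ 2) `^ p)%:E.
  by apply: lee_scale; rewrite ler0n.
rewrite -ge0_integralZl //; [|exact: measurable_disc2].
have mW2 : measurable_fun (@disc2 R)
    (fun w => 2%:E * (normc (E (w.1 +i* w.2)) * (1 - normc (w.1 +i* w.2) ^+ 2) `^ p)%:E).
  exact: measurable_funeM.
apply: (@le_trans _ _ (\int[leb \x leb]_(w in third)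
    (2%:E * (normc (E (w.1 +i* w.2)) * (1 - normc (w.1 +i* w.2) ^+ 2) `^ p)%:E))).
  apply: ge0_le_integral => //.
  - by move=> w _; rewrite lee_fin normc_ge0.
  - by apply/measurable_EFinP; exact: (measurable_funS (@measurable_disc2 R) third_sub mE).
  - exact: (measurable_funS (@measurable_disc2 R) third_sub mW2).
  move=> w Tw; rewrite -EFinM lee_fin; have n2 := third_disc Tw.
  have nn : (0 <= normc (w.1 +i* w.2) ^+ 2)%R by rewrite sqr_ge0.
  (* On the small square 1 - |w|^2 lies between 7/9 and 1, and an exponent at most 1 does not
     decrease such a number; this costs the factor 2. *)
  have : (2^-1 <= (1 - normc (w.1 +i* w.2) ^+ 2) `^ p)%R.
    apply: le_trans (ger1_powR _ p1); first by lra.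
    by apply/andP; split; lra.
  by have := normc_ge0 (E (w.1 +i* w.2)); nra.
apply: ge0_subset_integral => //; first exact: measurable_disc2.
by move=> w _; rewrite mule_ge0.
Qed.

End PointEvaluation.

(** * Identities and weight estimates for disc automorphisms *)

Section Moebius.
Variable R : realType.
Implicit Types (a b z d : R[i]).

Lemma unit_discE z : unit_disc z <-> normc z < 1.
Proof. by []. Qed.

Lemma disc0 : unit_disc (0 : R[i]).
Proof. by apply/unit_discE; rewrite normc0. Qed.

Lemma mulJc a : conjc a * a = (normc a ^+ 2)%:C.
Proof. by rewrite sqr_normcE; case: a => x y; simpc; congr (_ +i* _); ring. Qed.

Lemma sqr_normc_lt1 z : unit_disc z -> 0 < 1 - normc z ^+ 2.
Proof.
move=> /unit_discE H; have := normc_ge0 z => n0.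
by rewrite subr_gt0 expr_lt1.
Qed.

Lemma denom_ge a z : 1 - normc a * normc z <= normc (1 - conjc a * z).
Proof. by rewrite -{1}(normc1 R) -(normcJ' a) -normcM; exact: normc_subl. Qed.

Lemma denom_gel a z : unit_disc a -> unit_disc z -> 1 - normc a <= normc (1 - conjc a * z).
Proof.
move=> /unit_discE Ha /unit_discE Hz; apply: le_trans (denom_ge a z).
by have := normc_ge0 a; have := normc_ge0 z; nra.
Qed.

Lemma denom_ger a z : unit_disc a -> unit_disc z -> 1 - normc z <= normc (1 - conjc a * z).
Proof.
move=> /unit_discE Ha /unit_discE Hz; apply: le_trans (denom_ge a z).
by have := normc_ge0 a; have := normc_ge0 z; nra.
Qed.

Lemma denom_gt0 a z : unit_disc a -> unit_disc z -> 0 < normc (1 - conjc a * z).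
Proof.
by move=> Ha Hz; apply: lt_le_trans (denom_gel Ha Hz); rewrite subr_gt0.
Qed.

Lemma denom_neq0 a z : unit_disc a -> unit_disc z -> 1 - conjc a * z != 0.
Proof.
by move=> Ha Hz; apply: contraTneq (denom_gt0 Ha Hz) => ->; rewrite normc0 ltxx.
Qed.

Lemma normc_denomC a b : normc (1 - conjc a * b) = normc (1 - conjc b * a).
Proof.
rewrite -[LHS]normcJ' rmorphB rmorphM rmorph1 /=.
by rewrite conjcK mulrC.
Qed.

Lemma moebius_identity a z :
  normc (1 - conjc a * z) ^+ 2 - normc (a - z) ^+ 2 = (1 - normc a ^+ 2) * (1 - normc z ^+ 2).
Proof.
rewrite !sqr_normcE; case: a z => a1 a2 [z1 z2] /=; ring.
Qed.

Lemma disc_autE a z : disc_aut a z = (a - z) / (1 - conjc a * z).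
Proof. by []. Qed.

Lemma disc_aut_dist a z : unit_disc a -> unit_disc z ->
  1 - normc (disc_aut a z) ^+ 2 =
  (1 - normc a ^+ 2) * (1 - normc z ^+ 2) / normc (1 - conjc a * z) ^+ 2.
Proof.
move=> Ha Hz; have d0 := denom_gt0 Ha Hz.
rewrite -moebius_identity /disc_aut normcf_div.
by field; rewrite gt_eqF.
Qed.

Lemma disc_aut_disc a z : unit_disc a -> unit_disc z -> unit_disc (disc_aut a z).
Proof.
move=> Ha Hz; apply/unit_discE.
have : 0 < 1 - normc (disc_aut a z) ^+ 2.
  rewrite disc_aut_dist // divr_gt0 ?exprn_gt0 ?denom_gt0 //.
  by rewrite mulr_gt0 ?sqr_normc_lt1.
by rewrite subr_gt0 expr_lt1 ?normc_ge0.
Qed.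

Lemma disc_aut0 a : disc_aut a 0 = a.
Proof. by rewrite disc_autE mulr0 !subr0 divr1. Qed.

Lemma disc_autK a z : unit_disc a -> unit_disc z -> disc_aut a (disc_aut a z) = z.
Proof.
move=> Ha Hz; have d0 := denom_neq0 Ha Hz.
have d1 := denom_neq0 Ha (disc_aut_disc Ha Hz).
have na : 1 - conjc a * a != 0 by exact: denom_neq0.
have E : 1 - conjc a * disc_aut a z = (1 - conjc a * a) / (1 - conjc a * z).
  by rewrite disc_autE; field.
by rewrite [LHS]disc_autE E disc_autE; field; rewrite d0.
Qed.

Definition disc_aut' a z : R[i] := (conjc a * a - 1) / (1 - conjc a * z) ^+ 2.

Lemma disc_aut_cderiv a z : unit_disc a -> unit_disc z ->
  is_cderiv (disc_aut a) z (disc_aut' a z).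
Proof.
move=> Ha Hz; have d0 := denom_neq0 Ha Hz.
have D1 : is_cderiv (fun w => a - w) z (0 - 1) by apply: is_cderivB; [exact: is_cderiv_cst|exact: is_cderiv_id].
have D2 : is_cderiv (fun w => 1 - conjc a * w) z (0 - conjc a * 1).
  by apply: is_cderivB; [exact: is_cderiv_cst|apply: is_cderivZ; exact: is_cderiv_id].
have D : is_cderiv (disc_aut a) z _ :=
  is_cderiv_div (f := fun w => a - w) (g := fun w => 1 - conjc a * w) d0 D1 D2.
apply: (is_cderiv_eq D); rewrite /disc_aut'; congr (_ / _); ring.
Qed.

Lemma disc_aut'_cderiv a z : unit_disc a -> unit_disc z ->
  exists l, is_cderiv (disc_aut' a) z l.
Proof.
move=> Ha Hz; have d0 := denom_neq0 Ha Hz.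
have D2 : is_cderiv (fun w => 1 - conjc a * w) z (0 - conjc a * 1).
  by apply: is_cderivB; [exact: is_cderiv_cst|apply: is_cderivZ; exact: is_cderiv_id].
eexists; exact: (is_cderiv_div (f := fun=> conjc a * a - 1)
  (g := fun w => (1 - conjc a * w) * (1 - conjc a * w)) (mulf_neq0 d0 d0)
  (is_cderiv_cst _ z) (is_cderivM D2 D2)).
Qed.

Lemma normc_disc_aut' a z : unit_disc a ->
  normc (disc_aut' a z) = (1 - normc a ^+ 2) / normc (1 - conjc a * z) ^+ 2.
Proof.
move=> Ha; rewrite /disc_aut' normcf_div normcX; congr (_ / _).
have -> : conjc a * a - 1 = (normc a ^+ 2 - 1)%:C by rewrite mulJc; simpc.
by rewrite normc_real distrC ger0_norm // ltW // sqr_normc_lt1.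
Qed.

(** This is the denominator of phi_b o phi_a, a map that vanishes at d = phi_a(b) and is therefore a
    unimodular multiple of phi_d. *)
Lemma disc_aut_denom a b z : unit_disc a -> unit_disc b -> unit_disc z ->
  (1 - conjc b * disc_aut a z) * (1 - conjc a * z) =
  (1 - conjc b * a) * (1 - (conjc (disc_aut a b)) * z).
Proof.
move=> Ha Hb Hz; have d0 := denom_neq0 Ha Hz; have d1 := denom_neq0 Hb Ha.
have -> : (conjc (disc_aut a b)) = (conjc a - conjc b) / (1 - conjc b * a).
  rewrite disc_autE rmorphM fmorphV !rmorphB rmorphM rmorph1 /=.
  rewrite conjcK.
  by rewrite [a * _]mulrC.
by rewrite disc_autE; field; rewrite ?d0 ?d1.
Qed.

Lemma normc_disc_aut_comp' a b z : unit_disc a -> unit_disc b -> unit_disc z ->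
  normc (disc_aut' b (disc_aut a z)) * normc (disc_aut' a z) =
  (1 - normc (disc_aut a b) ^+ 2) / normc (1 - (conjc (disc_aut a b)) * z) ^+ 2.
Proof.
move=> Ha Hb Hz; rewrite !normc_disc_aut' // disc_aut_dist //.
have E := congr1 (@normc R) (disc_aut_denom Ha Hb Hz); rewrite !normcM in E.
have n1 := denom_gt0 Hb (disc_aut_disc Ha Hz); have n2 := denom_gt0 Ha Hz.
have n3 := denom_gt0 Hb Ha; have n4 := denom_gt0 (disc_aut_disc Ha Hb) Hz.
rewrite (normc_denomC a b).
have -> : (1 - normc b ^+ 2) / normc (1 - conjc b * disc_aut a z) ^+ 2 *
    ((1 - normc a ^+ 2) / normc (1 - conjc a * z) ^+ 2) =
    (1 - normc a ^+ 2) * (1 - normc b ^+ 2) /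
    (normc (1 - conjc b * disc_aut a z) * normc (1 - conjc a * z)) ^+ 2.
  by field; rewrite !gt_eqF.
by rewrite E; field; rewrite !gt_eqF.
Qed.

Lemma denom_ge_dist d z : unit_disc d -> unit_disc z -> normc (z - d) <= normc (1 - conjc d * z).
Proof.
move=> Hd Hz; rewrite normc_distC -(ler_pXn2r (_ : 0 < 2)%N) ?nnegrE ?normc_ge0 //.
by rewrite -subr_ge0 moebius_identity mulr_ge0 // ltW // sqr_normc_lt1.
Qed.

(** Put A = 1-|a|^2, B = 1-|b|^2, n = |1 - conj(a) b|. Both A and B are at most 2n, so
    1-|phi_a(b)|^2 = 4uv with u = A/(2n) and v = B/(2n) at most 1. Then (uv)^p <= (uv)^q, and A u v
    = u^2 B <= B. *)
Lemma moebius_weight_bound (p q : R) a b : 0 <= q <= p -> unit_disc a -> unit_disc b ->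
  (1 - normc a ^+ 2) `^ q * (1 - normc (disc_aut a b) ^+ 2) `^ p <=
  4 `^ p * (1 - normc b ^+ 2) `^ q.
Proof.
move=> /andP[q0 qp] Ha Hb; have A0 := sqr_normc_lt1 Ha; have B0 := sqr_normc_lt1 Hb.
have n3 := denom_gt0 Ha Hb; have la := denom_gel Ha Hb; have lb := denom_ger Ha Hb.
rewrite disc_aut_dist //; move: A0 B0 n3 la lb.
have := normc_ge0 a; have := normc_ge0 b; move: Ha Hb => /unit_discE + /unit_discE.
set x := normc a; set y := normc b; set n := normc _ => x1 y1 y0 x0 A0 B0 n0 la lb.
have A2 : 1 - x ^+ 2 <= 2 * n by nra.
have B2 : 1 - y ^+ 2 <= 2 * n by nra.
set A := 1 - x ^+ 2 in A0 A2 *; set B := 1 - y ^+ 2 in B0 B2 *.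
have A1 : A <= 1 by rewrite /A; have := sqr_ge0 x; lra.
pose u := A / (2 * n); pose v := B / (2 * n).
have n20 : 0 < 2 * n by lra.
have u0 : 0 < u by rewrite divr_gt0.
have v0 : 0 < v by rewrite divr_gt0.
have u1 : u <= 1 by rewrite ler_pdivrMr // mul1r.
have v1 : v <= 1 by rewrite ler_pdivrMr // mul1r.
have -> : A * B / n ^+ 2 = 4 * (u * v) by rewrite /u /v; field; rewrite gt_eqF.
have p0 : 0 <= p := le_trans q0 qp.
rewrite (powRM p (ler0n _ 4)); last by rewrite mulr_ge0 ?ltW.
rewrite mulrCA ler_wpM2l ?powR_ge0 //.
have uv0 : 0 < u * v by rewrite mulr_gt0.
have uv1 : u * v <= 1 by nra.
apply: (@le_trans _ _ (A `^ q * (u * v) `^ q)).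
  rewrite ler_wpM2l ?powR_ge0 //; apply: ger_powR => //.
  by rewrite uv0.
rewrite -powRM ?(ltW A0) ?(ltW uv0) //; apply: ge0_ler_powR => //; rewrite ?nnegrE;
  [by rewrite mulr_ge0 // ltW|exact: ltW|].
have -> : A * (u * v) = (A * A / (2 * n) ^+ 2) * B by rewrite /u /v; field; rewrite gt_eqF.
rewrite ger_pMl // ler_pdivrMr ?exprn_gt0 // mul1r expr2.
by apply: ler_pM => //; exact: ltW.
Qed.

End Moebius.

(** * The Forelli-Rudin type kernel estimate *)

Section ForelliRudin.
Variable R : realType.
Implicit Types (D c p x y : R) (z d : R[i]).

Local Notation leb := (@lebesgue_measure R).

Lemma is_derive_affine (k s x : R) : is_derive x 1 (fun y : R => k + s * y) s.
Proof.
apply: is_derive_eps => e e0; exists 1 => // h _.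
have -> : k + s * (x + h) - (k + s * x) - s * h = 0 by ring.
by rewrite normr0 mulr_ge0 // ltW.
Qed.

Lemma is_derive_invpow (k s k0 : R) m x : k + s * x != 0 ->
  is_derive x 1 (fun y : R => k0 * (k + s * y)^-1 ^+ m.+1)
    (- (k0 * m.+1%:R * s) * (k + s * x)^-1 ^+ m.+2).
Proof.
move=> n0.
have D1 := is_deriveV (f := fun y => k + s * y) n0 (is_derive_affine k s x).
have D2 := is_deriveX m.+1 D1.
rewrite exprfctE in D2; have D3 := is_deriveZ k0 D2.
suff <- : k0 *: ((m.+1%:R * (k + s * x)^-1 ^+ m.+1.-1) *: (- (k + s * x) ^- 2 *: s)) =
  - (k0 * m.+1%:R * s) * (k + s * x)^-1 ^+ m.+2 by exact: D3.
by rewrite /GRing.scale /= [in RHS]exprS [in RHS]exprS; field.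
Qed.

Lemma cont_inv_dist D c t : 0 < D -> {for t, continuous (fun y => (D + `|y - c|)^-1)}.
Proof.
move=> D0; apply: continuousV.
  by rewrite gt_eqF // ltr_wpDr.
apply: continuousD; first exact: cst_continuous.
apply: (@continuous_comp _ _ _ (fun y : R => y - c) (fun y => `|y|)); last exact: norm_continuous.
by apply: continuousB; [exact: cvg_id|exact: cst_continuous].
Qed.

Lemma cont_inv_dist_pow D c n t : 0 < D -> {for t, continuous (fun y => (D + `|y - c|)^-1 ^+ n)}.
Proof.
move=> D0; apply: (@continuous_comp _ _ _ (fun y => (D + `|y - c|)^-1) (fun y => y ^+ n)).
  exact: cont_inv_dist.
exact: exprn_continuous.
Qed.

(** Splitting at [c], each half has an explicit primitive and contributes at most D^-(m+1) / (m+1)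
    once the nonnegative far-end term is dropped. *)
Lemma integral_inv_dist D c m : 0 < D -> -1 <= c <= 1 ->
  (\int[leb]_(y in `[(-1)%R, 1%R]) ((D + `|y - c|)^-1 ^+ m.+2)%:E <=
   (2 / m.+1%:R * D^-1 ^+ m.+1)%:E)%E.
Proof.
move=> D0 /andP[c1 c2]; have ab : -1 <= 1 :> R by lra.
set f := fun y => (D + `|y - c|)^-1 ^+ m.+2.
have fc t : {for t, continuous f} by exact: cont_inv_dist_pow.
have If : leb.-integrable `[-1, 1] (EFin \o f) by exact: cont_integrable.
have -> : (\int[leb]_(y in `[(-1)%R, 1%R]) ((D + `|y - c|)^-1 ^+ m.+2)%:E = (rint f (-1) 1)%:E)%E.
  by rewrite /rint ab /Rintegral fineK //; exact: integrable_fin_num.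
rewrite lee_fin -(rint_chasles (A := -1) (B := 1) (b := c)) ?lexx ?ab ?c1 ?c2 //.
have m0 : m.+1%:R != 0 :> R by rewrite pnatr_eq0.
have P (v : R) : 0 < v -> 0 <= v^-1 ^+ m.+1 by move=> v0; rewrite exprn_ge0 // invr_ge0 ltW.
have R1 : rint f c 1 = m.+1%:R^-1 * (D^-1 ^+ m.+1 - (D + 1 - c)^-1 ^+ m.+1).
  rewrite (eq_rint (g := fun y => (D - c + 1 * y)^-1 ^+ m.+2)); last first.
    move=> t; rewrite segE // => /andP[ct _]; rewrite /f ger0_norm ?subr_ge0 //.
    by congr (_^-1 ^+ _); ring.
  have N t : seg c 1 t -> D - c + 1 * t != 0.
    by rewrite segE // => /andP[ct _]; rewrite gt_eqF //; lra.
  have HF t : seg c 1 t -> is_derive t 1 (fun y => (- m.+1%:R^-1) * (D - c + 1 * y)^-1 ^+ m.+1)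
      ((D - c + 1 * t)^-1 ^+ m.+2).
    move=> /N H; have DD := is_derive_invpow (- m.+1%:R^-1) m H.
    have E1 : - (- m.+1%:R^-1 * m.+1%:R * 1) = 1 :> R by field.
    by rewrite E1 [X in is_derive _ _ _ X]mul1r in DD.
  rewrite (rint_FTC HF).
  - have -> : D - c + 1 * 1 = D + 1 - c by ring.
    have -> : D - c + 1 * c = D by ring.
    by ring.
  - move=> t /N H; apply: (@continuous_comp _ _ _ (fun y => (D - c + 1 * y)^-1) (fun y => y ^+ m.+2)).
      apply: continuousV => //; have [DD _] := is_derive_affine (D - c) 1 t.
      exact/differentiable_continuous/derivable1_diffP.
    exact: exprn_continuous.
have R2 : rint f (-1) c = m.+1%:R^-1 * (D^-1 ^+ m.+1 - (D + c + 1)^-1 ^+ m.+1).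
  rewrite (eq_rint (g := fun y => (D + c + (-1) * y)^-1 ^+ m.+2)); last first.
    move=> t; rewrite segE // => /andP[_ ct]; rewrite /f ler0_norm ?subr_le0 //.
    by congr (_^-1 ^+ _); ring.
  have N t : seg (-1) c t -> D + c + (-1) * t != 0.
    by rewrite segE // => /andP[_ ct]; rewrite gt_eqF //; lra.
  have HF t : seg (-1) c t -> is_derive t 1 (fun y => (m.+1%:R^-1) * (D + c + (-1) * y)^-1 ^+ m.+1)
      ((D + c + (-1) * t)^-1 ^+ m.+2).
    move=> /N H; have DD := is_derive_invpow (m.+1%:R^-1) m H.
    have E1 : - (m.+1%:R^-1 * m.+1%:R * -1) = 1 :> R by field.
    by rewrite E1 [X in is_derive _ _ _ X]mul1r in DD.
  rewrite (rint_FTC HF).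
  - have -> : D + c + -1 * -1 = D + c + 1 by ring.
    have -> : D + c + -1 * c = D by ring.
    by ring.
  - move=> t /N H; apply: (@continuous_comp _ _ _ (fun y => (D + c + (-1) * y)^-1) (fun y => y ^+ m.+2)).
      apply: continuousV => //; have [DD _] := is_derive_affine (D + c) (-1) t.
      exact/differentiable_continuous/derivable1_diffP.
    exact: exprn_continuous.
rewrite R1 R2; have := P (D + 1 - c); have := P (D + c + 1).
move=> /(_ (ltac:(lra))) Q1 /(_ (ltac:(lra))) Q2.
have M0 : 0 < m.+1%:R^-1 :> R by rewrite invr_gt0 ltr0n.
set M := m.+1%:R^-1 in M0 *.
rewrite -mulrDr -mulrA mulrCA ler_pM2l //; lra.
Qed.

(** Since u/v >= 1 and p <= 1, (u/v)^p <= u/v. *)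
Lemma powR_trade (p u v : R) : 0 < p <= 1 -> 0 < v <= u -> u `^ p * v <= u * v `^ p.
Proof.
move=> /andP[p0 p1] /andP[v0 vu]; have u0 : 0 < u by exact: lt_le_trans vu.
have uv : 1 <= u / v by rewrite ler_pdivlMr // mul1r.
have -> : u `^ p = (u / v) `^ p * v `^ p by rewrite -powRM ?divr_ge0 ?ltW // divfK // gt_eqF.
have : (u / v) `^ p <= u / v.
  by apply: le_trans (ler_powR uv p1) _; rewrite powRr1 // divr_ge0 // ltW.
have := powR_ge0 v p => V0 H.
have -> : u * v `^ p = (u / v) * (v `^ p * v) by field; rewrite gt_eqF.
by rewrite -mulrA ler_wpM2r // mulr_ge0 // ltW.
Qed.

(* With w = |1 - conj(d) z| one has w >= |z - d|, 2w >= 1 - |d|^2 and 2w >= 1 - |z|^2;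
   trading a power of w for one of 1 - |d|^2 leaves a kernel of order -3, whose iterated
   integrals are elementary. *)
Lemma kernel_pointwise p d z : 0 < p <= 1 -> unit_disc d -> unit_disc z ->
  let del := 1 - normc d ^+ 2 in
  (del / normc (1 - conjc d * z) ^+ 2) ^+ 2 * (1 - normc z ^+ 2) `^ p <=
  128 * (del * del `^ p) *
    (del + `|complex.Re z - complex.Re d| + `|complex.Im z - complex.Im d|)^-1 ^+ 3.
Proof.
move=> hp Hd Hz; set del := 1 - _ ^+ 2; rewrite /=.
have d0 : 0 < del by exact: sqr_normc_lt1.
have t0 := sqr_normc_lt1 Hz.
have w0 := denom_gt0 Hd Hz; have wl := denom_gel Hd Hz; have wr := denom_ger Hd Hz.
have wd := denom_ge_dist Hd Hz.
have n1 : normc d < 1 by []. 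
have n2 : normc z < 1 by [].
have nd0 := normc_ge0 d; have nz0 := normc_ge0 z.
have rx := Re_le_normc (z - d); have ry := Im_le_normc (z - d); rewrite !raddfB in rx ry.
set w := normc (1 - _) in w0 wl wr wd *.
set X := `|complex.Re z - complex.Re d| in rx *; set Y := `|complex.Im z - complex.Im d| in ry *.
have X0 : 0 <= X by exact: normr_ge0.
have Y0 : 0 <= Y by exact: normr_ge0.
have dw : del <= 2 * w by rewrite /del; nra.
have tw : 1 - normc z ^+ 2 <= 2 * w by nra.
have Q0 : 0 < del + X + Y by lra.
(* Here del <= 2w, while X and Y are at most |z-d| <= w. The cube 64 and the factor 2 from [tp] make
   128. *)
have Qw : del + X + Y <= 4 * w by lra.
have tp : (1 - normc z ^+ 2) `^ p * del <= 2 * w * del `^ p.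
  apply: (@le_trans _ _ ((2 * w) `^ p * del)).
    rewrite ler_wpM2r ?(ltW d0) //; apply: ge0_ler_powR => //; rewrite ?nnegrE ?(ltW t0) //.
      by case/andP: hp => /ltW.
    by rewrite mulr_ge0 // ltW.
  by apply: powR_trade => //; rewrite d0.
have D0 := powR_ge0 del p; have T0 := powR_ge0 (1 - normc z ^+ 2) p.
move: tp D0 T0; set P := del `^ p; set T := _ `^ p => tp P0 T0.
have W4 : (del / w ^+ 2) ^+ 2 * T = (del * (T * del)) * w^-1 ^+ 4 by field; rewrite gt_eqF.
rewrite W4; apply: (@le_trans _ _ (del * (2 * w * P) * w^-1 ^+ 4)).
  by rewrite ler_wpM2r ?exprn_ge0 ?invr_ge0 ?(ltW w0) // ler_wpM2l // ltW.
have -> : del * (2 * w * P) * w^-1 ^+ 4 = 2 * (del * P) * w^-1 ^+ 3 by field; rewrite gt_eqF.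
have W3 : w^-1 ^+ 3 <= 64 * (del + X + Y)^-1 ^+ 3.
  have -> : 64 * (del + X + Y)^-1 ^+ 3 = (4 * (del + X + Y)^-1) ^+ 3 by rewrite exprMn; congr (_ * _); ring.
  rewrite ler_pXn2r ?nnegrE ?invr_ge0 ?mulr_ge0 ?invr_ge0 ?(ltW w0) ?(ltW Q0) //.
  by rewrite ler_pdivlMr // ler_pdivrMl // mulrC.
have -> : 128 * (del * P) * (del + X + Y)^-1 ^+ 3 = 2 * (del * P) * (64 * (del + X + Y)^-1 ^+ 3) by ring.
by rewrite ler_wpM2l // !mulr_ge0 // ltW.
Qed.

Local Open Scope ereal_scope.

Let box : set (R * R) := `[(-1)%R, 1%R] `*` `[(-1)%R, 1%R].

Let disc2_box : @disc2 R `<=` box.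
Proof.
move=> w Hw; have := Re_le_normc (w.1 +i* w.2); have := Im_le_normc (w.1 +i* w.2).
have : (normc (w.1 +i* w.2) < 1)%R by [].
have -> : complex.Re (w.1 +i* w.2) = w.1 by []. have -> : complex.Im (w.1 +i* w.2) = w.2 by [].
move=> n1; rewrite !ler_norml => /andP[? ?] /andP[? ?].
by split; rewrite /= in_itv /=; apply/andP; split; lra.
Qed.

(** Tonelli and two uses of [integral_inv_dist]: integrating in y lowers the order from -3 to -2
    with factor 2/2, integrating in x lowers it to -1 with factor 2. *)
Lemma integral_box_kernel (del c1 c2 k : R) : (0 < del)%R -> (0 <= k)%R ->
  (-1 <= c1 <= 1)%R -> (-1 <= c2 <= 1)%R ->
  measurable_fun setT (fun w : R * R => (k * (del + `|w.1 - c1| + `|w.2 - c2|)^-1 ^+ 3)%R) /\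
  \int[leb \x leb]_(w in box) (k * (del + `|w.1 - c1| + `|w.2 - c2|)^-1 ^+ 3)%:E <=
    (k * (2 * del^-1))%:E.
Proof.
move=> d0 k0 hc1 hc2.
have mf : measurable_fun setT (fun w : R * R => (k * (del + `|w.1 - c1| + `|w.2 - c2|)^-1 ^+ 3)%R).
  apply: measurable_funM; first exact: measurable_cst.
  apply: measurable_funX.
  have mq : measurable_fun setT (fun w : R * R => (del + `|w.1 - c1| + `|w.2 - c2|)%R).
    apply: measurable_funD; first apply: measurable_funD; first exact: measurable_cst.
      by apply: measurableT_comp => //; apply: measurable_funB; [exact: measurable_fst|exact: measurable_cst].
    by apply: measurableT_comp => //; apply: measurable_funB; [exact: measurable_snd|exact: measurable_cst].
  have -> : (fun w : R * R => (del + `|w.1 - c1| + `|w.2 - c2|)^-1)%R =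
      (fun w : R * R => (del + `|w.1 - c1| + `|w.2 - c2|) `^ (-1))%R.
    by apply/funext => w; rewrite powR_inv1 // !addr_ge0 // ltW.
  apply: (measurableT_comp (f := fun x : R => x `^ (-1))%R) => //; exact: measurable_powR.
split=> //.
have mbox : measurable box by apply: measurableX; exact: measurable_itv.
pose K (w : R * R) := (k * (del + `|w.1 - c1| + `|w.2 - c2|)^-1 ^+ 3)%R.
have K0 w : (0 <= K w)%R by rewrite mulr_ge0 // exprn_ge0 // invr_ge0 !addr_ge0 // ltW.
pose G := (fun w => (K w)%:E) \_ box.
have mG : measurable_fun setT G by apply/(measurable_restrictT _ mbox)/measurable_funTS/measurable_EFinP.
have G0 w : 0 <= G w by rewrite /G patchE; case: ifP => // _; rewrite lee_fin.
have -> : \int[leb \x leb]_(w in box) (k * (del + `|w.1 - c1| + `|w.2 - c2|)^-1 ^+ 3)%:E =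
    \int[leb \x leb]_w G w by rewrite integral_mkcond.
rewrite fubini_tonelli1 //.
pose g x := (k * (del + `|x - c1|)^-1 ^+ 2)%R.
have g0 x : (0 <= g x)%R by rewrite mulr_ge0 // exprn_ge0 // invr_ge0 addr_ge0 // ltW.
have mg : measurable_fun setT g.
  apply: measurable_funM; first exact: measurable_cst.
  by apply: continuous_measurable_fun => t; exact: cont_inv_dist_pow.
have mgE : measurable_fun setT ((fun x => (g x)%:E) \_ `[(-1)%R, 1%R]).
  have mI : measurable `[(-1)%R, 1%R : R] by exact: measurable_itv.
  by apply/(measurable_restrictT _ mI)/measurable_funTS/measurable_EFinP.
have inner x : fubini_F leb G x <= ((fun x => (g x)%:E) \_ `[(-1)%R, 1%R]) x.
  rewrite /fubini_F patchE; case: ifPn => Hx; last first.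
    rewrite integral0_eq // => y _; rewrite /G patchE ifN //.
    by apply: contra Hx; rewrite !inE => -[].
  have -> : \int[leb]_y G (x, y) = \int[leb]_(y in `[(-1)%R, 1%R])
      (k%:E * (((del + `|x - c1|) + `|y - c2|)^-1 ^+ 3)%:E).
    rewrite [RHS]integral_mkcond; apply: eq_integral => y _.
    rewrite /G !patchE; congr (if _ then _ else _).
    rewrite inE in Hx; apply/idP/idP; rewrite !inE; first by case.
    by move=> Hy; split.
  have D0 : (0 < del + `|x - c1|)%R by rewrite ltr_wpDr.
  rewrite ge0_integralZl //.
  - apply: le_trans (lee_wpmul2l _ (integral_inv_dist 1 D0 hc2)) _; first by rewrite lee_fin.
    by rewrite -EFinM lee_fin /g divff ?mul1r.
  - apply/measurable_EFinP/measurable_funTS; apply: continuous_measurable_fun => t.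
    exact: cont_inv_dist_pow.
  - by move=> y _; rewrite lee_fin exprn_ge0 // invr_ge0 addr_ge0 // ltW.
apply: (@le_trans _ _ (\int[leb]_x ((fun x => (g x)%:E) \_ `[(-1)%R, 1%R]) x)).
  apply: ge0_le_integral => //.
  - by move=> x _; apply: integral_ge0.
  - exact: measurable_fun_fubini_tonelli_F.
  - by move=> x _; exact: inner.
rewrite -integral_mkcond; under eq_integral do rewrite EFinM.
rewrite ge0_integralZl //.
- apply: le_trans (lee_wpmul2l _ (integral_inv_dist 0 d0 hc1)) _; first by rewrite lee_fin.
  by rewrite -EFinM lee_fin divr1 expr1.
- apply/measurable_EFinP/measurable_funTS; apply: continuous_measurable_fun => t.
  exact: cont_inv_dist_pow.
- by move=> y _; rewrite lee_fin exprn_ge0 // invr_ge0 addr_ge0 // ltW.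
Qed.

(** The integrand is |phi_d'|^2 times the weight. Enlarging the disc to the box leaves 128 del^(1+p)
    * 2 del^-1, which accounts for 256 and the exponent p. *)
Theorem forelli_rudin p d : (0 < p <= 1)%R -> unit_disc d ->
  \int[leb \x leb]_(w in @disc2 R)
     (((1 - normc d ^+ 2) / normc (1 - conjc d * (w.1 +i* w.2)) ^+ 2) ^+ 2 *
       (1 - normc (w.1 +i* w.2) ^+ 2) `^ p)%:E <= (256 * (1 - normc d ^+ 2) `^ p)%:E.
Proof.
move=> hp Hd; have d0 := sqr_normc_lt1 Hd.
set del := (1 - normc d ^+ 2)%R in d0 *.
have [hc1 hc2] : (-1 <= complex.Re d <= 1)%R /\ (-1 <= complex.Im d <= 1)%R.
  have n1 : (normc d < 1)%R by [].
  have := Re_le_normc d; have := Im_le_normc d; rewrite !ler_norml => /andP[? ?] /andP[? ?].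
  by split; apply/andP; split; lra.
have k0 : (0 <= 128 * (del * del `^ p))%R by rewrite !mulr_ge0 ?powR_ge0 // ltW.
have [mK IK] := integral_box_kernel d0 k0 hc1 hc2.
have mbox : measurable box by apply: measurableX; exact: measurable_itv.
have -> : (256 * del `^ p = 128 * (del * del `^ p) * (2 * del^-1))%R by field; rewrite gt_eqF.
apply: le_trans IK; set K := fun w : R * R => (_ * (_ + _ + _)^-1 ^+ 3)%R in mK *.
have K0 w : (0 <= K w)%R.
  apply: mulr_ge0; first exact: k0.
  apply: exprn_ge0; rewrite invr_ge0; apply: addr_ge0 => //; apply: addr_ge0 => //.
  exact: ltW d0.
have mD := @measurable_disc2 R.
apply: (@le_trans _ _ (\int[leb \x leb]_(w in @disc2 R) (K w)%:E)); last first.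
  apply: ge0_subset_integral => //; last by move=> w _; rewrite lee_fin.
  exact/measurable_EFinP/measurable_funTS.
apply: ge0_le_integral => //.
- by move=> w _; rewrite lee_fin mulr_ge0 ?powR_ge0 // sqr_ge0.
- apply/measurable_EFinP; apply: measurable_funM; last exact: measurable_disc_weight.
  apply: (eq_measurable_fun (fun w : R * R =>
     normc (disc_aut' d (w.1 +i* w.2)) ^+ 2)%R).
    by move=> w _; rewrite normc_disc_aut'.
  apply: measurable_funX; apply: measurable_disc_norm => z Hz.
  by have [l Hl] := disc_aut'_cderiv Hd Hz; exact: is_cderiv_cont Hl.
- exact/measurable_EFinP/measurable_funTS.
- by move=> w Hw; rewrite lee_fin; exact: kernel_pointwise.
Qed.

End ForelliRudin.

(** * Morrey terms as energies, and boundedness for bounded symbols *)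

Section DirichletMorrey.
Variable R : realType.
Implicit Types (p lambda M : R) (f g h : R[i] -> R[i]) (a b z : R[i]).

(** The argument is the derivative itself, so pullbacks are compared through explicit formulas for
    their derivatives. *)
Definition energy p h : \bar R :=
  disc_integral (fun z => (normc (h z) ^+ 2 * (1 - normc z ^+ 2) `^ p)%:E).

Local Notation leb := (@lebesgue_measure R).

Lemma measurable_energy p h : (forall z, unit_disc z -> ccont h z) ->
  measurable_fun (@disc2 R) (fun w => (normc (h (w.1 +i* w.2)) ^+ 2 *
    (1 - normc (w.1 +i* w.2) ^+ 2) `^ p)%:E).
Proof.
move=> Hh; apply/measurable_EFinP; apply: measurable_funM; last exact: measurable_disc_weight.
by apply: measurable_funX; exact: measurable_disc_norm.
Qed.

Lemma pi_inv_ge0 : (0 <= (pi^-1 : R)%:E)%E.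
Proof. by rewrite lee_fin invr_ge0 pi_ge0. Qed.

Lemma energy_ge0 p h : (0 <= energy p h)%E.
Proof.
apply: mule_ge0; first exact: pi_inv_ge0.
by apply: integral_ge0 => w _; rewrite lee_fin mulr_ge0 ?powR_ge0 // sqr_ge0.
Qed.

Lemma eq_disc_integral (F G : R[i] -> \bar R) : (forall z, unit_disc z -> F z = G z) ->
  disc_integral F = disc_integral G.
Proof.
by move=> FG; congr (_ * _)%E; apply: eq_integral => w; rewrite inE => Hw; exact: FG.
Qed.

Lemma energy_le p h1 h2 M : (forall z, unit_disc z -> ccont h1 z) ->
  (forall z, unit_disc z -> ccont h2 z) -> 0 <= M ->
  (forall z, unit_disc z -> normc (h1 z) <= M * normc (h2 z)) ->
  (energy p h1 <= (M ^+ 2)%:E * energy p h2)%E.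
Proof.
move=> c1 c2 M0 H; rewrite /energy /disc_integral muleCA; apply: lee_wpmul2l; first exact: pi_inv_ge0.
have mD := @measurable_disc2 R.
have P0 h (w : R * R) : (0 <= (normc (h (w.1 +i* w.2)) ^+ 2 *
    (1 - normc (w.1 +i* w.2) ^+ 2) `^ p)%:E)%E.
  by rewrite lee_fin mulr_ge0 ?powR_ge0 // sqr_ge0.
rewrite -ge0_integralZl //; last 2 first.
- exact: measurable_energy.
- by rewrite lee_fin sqr_ge0.
apply: ge0_le_integral => //.
- exact: measurable_energy.
- by apply: measurable_funeM; exact: measurable_energy.
move=> w Hw; rewrite -EFinM lee_fin mulrA -exprMn ler_wpM2r ?powR_ge0 //.
by rewrite ler_pXn2r ?nnegrE ?mulr_ge0 ?normc_ge0 //; exact: H.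
Qed.

Lemma sqrte_sqr_mul M (x : \bar R) : 0 <= M ->
  (sqrte ((M ^+ 2)%:E * x) = M%:E * sqrte x)%E.
Proof.
move=> M0; rewrite sqrteM ?lee_fin ?sqr_ge0 //; congr (_ * _)%E.
by rewrite /= sqrtr_sqr ger0_norm.
Qed.

Definition pullback_deriv (f' : R[i] -> R[i]) a z : R[i] := f' (disc_aut a z) * disc_aut' a z.

Lemma pullback_cderiv f (f' : R[i] -> R[i]) a z :
  (forall w, unit_disc w -> is_cderiv f w (f' w)) -> unit_disc a -> unit_disc z ->
  is_cderiv (fun w => f (disc_aut a w)) z (pullback_deriv f' a z).
Proof.
move=> Hf Ha Hz; apply: is_cderiv_comp (disc_aut_cderiv Ha Hz) _.
exact/Hf/disc_aut_disc.
Qed.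

Lemma pullback_deriv_cont (f' : R[i] -> R[i]) a z :
  (forall w, unit_disc w -> exists l, is_cderiv f' w l) -> unit_disc a -> unit_disc z ->
  ccont (pullback_deriv f' a) z.
Proof.
move=> Hf Ha Hz; have [l Hl] := Hf _ (disc_aut_disc Ha Hz); have [m Hm] := disc_aut'_cderiv Ha Hz.
exact: is_cderiv_cont (is_cderivM (is_cderiv_comp (disc_aut_cderiv Ha Hz) Hl) Hm).
Qed.

Lemma dirichlet_norm_pullback p f (f' : R[i] -> R[i]) a :
  (forall w, unit_disc w -> is_cderiv f w (f' w)) -> unit_disc a ->
  dirichlet_norm p (fun z => f (disc_aut a z) - f a) = sqrte (energy p (pullback_deriv f' a)).
Proof.
move=> Hf Ha; rewrite /dirichlet_norm disc_aut0 subrr normc0 expr0n /= add0e.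
congr sqrte; apply: eq_disc_integral => z Hz.
suff -> : cderive (fun z => f (disc_aut a z) - f a) z = pullback_deriv f' a z by [].
apply: cderiveE; rewrite -[pullback_deriv _ _ _]subr0.
by apply: is_cderivB; [exact: pullback_cderiv|exact: is_cderiv_cst].
Qed.

Definition morrey_term p lambda f a : \bar R :=
  (((1 - normc a ^+ 2) `^ (p / 2 * (1 - lambda)))%:E *
    dirichlet_norm p (fun z => f (disc_aut a z) - f a)%R)%E.

Lemma morrey_term_ge0 p lambda f a : (0 <= morrey_term p lambda f a)%E.
Proof. by apply: mule_ge0; rewrite ?lee_fin ?powR_ge0 // sqrte_ge0. Qed.

Lemma morrey_term_le p lambda f a : unit_disc a ->
  (morrey_term p lambda f a <= dirichlet_morrey_norm p lambda f)%E.
Proof.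
move=> Ha; apply: (@le_trans _ _ (ereal_sup [set morrey_term p lambda f a | a in @unit_disc R])).
  by apply: ereal_sup_ubound; exists a.
by apply: leeDr; rewrite lee_fin normc_ge0.
Qed.

Lemma morrey_norm_ge0 p lambda f : (0 <= dirichlet_morrey_norm p lambda f)%E.
Proof. exact: le_trans (morrey_term_ge0 _ _ _ 0) (morrey_term_le _ _ _ (disc0 R)). Qed.

Lemma morrey_norm_le p lambda f (K : \bar R) : f 0 = 0 ->
  (forall a, unit_disc a -> (morrey_term p lambda f a <= K)%E) ->
  (dirichlet_morrey_norm p lambda f <= K)%E.
Proof.
move=> f0 H; rewrite /dirichlet_morrey_norm f0 normc0 add0e.
by apply: ge_ereal_sup => _ [a Ha <-]; exact: H.
Qed.

Lemma cderive_mul_cderiv f g z : holomorphic_on_disc f -> holomorphic_on_disc g -> unit_disc z ->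
  exists l, is_cderiv (fun w => cderive f w * g w) z l.
Proof.
move=> Hf Hg Hz; have [l Hl] := derivative_cderiv Hf Hz.
by eexists; exact: is_cderivM Hl (holo_cderiv Hg Hz).
Qed.

Lemma disc_near z : unit_disc z -> exists2 r : R, 0 < r &
  forall h : R[i], normc h < r -> unit_disc (z + h).
Proof.
move=> /unit_discE Hz; exists (1 - normc z); first by rewrite subr_gt0.
by move=> h hr; apply/unit_discE; have := normcD z h; lra.
Qed.

Lemma is_cderiv_I_op f g z : holomorphic_on_disc f -> holomorphic_on_disc g -> unit_disc z ->
  is_cderiv (I_op g f) z (cderive f z * g z).
Proof.
move=> Hf Hg Hz; have [P HP HI] := I_op_cderiv Hf Hg; have [r r0 Hr] := disc_near Hz.
have D := is_cderivB (HP z Hz) (is_cderiv_cst (P 0) z); rewrite subr0 in D.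
by apply: (is_cderiv_near r0 _ D) => h /Hr Hh; rewrite HI.
Qed.

Lemma I_op0 f g : I_op g f 0 = 0.
Proof. by rewrite /I_op /segment_integral mul0r. Qed.

Lemma morrey_term_I_op_le p lambda f g M a : holomorphic_on_disc f -> holomorphic_on_disc g ->
  0 <= M -> (forall z, unit_disc z -> normc (g z) <= M) -> unit_disc a ->
  (morrey_term p lambda (I_op g f) a <= M%:E * morrey_term p lambda f a)%E.
Proof.
move=> Hf Hg M0 gM Ha; rewrite /morrey_term muleCA.
apply: lee_wpmul2l; first by rewrite lee_fin powR_ge0.
rewrite (dirichlet_norm_pullback p (fun w Hw => is_cderiv_I_op Hf Hg Hw) Ha).
rewrite (dirichlet_norm_pullback p (fun w Hw => holo_cderiv Hf Hw) Ha).
rewrite -sqrte_sqr_mul // lee_sqrt; last first.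
  by apply: mule_ge0; [rewrite lee_fin sqr_ge0|exact: energy_ge0].
apply: energy_le => //.
- by move=> z; apply: pullback_deriv_cont => // w; exact: cderive_mul_cderiv.
- by move=> z; apply: pullback_deriv_cont => // w; exact: derivative_cderiv.
move=> z Hz; rewrite /pullback_deriv (normcM (_ * _) (disc_aut' a z)).
rewrite (normcM (cderive f _) (disc_aut' a z)) (normcM (cderive f _)).
rewrite [M * _]mulrA ler_wpM2r ?normc_ge0 //.
by rewrite mulrC ler_wpM2r ?normc_ge0 //; apply: gM; exact: disc_aut_disc.
Qed.

Theorem bounded_of_H_infty p lambda g : H_infty g ->
  bounded_on_dirichlet_morrey p lambda (I_op g).
Proof.
move=> [Hg [M0 HM0]]; pose M := `|M0|; have M_ge0 : 0 <= M by exact: normr_ge0.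
have HM z : unit_disc z -> normc (g z) <= M.
  by move=> /HM0/le_trans; apply; exact: ler_norm.
have NB f : dirichlet_morrey p lambda f ->
    (dirichlet_morrey_norm p lambda (I_op g f) <= M%:E * dirichlet_morrey_norm p lambda f)%E.
  move=> [Hf _]; apply: morrey_norm_le; first exact: I_op0.
  move=> a Ha; apply: le_trans (morrey_term_I_op_le p lambda Hf Hg M_ge0 HM Ha) _.
  by apply: lee_wpmul2l; [rewrite lee_fin|exact: morrey_term_le].
split.
- move=> f Hf; split.
    by case: Hf => Hf _; apply: cderiv_holo => z; exact: is_cderiv_I_op.
  apply: le_lt_trans (NB f Hf) _; case: Hf => _ Hfin.
  by apply: lte_mul_pinfty; rewrite ?lee_fin // ?morrey_norm_ge0.
- move=> c f h [Hf _] [Hh _] z Hz.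
  have [P1 D1 E1] := I_op_cderiv Hf Hg; have [P2 D2 E2] := I_op_cderiv Hh Hg.
  have DL w : unit_disc w -> is_cderiv (fun w => c * f w + h w) w (c * cderive f w + cderive h w).
    by move=> Hw; apply: is_cderivD; [apply: is_cderivZ|]; exact: holo_cderiv.
  have HL : holomorphic_on_disc (fun w => c * f w + h w) := cderiv_holo DL.
  rewrite E1 // E2 //.
  pose F w := cderive (fun w => c * f w + h w) w * g w.
  (* Linearity follows because [c * P1 + P2] is a primitive of the integrand attached to the
     combination, and the segment integral is its increment. *)
  have DP w : unit_disc w -> is_cderiv (fun w => c * P1 w + P2 w) w (F w).
    move=> Hw; rewrite /F (cderiveE (DL w Hw)) mulrDl -mulrA.
    by apply: is_cderivD; [apply: is_cderivZ; exact: D1|exact: D2].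
  have CF w : unit_disc w -> ccont F w.
    by move=> Hw; have [l Hl] := cderive_mul_cderiv HL Hg Hw; exact: is_cderiv_cont Hl.
  have E : I_op g (fun w => c * f w + h w) z = _ := segment_integral_primitive DP CF Hz.
  by rewrite E; ring.
- by exists M.
Qed.

(** Differentiate the involution identity phi_b o phi_b = id. *)
Lemma disc_aut'_inv b z : unit_disc b -> unit_disc z ->
  disc_aut' b (disc_aut b z) * disc_aut' b z = 1.
Proof.
move=> Hb Hz; have D := pullback_cderiv (fun w Hw => disc_aut_cderiv Hb Hw) Hb Hz.
have [r r0 Hr] := disc_near Hz.
apply: is_cderiv_unique (is_cderiv_id z).
by apply: (is_cderiv_near r0 _ D) => h /Hr Hh; exact: disc_autK.
Qed.

Lemma pi_inv_le1 : (pi^-1 : R) <= 1.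
Proof. by rewrite invf_le1 ?pi_gt0 //; have := @pi_ge2 R; lra. Qed.

(** * The converse: normalized automorphisms as test functions *)

Section TestFunction.
Variables (p lambda : R) (b : R[i]).
Hypotheses (hp : 0 < p < 1) (hl : 0 < lambda < 1) (Hb : unit_disc b).

Let r := p / 2 * (1 - lambda).
Let B := 1 - normc b ^+ 2.
Let k := (B `^ r)^-1.

Let B0 : 0 < B. Proof. exact: sqr_normc_lt1. Qed.
Let Br0 : 0 < B `^ r. Proof. exact: powR_gt0. Qed.
Let k0 : 0 < k. Proof. by rewrite invr_gt0. Qed.

(* Composed with disc_aut b this is the affine function z |-> k (z - b), so the pullback
   of I_g test_fun by disc_aut b has derivative k * (g \o disc_aut b). *)
Definition test_fun z : R[i] := k%:C * (disc_aut b z - b).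

Lemma test_fun_cderiv z : unit_disc z -> is_cderiv test_fun z (k%:C * disc_aut' b z).
Proof.
move=> Hz; apply: is_cderivZ; rewrite -[disc_aut' b z]subr0.
by apply: is_cderivB; [exact: disc_aut_cderiv|exact: is_cderiv_cst].
Qed.

Lemma test_fun'_cderiv z : unit_disc z -> exists l, is_cderiv (fun z => k%:C * disc_aut' b z) z l.
Proof.
by move=> Hz; have [l Hl] := disc_aut'_cderiv Hb Hz; exists (k%:C * l); exact: is_cderivZ.
Qed.

Lemma test_fun_holo : holomorphic_on_disc test_fun.
Proof. exact: cderiv_holo test_fun_cderiv. Qed.

Lemma test_fun0 : test_fun 0 = 0.
Proof. by rewrite /test_fun disc_aut0 subrr mulr0. Qed.

Lemma energy_disc_aut' d : unit_disc d ->
  (energy p (disc_aut' d) <= (256 * (1 - normc d ^+ 2) `^ p)%:E)%E.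
Proof.
move=> Hd; have hp1 : 0 < p <= 1 by case/andP: hp => -> /ltW.
have FR := forelli_rudin hp1 Hd.
have -> : energy p (disc_aut' d) = ((pi^-1)%:E * \int[leb \x leb]_(w in @disc2 R)
     (((1 - normc d ^+ 2) / normc (1 - conjc d * (w.1 +i* w.2)) ^+ 2) ^+ 2 *
       (1 - normc (w.1 +i* w.2) ^+ 2) `^ p)%:E)%E.
  by congr (_ * _)%E; apply: eq_integral => w; rewrite inE => Hw; rewrite normc_disc_aut'.
apply: le_trans (lee_wpmul2l pi_inv_ge0 FR) _.
by rewrite -EFinM lee_fin ler_piMl ?pi_inv_le1 // mulr_ge0 // powR_ge0.
Qed.

(** The pullback by phi_a has derivative of modulus k |phi_d'| with d = phi_a(b), so its energy is
    at most 256 k^2 (1-|d|^2)^p. [moebius_weight_bound] with q = p(1-lambda) cancels k^2, leaving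
    256 * 4^p <= 32^2. *)
Lemma test_fun_term_le a : unit_disc a -> (morrey_term p lambda test_fun a <= 32%:E)%E.
Proof.
move=> Ha; rewrite /morrey_term (dirichlet_norm_pullback p test_fun_cderiv Ha) -/r.
pose d := disc_aut a b; have Hd : unit_disc d by exact: disc_aut_disc.
have A0 := sqr_normc_lt1 Ha; set A := 1 - normc a ^+ 2 in A0 *.
rewrite -sqrte_sqr_mul ?powR_ge0 //.
have E1 : (energy p (pullback_deriv (fun z => k%:C * disc_aut' b z)%R a) <=
    (k ^+ 2)%:E * energy p (disc_aut' d))%E.
  apply: energy_le.
  - by move=> z; apply: pullback_deriv_cont => // w; exact: test_fun'_cderiv.
  - by move=> z Hz; have [l Hl] := disc_aut'_cderiv Hd Hz; exact: is_cderiv_cont Hl.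
  - exact: ltW.
  - move=> z Hz; rewrite /pullback_deriv (normcM (k%:C * _)) (normcM k%:C) normc_real gtr0_norm // -mulrA.
    by rewrite normc_disc_aut_comp' // normc_disc_aut'.
have E2 : ((A `^ r) ^+ 2 * (k ^+ 2 * (256 * (1 - normc d ^+ 2) `^ p)) <= 32 ^+ 2).
  have q2 (x : R) : (x `^ r) ^+ 2 = x `^ (p * (1 - lambda)).
    by rewrite -powR_mulrn ?powR_ge0 // -powRrM; congr (_ `^ _); rewrite /r; field.
  have hq : 0 <= p * (1 - lambda) <= p.
    by case/andP: hp => ? ?; case/andP: hl => ? ?; apply/andP; split; nra.
  have W := moebius_weight_bound hq Ha Hb; rewrite -/A -/B -/d in W.
  rewrite /k exprVn !q2.
  have Bq : 0 < B `^ (p * (1 - lambda)) by exact: powR_gt0.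
  have P4 : 4 `^ p <= 4 :> R.
    rewrite -[X in _ <= X]powRr1 //; apply: ler_powR; first by lra.
    by case/andP: hp => _ /ltW.
  have -> : A `^ (p * (1 - lambda)) * ((B `^ (p * (1 - lambda)))^-1 * (256 * (1 - normc d ^+ 2) `^ p)) =
    256 * (A `^ (p * (1 - lambda)) * (1 - normc d ^+ 2) `^ p) / B `^ (p * (1 - lambda)) by ring.
  by rewrite ler_pdivrMr //; nra.
apply: (@le_trans _ _ (sqrte (32 ^+ 2)%:E)); last by rewrite /= sqrtr_sqr ger0_norm.
rewrite lee_sqrt ?lee_fin ?sqr_ge0 //.
apply: le_trans (lee_wpmul2l _ E1) _; first by rewrite lee_fin sqr_ge0.
apply: le_trans (lee_wpmul2l _ (lee_wpmul2l _ (energy_disc_aut' Hd))) _; rewrite ?lee_fin ?sqr_ge0 //.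
Qed.

Lemma test_fun_norm_le : (dirichlet_morrey_norm p lambda test_fun <= 32%:E)%E.
Proof. by apply: morrey_norm_le test_fun0 _ => a; exact: test_fun_term_le. Qed.

Lemma test_fun_morrey : dirichlet_morrey p lambda test_fun.
Proof.
split; first exact: test_fun_holo.
by apply: le_lt_trans test_fun_norm_le _; rewrite ltry.
Qed.

Lemma I_op_test_fun_ge g : holomorphic_on_disc g ->
  (sqrte (energy p (fun z => g (disc_aut b z))) <=
   dirichlet_morrey_norm p lambda (I_op g test_fun))%E.
Proof.
move=> Hg; apply: le_trans (morrey_term_le p lambda (I_op g test_fun) Hb).
rewrite /morrey_term -/r -/B.
rewrite (dirichlet_norm_pullback p (fun w Hw => is_cderiv_I_op test_fun_holo Hg Hw) Hb).
rewrite -sqrte_sqr_mul ?powR_ge0 // lee_sqrt; last first.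
  by apply: mule_ge0; [rewrite lee_fin sqr_ge0|exact: energy_ge0].
apply: energy_le.
- move=> z Hz; apply: is_cderiv_cont (is_cderiv_comp (disc_aut_cderiv Hb Hz) (holo_cderiv Hg _)).
  exact: disc_aut_disc.
- move=> z Hz; apply: (pullback_deriv_cont _ Hb Hz) => w Hw.
  exact: (cderive_mul_cderiv test_fun_holo Hg Hw).
- exact: powR_ge0.
move=> z Hz; have Hw := disc_aut_disc Hb Hz.
rewrite /pullback_deriv (cderiveE (test_fun_cderiv Hw)).
(* The two derivative factors multiply to 1, leaving [k * g], and the Morrey weight B^r is the
   inverse of [k]. *)
have -> : k%:C * disc_aut' b (disc_aut b z) * g (disc_aut b z) * disc_aut' b z =
  k%:C * g (disc_aut b z) * (disc_aut' b (disc_aut b z) * disc_aut' b z) by ring.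
rewrite disc_aut'_inv // mulr1 normcM normc_real gtr0_norm // mulrA /k divff ?mul1r //.
by rewrite gt_eqF.
Qed.

(** The modulus of (g o phi_b)^2 is the energy density of g o phi_b, so the L^1 point bound reads as
    an energy bound. The factor pi undoes the normalization of area. *)
Lemma point_value_le g K : holomorphic_on_disc g -> 0 <= K ->
  (dirichlet_morrey_norm p lambda (I_op g test_fun) <= K%:E)%E ->
  normc (g b) ^+ 2 <= 432 * 2 * (pi * K ^+ 2).
Proof.
move=> Hg K0 H; have S := le_trans (I_op_test_fun_ge Hg) H.
pose E z := g (disc_aut b z) ^+ 2.
have HE z : unit_disc z -> exists l, is_cderiv E z l.
  move=> Hz; have D := is_cderiv_comp (disc_aut_cderiv Hb Hz) (holo_cderiv Hg (disc_aut_disc Hb Hz)).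
  by eexists; exact: (is_cderivM D D).
have hp1 : 0 <= p <= 1 by case/andP: hp => /ltW -> /ltW.
have PB := point_bound hp1 HE.
have E0 : normc (E 0) = normc (g b) ^+ 2 by rewrite /E disc_aut0 normcX.
have pi0 : (0 < pi :> R) by exact: pi_gt0.
have IE : (\int[leb \x leb]_(w in @disc2 R)
     (normc (E (w.1 +i* w.2)) * (1 - normc (w.1 +i* w.2) ^+ 2) `^ p)%:E =
    pi%:E * energy p (fun z => g (disc_aut b z)))%E.
  rewrite /energy /disc_integral muleA -EFinM divff ?gt_eqF // mul1e.
  by apply: eq_integral => w _; rewrite /E normcX.
have EK : (energy p (fun z => g (disc_aut b z)) <= (K ^+ 2)%:E)%E.
  rewrite -lee_sqrt ?lee_fin ?sqr_ge0 // /= sqrtr_sqr ger0_norm //.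
rewrite IE E0 in PB; rewrite -lee_fin; apply: le_trans PB _.
rewrite [X in (_ <= X)%E]EFinM; apply: lee_wpmul2l; first by rewrite lee_fin mulr_ge0 ?ler0n.
by rewrite EFinM; apply: lee_wpmul2l EK; rewrite lee_fin ltW.
Qed.

End TestFunction.

Theorem H_infty_of_bounded p lambda g : 0 < p < 1 -> 0 < lambda < 1 ->
  holomorphic_on_disc g -> bounded_on_dirichlet_morrey p lambda (I_op g) -> H_infty g.
Proof.
move=> hp hl Hg [_ _ [C C0 HC]]; split=> //.
(* The Morrey norm of I_g of the test function is at most [C * 32] for every [b], so the bound on
   |g(b)| is uniform. *)
exists (Num.sqrt (432 * 2 * (pi * (C * 32) ^+ 2))) => b Hb.
have CK : 0 <= C * 32 by rewrite mulr_ge0.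
rewrite -[normc (g b)]ger0_norm ?normc_ge0 // -sqrtr_sqr ler_wsqrtr //.
apply: (point_value_le hp Hb Hg CK (lambda := lambda)).
apply: le_trans (HC _ (test_fun_morrey hp hl Hb)) _; rewrite EFinM.
by apply: lee_wpmul2l; [rewrite lee_fin|exact: test_fun_norm_le].
Qed.

End DirichletMorrey.

Theorem theorem2 (R : realType) (p lambda : R) (g : R[i] -> R[i])
    (hp0 : 0 < p) (hp1 : p < 1) (hlambda0 : 0 < lambda) (hlambda1 : lambda < 1)
    (hg : holomorphic_on_disc g) :
  bounded_on_dirichlet_morrey p lambda (I_op g) <-> H_infty g.

Proof.
have hp : 0 < p < 1 by rewrite hp0.
have hl : 0 < lambda < 1 by rewrite hlambda0.
by split; [exact: H_infty_of_bounded|exact: bounded_of_H_infty].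
Qed.
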